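(* Let $K\in L^\infty(B_R)$ (with $\operatorname{ess\,inf}K>0$) and $1<q\le\infty$. Then there exist $\mathbf a$ and $\mathbf b$ satisfying the uniform ellipticity condition (E) and the growth condition (B) of the context, respectively, such that $$p^*=q$$ and $\Psi_g$ oscillates around $2$ for all $g\in GL_N$, in the sense that $$\underline{\underline{\Psi}}<2\le\overline{\overline{\Psi}}.$$
   Context: $N\ge1$, $B_R\subset\mathbb{R}^N$ is the open ball of radius $R>0$ centered at the origin. For $\mathbf a=(a_{ij}(x))$ and $\mathbf b=(b_i(x))$ let $\mathscr{L}u=\sum_{i,j=1}^N a_{ij}(x)\frac{\partial^2u}{\partial x_i\partial x_j}+\sum_{i=1}^N b_i(x)\frac{\partial u}{\partial x_i}$. (E): $\mathbf a\in L^\infty(B_R)$ is a.e. symmetric and there is $\nu>1$ with $\nu^{-1}|\xi|^2\le\sum_{i,j}a_{ij}(x)\xi_i\xi_j\le\nu|\xi|^2$ for all $\xi\in\mathbb{R}^N$ and a.a. $x\in B_R\setminus\{0\}$. (B): $\mathbf b\in L^\infty_{\rm loc}(B_R\setminus\{0\})$ and there is $c>0$ with $|b_i(x)|\le c/|x|$ for a.a. $x\in B_R\setminus\{0\}$, $1\le i\le N$. For $p\in\mathbb{R}$, $(1)_p$ denotes the inequality $\mathscr{L}u\ge K(x)u^p$ a.e. in a punctured ball. A solution to $(1)_p$ is a function $u>0$ for which there is some (small) radius $R'\in(0,R]$ such that $u\in W^{2,N}(B_{R'}\setminus\overline B_\varepsilon)$ for all $\varepsilon\in(0,R')$ and $\mathscr{L}u\ge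 Ku^p$ a.e. on $B_{R'}\setminus\{0\}$. It is a singular solution if $\limsup_{|x|\to0}u(x)=\infty$. Critical exponent: $p^*:=\inf\{p>1:(1)_p\text{ has no singular solution}\}$ (with $\inf\emptyset=+\infty$). For $g\in GL_N$ let $\mathbf a_g(x):=g\,\mathbf a(g^{-1}x)\,g^\top$, $\mathbf b_g(x):=g\,\mathbf b(g^{-1}x)$ and $$\Psi_g(x):=\frac{\operatorname{Tr}\mathbf a_g(x)+\mathbf b_g(x)\cdot x}{(\mathbf a_g(x)x,x)/|x|^2},$$ $$\overline{\overline{\Psi}}:=\inf_{g\in GL_N}\lim_{r\to0}\operatorname*{ess\,sup}_{x\in B_r}\Psi_g(x),\qquad \underline{\underline{\Psi}}:=\sup_{g\in GL_N}\lim_{r\to0}\operatorname*{ess\,inf}_{x\in B_r}\Psi_g(x).$$ *)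

(* Defs.v *)
From HB Require Import structures.
From mathcomp Require Import all_boot all_order all_algebra.
From mathcomp Require Import all_classical all_reals all_analysis.

Set Implicit Arguments.
Unset Strict Implicit.
Unset Printing Implicit Defensive.

Import Order.TTheory GRing.Theory Num.Theory.
Import numFieldNormedType.Exports.

Local Open Scope classical_set_scope.
Local Open Scope ring_scope.

Definition measure_cV_display : measure_display.
Proof. exact: default_measure_display. Qed.

Section cV_measurable.
Context {R : realType} {n : nat}.

(* The sigma-algebra generated by the coordinates (the same construction as the
   one the library uses for [n.-tuple]); it is the Borel sigma-algebra. *)
Definition cV_measurable : set (set 'cV[R]_n) :=
  g_sigma_preimage (fun (i : 'I_n) (x : 'cV[R]_n) => x i 0).

Let cV_set0 : cV_measurable set0.
Proof. exact: sigma_algebra0. Qed.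

Let cV_setC A : cV_measurable A -> cV_measurable (~` A).
Proof. exact: sigma_algebraC. Qed.

Let cV_bigcup (F : (set 'cV[R]_n)^nat) :
  (forall i, cV_measurable (F i)) -> cV_measurable (\bigcup_i F i).
Proof. exact: sigma_algebra_bigcup. Qed.

HB.instance Definition _ := @isMeasurable.Build measure_cV_display
  'cV[R]_n cV_measurable cV_set0 cV_setC cV_bigcup.

End cV_measurable.

Lemma measurable_cV_coord (R : realType) (n : nat) (i : 'I_n) :
  measurable_fun [set: 'cV[R]_n] (fun x : 'cV[R]_n => x i 0).
Proof.
move=> _ Y mY; rewrite setTI; apply: sub_sigma_algebra => /=.
rewrite -bigcup_seq/=; exists i => /=; first by rewrite mem_index_enum.
by exists Y => //; rewrite setTI.
Qed.

Lemma measurable_fun_cV d (T : measurableType d) (R : realType) (n : nat)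
    (f : T -> 'cV[R]_n) :
  (forall i, measurable_fun [set: T] (fun t => f t i 0)) ->
  measurable_fun [set: T] f.
Proof.
move=> mf.
suff H : @cV_measurable R n `<=` [set A | measurable (f @^-1` A)].
  by move=> _ A mA; rewrite setTI; exact: H.
apply: smallest_sub.
  split=> /=.
  - by rewrite preimage_set0.
  - by move=> A mA; rewrite setTD preimage_setC; exact: measurableC.
  - by move=> F mF; rewrite preimage_bigcup; exact: bigcup_measurable.
rewrite -bigcup_seq; apply: bigcup_sub => i _ A [B mB <-] /=.
by have := mf i measurableT _ mB; rewrite !setTI.
Qed.

Section cV_product.
Context {R : realType} {n : nat}.

Definition cV_cons (p : 'cV[R]_n * measurableTypeR R) : 'cV[R]_n.+1 :=
  \col_i oapp (fun j => p.1 j 0) p.2 (unlift ord0 i).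

Definition cV_uncons (x : 'cV[R]_n.+1) : 'cV[R]_n * measurableTypeR R :=
  (\col_j x (lift ord0 j) 0, x ord0 0).

Lemma cV_consK : cancel cV_cons cV_uncons.
Proof.
move=> [x t]; rewrite /cV_uncons /cV_cons mxE unlift_none/=; congr pair.
by apply/matrixP => i j; rewrite !mxE liftK/= !ord1.
Qed.

Lemma measurable_cV_cons : measurable_fun [set: _] cV_cons.
Proof.
apply: measurable_fun_cV => i; rewrite /cV_cons.
case: (unliftP ord0 i) => [j|] ->.
- rewrite (_ : (fun _ => _) =
      (fun x : 'cV[R]_n => x j 0) \o @fst 'cV[R]_n (measurableTypeR R)).
    by apply: measurableT_comp; [exact: measurable_cV_coord|].
  by apply/funext => p; rewrite mxE liftK.
- rewrite (_ : (fun _ => _) = @snd 'cV[R]_n (measurableTypeR R)) //.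
  by apply/funext => p; rewrite mxE unlift_none.
Qed.

Lemma measurable_cV_uncons : measurable_fun [set: _] cV_uncons.
Proof.
apply: measurable_fun_pair; last exact: (@measurable_cV_coord R n.+1 ord0).
apply: measurable_fun_cV => j.
rewrite (_ : (fun _ => _) = (fun x : 'cV[R]_n.+1 => x (lift ord0 j) 0)).
  exact: measurable_cV_coord.
by apply/funext => x; rewrite /= mxE.
Qed.

Variable mu : {sigma_finite_measure set 'cV[R]_n -> \bar R}.

Definition cV_prod : set 'cV[R]_n.+1 -> \bar R :=
  pushforward (mu \x lebesgue_measure)%E cV_cons.

Let m : {measure set _ -> \bar R} := (mu \x @lebesgue_measure R)%E.

Let mpre A : measurable A -> measurable (cV_cons @^-1` A).
Proof. by move=> mA; rewrite -[X in measurable X]setTI; exact: measurable_cV_cons. Qed.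

Let cV_prod0 : cV_prod set0 = 0%E.
Proof. by rewrite /cV_prod /pushforward preimage_set0 measure0. Qed.

Let cV_prod_ge0 A : (0 <= cV_prod A)%E.
Proof. exact: (measure_ge0 m). Qed.

Let cV_prod_sigma_additive : semi_sigma_additive cV_prod.
Proof.
move=> F mF tF mUF; rewrite /cV_prod /pushforward preimage_bigcup.
apply: (@measure_semi_sigma_additive _ _ _ m).
- by move=> k; exact: mpre.
- apply/trivIsetP => i j _ _ ij; rewrite -preimage_setI.
  by move/trivIsetP : tF => /(_ _ _ _ _ ij) ->//; rewrite preimage_set0.
- by rewrite -preimage_bigcup; exact: mpre.
Qed.

HB.instance Definition _ := isMeasure.Build _ _ _ cV_prod
  cV_prod0 cV_prod_ge0 cV_prod_sigma_additive.

Let cV_prod_sigma_finite : sigma_finite setT cV_prod.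
Proof.
have /sigma_finiteP[F [FT ndF mF]] := sigma_finiteT mu.
have /sigma_finiteP[G [GT ndG mG]] := sigma_finiteT (@lebesgue_measure R).
exists (fun k => cV_uncons @^-1` (F k `*` G k)).
  rewrite -preimage_bigcup (_ : \bigcup_k _ = setT) ?preimage_setT//.
  rewrite -subTset => -[x t] _.
  have [i _ Fix] : (\bigcup_i F i) x by rewrite -FT.
  have [j _ Gjt] : (\bigcup_i G i) t by rewrite -GT.
  exists (maxn i j) => //; split => /=.
  - by move: x Fix; exact/subsetPset/ndF/leq_maxl.
  - by move: t Gjt; exact/subsetPset/ndG/leq_maxr.
move=> k; have [mFk Fk] := mF k; have [mGk Gk] := mG k; split.
  rewrite -[X in measurable X]setTI; apply: measurable_cV_uncons => //.
  exact: measurableX.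
rewrite /cV_prod /pushforward -comp_preimage.
rewrite (_ : cV_uncons \o cV_cons = id); last first.
  by apply/funext => p; exact: cV_consK.
by rewrite preimage_id product_measure1E// lte_mul_pinfty// ge0_fin_numE.
Qed.

HB.instance Definition _ := Measure_isSigmaFinite.Build _ _ _ cV_prod
  cV_prod_sigma_finite.

End cV_product.

(* Lebesgue measure on [R^n] as an iterated product, restricted to the Borel
   sets; [cV_prod] is, up to [cV_cons], the product with the one-dimensional
   Lebesgue measure. *)
Fixpoint leb {R : realType} (n : nat) :
    {sigma_finite_measure set 'cV[R]_n -> \bar R} :=
  match n with
  | 0 => dirac (0 : 'cV[R]_0)
  | k.+1 => cV_prod (leb k)
  end.

Section euclidean.
Context {R : realType} {n : nat}.
Implicit Types (x y : 'cV[R]_n) (D : set 'cV[R]_n).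

Definition dot x y : R := \sum_i x i 0 * y i 0.

(* The norm [`|x|] that the library puts on matrices is the sup norm: it induces
   the usual topology, but its balls are cubes. *)
Definition enorm x : R := Num.sqrt (dot x x).

Definition eball (r : R) : set 'cV[R]_n := [set x | enorm x < r].

Definition pball (r : R) : set 'cV[R]_n := eball r `\ 0.

(* [B_r] minus the closure of [B_e] *)
Definition annulus (e r : R) : set 'cV[R]_n := [set x | e < enorm x < r].

(* [ess_sup] and [ess_inf] of the library, relative to a subset [D] *)
Definition ess_sup_on D (f : 'cV[R]_n -> \bar R) : \bar R :=
  ereal_inf [set y | {ae leb n, forall x, D x -> (f x <= y)%E}].

Definition ess_inf_on D (f : 'cV[R]_n -> \bar R) : \bar R :=
  ereal_sup [set y | {ae leb n, forall x, D x -> (y <= f x)%E}].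

(* Measurability is with respect to the Borel sigma-algebra: every class of
   functions modulo null sets has a Borel representative, and what is required
   below of [K], [a] and [b] only depends on the class. *)
Definition Linfty D (f : 'cV[R]_n -> R) : Prop :=
  measurable_fun D f /\ (ess_sup_on D (fun x => `|f x|%:E) < +oo)%E.

Definition Linfty_loc D (f : 'cV[R]_n -> R) : Prop :=
  forall C : set 'cV[R]_n, compact C -> C `<=` D -> Linfty C f.

Definition Lp (p : R) D (f : 'cV[R]_n -> R) : Prop :=
  measurable_fun D f /\ (\int[leb n]_(x in D) (`|f x| `^ p)%:E < +oo)%E.

Definition L1_loc D (f : 'cV[R]_n -> R) : Prop :=
  measurable_fun D f /\
  forall C : set 'cV[R]_n, compact C -> C `<=` D ->
    (\int[leb n]_(x in C) `|f x|%:E < +oo)%E.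

End euclidean.

Section sobolev.
Context {R : realType} {n : nat}.
Implicit Types (D : set 'cV[R]_n) (u v phi : 'cV[R]_n -> R) (s : seq 'I_n).

(* A multi-index is given by the list of the differentiation directions, so that
   [pderiv [:: i; j] u] is the second derivative of [u] with respect to [x_i]
   and [x_j], and the order of the derivative is [size s]. *)
Definition pderiv s u : 'cV[R]_n -> R :=
  foldr (fun i f => 'D_(delta_mx i 0) f) u s.

Definition smooth phi : Prop :=
  forall s x, differentiable (pderiv s phi) x.

Definition test_function D phi : Prop :=
  let supp := closure [set x | phi x != 0] in
  [/\ smooth phi, compact supp & supp `<=` D].

Definition weak_derivative D s u v : Prop :=
  [/\ L1_loc D u, L1_loc D v &
    forall phi, test_function D phi ->
      \int[leb n]_(x in D) (u x * pderiv s phi x) =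
      (-1) ^+ size s * \int[leb n]_(x in D) (v x * phi x)].

(* [u] belongs to [W^{k,p}(D)], and [du s] is its weak derivative of
   multi-index [s] for every [s] of order at most [k] *)
Definition sobolev_with (k : nat) (p : R) D u (du : seq 'I_n -> 'cV[R]_n -> R) :
    Prop :=
  forall s, (size s <= k)%N -> weak_derivative D s u (du s) /\ Lp p D (du s).

End sobolev.

Section operator.
Context {R : realType} {N : nat}.
Local Notation V := 'cV[R]_N.
Implicit Types (r p : R) (a : V -> 'M[R]_N) (b : V -> V) (K u : V -> R).

Definition elliptic r a : Prop :=
  [/\ forall i j, Linfty (eball r) (fun x => a x i j),
      {ae leb N, forall x, eball r x -> (a x)^T = a x} &
      exists2 nu : R, 1 < nu &
        {ae leb N, forall x, pball r x -> forall xi : V,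
          nu^-1 * enorm xi ^+ 2 <=
            \sum_i \sum_j a x i j * xi i 0 * xi j 0 <= nu * enorm xi ^+ 2}].

Definition drift_growth r b : Prop :=
  (forall i, Linfty_loc (pball r) (fun x => b x i 0)) /\
  exists2 c : R, 0 < c &
    {ae leb N, forall x, pball r x -> forall i, `|b x i 0| <= c / enorm x}.

(* [du] is the family of the weak derivatives of the function the operator is
   applied to. *)
Definition Lop a b (du : seq 'I_N -> V -> R) (x : V) : R :=
  \sum_i \sum_j a x i j * du [:: i; j] x + \sum_i b x i 0 * du [:: i] x.

(* As [W^{2,N}] functions of [N] variables are continuous (up to a null set),
   [u] is taken to be its continuous representative, which gives a meaning to
   [u > 0] and to the pointwise upper limit in [singular_solution].  The
   values of [u] outside the punctured ball of radius [r'] are irrelevant.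
   The weak derivatives on the annuli agree on overlaps, hence a single family
   [du] serves for all of them. *)
Definition solution r a b K p u : Prop :=
  exists2 r' : R, 0 < r' <= r &
  exists du : seq 'I_N -> V -> R,
    [/\ forall x, pball r' x -> 0 < u x,
        forall x, pball r' x -> {for x, continuous u},
        forall e : R, 0 < e < r' ->
          sobolev_with 2 N%:R (annulus e r') u du &
        {ae leb N, forall x, pball r' x -> K x * u x `^ p <= Lop a b du x}].

Definition singular_solution r a b K p u : Prop :=
  solution r a b K p u /\ limf_esup (EFin \o u) (0 : V)^' = +oo%E.

Definition critical_exponent r a b K : \bar R :=
  ereal_inf [set p%:E | p in
    [set p : R | 1 < p /\ ~ exists u, singular_solution r a b K p u]].

Definition transport_mx a (g : 'M[R]_N) (x : V) : 'M[R]_N :=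
  g *m a (invmx g *m x) *m g^T.

Definition transport_cV b (g : 'M[R]_N) (x : V) : V :=
  g *m b (invmx g *m x).

Definition Psi a b (g : 'M[R]_N) (x : V) : R :=
  (\tr (transport_mx a g x) + dot (transport_cV b g x) x) /
  (dot (transport_mx a g x *m x) x / enorm x ^+ 2).

Definition Psi_sup a b : \bar R :=
  ereal_inf [set lim (ess_sup_on (eball r) (EFin \o Psi a b g) @[r --> 0^'+])
            | g in [set g : 'M[R]_N | g \in unitmx]].

Definition Psi_inf a b : \bar R :=
  ereal_sup [set lim (ess_inf_on (eball r) (EFin \o Psi a b g) @[r --> 0^'+])
            | g in [set g : 'M[R]_N | g \in unitmx]].

End operator.

(* Main.v *)
Require Import Defs.
From mathcomp Require Import all_boot all_order all_algebra.
From mathcomp Require Import all_classical all_reals all_analysis.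
From mathcomp Require Import measurable_realfun.
From mathcomp Require Import ring lra.

(** The coefficients are [a = 1] and the radial field [b = grad W], where
    [W = w (ln |x|)]. In the variable [t = ln |x|] the operator acts on a radial
    function [f] by [|x|^2 L f = f'' + (n - 2 + w') f']. Let
    [s (t) = t + sin (om t) / (2 om)]; its derivative [s' = 1 + cos (om t) / 2] stays
    between [1/2] and [3/2], and [s - t] is bounded. The slope
    [w' = 2 - n - s'' / s' + mb s'] is the one for which, in the variable [s],
    [|x|^2 L f = s'^2 (f_ss + mb f_s)]. Up to bounded factors this is an operator with
    constant coefficients: [exp (- mb s)] is a solution of the homogeneous equation,
    comparable to [|x| ^ - mb], and the critical exponent is [q = 1 + 2 / mb]
    (infinite for [mb = 0]). The term [s'' / s'] does not affect this exponent, but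
    makes [w'] oscillate with an amplitude of order [om], which is at our disposal.

    Below [q], the function [exp (- al s)] with [mb < al < 2 / (p - 1)] is a singular
    solution ([singular_solution_exists]). Above [q], it suffices to treat
    [q < p <= q + 1], as the critical exponent is an infimum. In the variable
    [tau = exp (- mb s)] the operator reduces to a second derivative, and
    [D tau (1 - tau / T) ^ - m] is a Keller-Osserman barrier: a supersolution which is
    infinite on a small sphere around the origin, and in which [D] may be taken
    arbitrarily small provided that [T] is large. Hence a solution is bounded near the
    origin by its maximum on a sphere ([solution_le_sphere], [no_singular_solution]).

    The comparison with the barrier takes place at a point where a weak subsolution [u]
    is touched from above by a smooth function [psi], which must then be a subsolution
    at that point ([weak_touch]). As the drift is a gradient, multiplication by
    [exp (W / 2)] turns the difference into a distribution whose Laplacian is positive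
    near the point, while it has a maximum there. This is excluded by the
    monotonicity in the radius of mean values against a well chosen kernel
    ([subharmonic_touch]), once smooth functions are known to satisfy integration by
    parts ([integral_by_parts]).

    Finally, [Psi g] at the image under [g] of a point of the [i]-th axis, [i] being the
    index of the longest column of [g], is at most [0] when [w' <= - n] and at least
    [2] when [w' >= 2 n]. For large [om] both occur arbitrarily close to the origin, and
    [Psi g] is continuous there, which bounds its essential infimum and supremum on
    every ball ([Psi_oscillates]). *)

Set Implicit Arguments.
Unset Strict Implicit.
Unset Printing Implicit Defensive.

Import Order.TTheory GRing.Theory Num.Theory.
Import numFieldNormedType.Exports.

Local Open Scope classical_set_scope.
Local Open Scope ring_scope.

(** * Cubes and Lebesgue measure *)

Section cubes.
Context {R : realType} {n : nat}.
Implicit Types (x c : 'cV[R]_n) (r : R).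

(** The open balls of the sup norm, for which both the topology and the measure
    are explicit. *)
Definition cube c r : set 'cV[R]_n := [set x | forall i, `|x i 0 - c i 0| < r].

Lemma ballE_cube c r : 0 < r -> ball c r = cube c r.
Proof.
move=> r0; apply/seteqP; split=> [x [_ h] i|x h].
  by rewrite distrC; exact: h.
by split => // i j; rewrite [j]ord1 /ball/= distrC; exact: h.
Qed.

Lemma nbhs_cubeP c (A : set 'cV[R]_n) :
  nbhs c A <-> exists2 r, 0 < r & cube c r `<=` A.
Proof.
split=> [/nbhs_ballP[e/= e0 H]|[e e0 H]].
  by exists e => //; rewrite -ballE_cube.
by apply/nbhs_ballP; exists e => //=; rewrite ballE_cube.
Qed.

Lemma coord_norm_le x i : `|x i 0| <= `|x|.
Proof.
rewrite [leRHS]mx_normrE; apply/bigmax_geP; right => /=.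
by exists (i, 0).
Qed.

Lemma measurable_cube c r : measurable (cube c r).
Proof.
have -> : cube c r = \bigcap_(i in [set` 'I_n])
    ((fun x : 'cV[R]_n => x i 0) @^-1` [set t | `|t - c i 0| < r]).
  by apply/seteqP; split => [x h i _|x h i]; [exact: h|exact: (h i)].
apply: fin_bigcap_measurable => // i _.
rewrite -[X in measurable X]setTI; apply: measurable_cV_coord => //.
have -> : [set t | `|t - c i 0| < r] = `]c i 0 - r, c i 0 + r[%classic.
  by apply/seteqP; split=> t /=; rewrite in_itv/= ltr_distl.
exact: measurable_itv.
Qed.

(** The sigma-algebra is generated by the coordinates; an open set is the countable
    union of the rational cubes which it contains. *)
Lemma open_measurable_cV (A : set 'cV[R]_n) : open A -> measurable A.
Proof.
move=> oA.
pose B (k : nat) : set 'cV[R]_n :=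
  if (unpickle k : option ('cV[rat]_n * nat)%type) is Some (q, m) then
    let C := cube (map_mx ratr q) m.+1%:R^-1 in
    if `[< C `<=` A >] then C else set0
  else set0.
suff -> : A = \bigcup_k B k.
  apply: bigcupT_measurable => k; rewrite /B.
  case: unpickle => [[q m]|] //; case: asboolP => // _.
  exact: measurable_cube.
apply/seteqP; split=> [x Ax|x [k _]]; last first.
  by rewrite /B; case: unpickle => [[q m]|] //; case: asboolP => // h /h.
have /nbhs_cubeP[r r0 rA] : nbhs x A by exact: open_nbhs_nbhs.
have [m mr] : exists m : nat, m.+1%:R^-1 < r / 2.
  have := @near_infty_natSinv_lt R (PosNum (divr_gt0 r0 (ltr0Sn R 1))).
  by move=> [m _ H]; exists m; apply: H => /=.
have m0 : (0 : R) < m.+1%:R^-1 by rewrite invr_gt0.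
have H i : exists q : rat, `|x i 0 - ratr q| < m.+1%:R^-1.
  have [q] := rat_in_itvoo (ltr_pwDr m0 (lexx (x i 0))).
  rewrite in_itv/= => /andP[q1 q2]; exists q.
  by rewrite distrC gtr0_norm ?subr_gt0// ltrBlDl.
have {H} [q Hq] := choice H.
pose Q : 'cV[rat]_n := \col_i q i.
exists (pickle (Q, m)) => //; rewrite /B pickleK.
case: asboolP => [_ i|]; first by rewrite !mxE; exact: Hq.
move=> h; exfalso; apply: h => y Hy; apply: rA => i.
have := Hy i; have := Hq i; rewrite !mxE => h1 h2.
rewrite (_ : _ - _ = (y i 0 - ratr (q i)) - (x i 0 - ratr (q i))); last by ring.
by rewrite (le_lt_trans (ler_normB _ _))// [ltRHS]splitr ltrD// (lt_trans _ mr).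
Qed.

Lemma measurable_fun_continuous_open (O : set 'cV[R]_n) (f : 'cV[R]_n -> R) :
  open O -> (forall x, O x -> {for x, continuous f}) -> measurable_fun O f.
Proof.
move=> oO cf mO; apply: (measurability _
  (RGenOpens.measurableE R)) => // _ [_ [a [b ->]] <-].
apply: open_measurable_cV.
rewrite openE => x [Ox fx] /=; apply: filterI; first exact: open_nbhs_nbhs.
by apply: (cf x Ox); apply: open_nbhs_nbhs; split => //; exact: interval_open.
Qed.

Lemma measurable_fun_continuous (f : 'cV[R]_n -> R) :
  continuous f -> measurable_fun setT f.
Proof.
move=> cf; apply: measurable_fun_continuous_open; first exact: openT.
by move=> x _; exact: cf.
Qed.

End cubes.

(** The measure is an iterated product, and cubes are iterated products of intervals. *)
Lemma leb_cube (R : realType) n (c : 'cV[R]_n) r : 0 <= r ->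
  leb n (cube c r) = ((r *+ 2) ^+ n)%:E.
Proof.
move=> r0; elim: n c => [|n IH] c.
  rewrite /= diracE mem_set ?expr0// => -[].
  by [].
rewrite /= /cV_prod /pushforward.
have -> : cV_cons @^-1` cube c r =
    cube (\col_j c (lift ord0 j) 0) r `*` ball (c ord0 0) r.
  apply/seteqP; split=> [[x t] /= h|[x t] [/= h1 h2] i].
    split=> [i|] /=.
      by have := h (lift ord0 i); rewrite !mxE liftK.
    by have := h ord0; rewrite !mxE unlift_none /= distrC.
  rewrite mxE; case: (unliftP ord0 i) => [j|] -> /=.
    by have := h1 j; rewrite mxE.
  by rewrite distrC.
rewrite product_measure1E//; last 2 first.
- exact: measurable_cube.
- by apply: open_measurable; exact: ball_open.
apply: etrans (congr2 mule (IH _) (lebesgue_measure_ball _ r0)) _.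
by rewrite -EFinM -exprSr.
Qed.

Section null_and_finite.
Context {R : realType} {n : nat}.

(** A neighbourhood contains a cube, which is not null. *)
Lemma ae_open_exists (P : set 'cV[R]_n) (x : 'cV[R]_n) (A : set 'cV[R]_n) :
  {ae leb n, forall x, P x} -> nbhs x A -> exists2 y, A y & P y.
Proof.
move=> aeP /nbhs_cubeP[r r0 rA]; apply: contrapT => hn.
have : (leb n).-negligible (cube x r).
  by apply: negligibleS aeP => y /rA Ay /= Py; apply: hn; exists y.
move/measure_negligible => /(_ (measurable_cube _ _)) /eqP.
apply/negP; have := leb_cube x (ltW r0); rewrite /= => ->.
by rewrite eqe gt_eqF// exprn_gt0// mulrn_wgt0.
Qed.

Lemma leb_cube_fin (c : 'cV[R]_n) r : 0 <= r -> (leb n (cube c r) < +oo)%E.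
Proof. by move=> r0; rewrite leb_cube// ltry. Qed.

Lemma leb_sub_cube_fin (c : 'cV[R]_n) r (A : set 'cV[R]_n) :
  measurable A -> A `<=` cube c r -> 0 <= r -> (leb n A < +oo)%E.
Proof.
move=> mA Ac r0; apply: le_lt_trans (leb_cube_fin c r0).
by apply: le_measure => //; rewrite inE//; exact: measurable_cube.
Qed.

Lemma integrable_bounded_cube (c : 'cV[R]_n) r M (f : 'cV[R]_n -> R) :
  measurable_fun setT f -> 0 <= r -> (forall x, `|f x| <= M) ->
  (forall x, ~ cube c r x -> f x = 0) ->
  (leb n).-integrable setT (EFin \o f).
Proof.
move=> mf r0 fM f0.
have -> : (EFin \o f) = (EFin \o f) \_ (cube c r).
  apply/funext => x; rewrite patchE; case: ifPn => //=.
  by move/negP; rewrite inE => /f0 ->.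
apply/(integrable_mkcond _ (measurable_cube c r)).
apply: measurable_bounded_integrable.
- exact: measurable_cube.
- exact: leb_cube_fin.
- exact: measurable_funTS.
- exists M; split; first exact: num_real.
  by move=> N /ltW MN x _ /=; apply: le_trans MN.
Qed.

End null_and_finite.

(** * Compactness and the divergence theorem *)

Lemma mx_norm_leP (R : realType) m n (x : 'M[R]_(m, n)) N : 0 <= N ->
  `|x| <= N <-> (forall i j, `|x i j| <= N).
Proof.
move=> N0; rewrite [leLHS]mx_normrE; split=> [/bigmax_leP[_ h] i j|h].
  exact: (h (i, j)).
by apply/bigmax_leP; split => // -[i j] _ /=.
Qed.

Section compactness.
Context {R : realType} {n : nat}.

(** The Heine-Borel theorem for row vectors, transposed. *)
Lemma bounded_closed_compact_cV (B : set 'cV[R]_n) :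
  bounded_set B -> closed B -> compact B.
Proof.
move=> [M [Mr bA]] cA.
have ct1 : continuous (fun x : 'rV[R]_n => x^T).
  move=> x A /nbhs_ballP[e e0 hA]; apply/nbhs_ballP; exists e => // y [_ h].
  by apply: hA; split=> // i j; rewrite !mxE; exact: h.
have ct2 : continuous (fun x : 'cV[R]_n => x^T).
  move=> x A /nbhs_ballP[e e0 hA]; apply/nbhs_ballP; exists e => // y [_ h].
  by apply: hA; split=> // i j; rewrite !mxE; exact: h.
have -> : B = (fun x : 'rV[R]_n => x^T) @` ((fun x : 'rV[R]_n => x^T) @^-1` B).
  apply/seteqP; split=> [x Ax|x [y Ay <-]//].
  by exists x^T; rewrite /= ?trmxK.
apply: continuous_compact.
  by apply: continuous_subspaceT; exact: ct1.
apply: bounded_closed_compact.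
  exists M; split => // N MN x /= Ax.
  have := bA _ MN _ Ax => h.
  have N0 : 0 <= N := le_trans (normr_ge0 _) h.
  apply/mx_norm_leP => // i j; have /mx_norm_leP := h => /(_ N0 j i).
  by rewrite mxE.
by apply: closed_comp => // x _; exact: ct1.
Qed.

Lemma compact_ccube (M : R) :
  compact [set x : 'cV[R]_n | forall i, `|x i 0| <= M].
Proof.
apply: bounded_closed_compact_cV.
  exists `|M|; split; first exact: num_real.
  move=> N MN x /= h; have N0 : 0 <= N by rewrite (le_trans _ (ltW MN)).
  apply/mx_norm_leP => // i j.
  by rewrite [j]ord1 (le_trans (h i))// (le_trans (ler_norm _))// ltW.
rewrite (_ : [set _ | _] = \bigcap_(i in [set: 'I_n])
   ((fun x : 'cV[R]_n => `|x i 0|) @^-1` [set t | t <= M])); last first.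
  by apply/seteqP; split=> [x h i _|x h i]; [exact: h|exact: (h i)].
apply: closed_bigI => i _; apply: closed_comp; last exact: closed_le.
move=> x _; apply: (@continuous_comp _ _ _ (fun x : 'cV[R]_n => x i 0) Num.norm).
  exact: coord_continuous.
exact: norm_continuous.
Qed.

Lemma continuous_cube_bounded (f : 'cV[R]_n -> R) M :
  continuous f -> (forall x, ~ cube 0 M x -> f x = 0) ->
  exists B, forall x, `|f x| <= B.
Proof.
move=> cf f0.
have [B0 [_ hB]] : bounded_set (f @` [set x : 'cV[R]_n | forall i, `|x i 0| <= M]).
  apply: compact_bounded; apply: continuous_compact; last exact: compact_ccube.
  exact: continuous_subspaceT.
exists (`|B0| + 1) => x; have [hx|/f0 ->] := pselect (cube 0 M x); last first.
  by rewrite normr0 addr_ge0.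
apply: (hB (`|B0| + 1)).
  by rewrite (le_lt_trans (ler_norm _))// ltrDl.
by exists x => // i; have := hx i; rewrite mxE subr0 => /ltW.
Qed.

Lemma continuous_cube_integrable (f : 'cV[R]_n -> R) M :
  continuous f -> 0 <= M -> (forall x, ~ cube 0 M x -> f x = 0) ->
  (leb n).-integrable setT (EFin \o f).
Proof.
move=> cf M0 f0; have [B hB] := continuous_cube_bounded cf f0.
by apply: (integrable_bounded_cube _ M0 hB f0); exact: measurable_fun_continuous.
Qed.

Lemma derive_cube0 (f : 'cV[R]_n -> R) M v :
  (forall x, ~ cube 0 M x -> f x = 0) ->
  forall x, ~ cube 0 (M + 1) x -> 'D_v f x = 0.
Proof.
move=> f0 x hx.
suff fn0 : {near x, f =1 cst 0}.
  by rewrite (near_eq_derive v fn0) derive_cst.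
have /existsNP[i /negP] := hx; rewrite mxE subr0 -leNgt => hi.
apply/nbhs_cubeP; exists 1 => // y /(_ i) hy; apply: f0 => /(_ i).
rewrite mxE subr0 => hyi.
have := ler_normD (y i 0) (- (y i 0 - x i 0)).
rewrite normrN opprB addrC subrK => h.
by move: (le_lt_trans (le_trans hi h) (ltrD hyi hy)); rewrite ltxx.
Qed.

End compactness.

Lemma integral_derive1_cpt0 (R : realType) (F : R -> R) (M : R) : 0 < M ->
  (forall t, derivable F t 1) -> continuous F^`()%classic ->
  (forall t, M <= `|t| -> F t = 0) ->
  (\int[@lebesgue_measure R]_t (F^`()%classic t)%:E = 0)%E.
Proof.
move=> M0 dF cF F0.
have cFF : continuous F.
  by move=> t; apply: differentiable_continuous; exact/derivable1_diffP.
have F'0 t : M < `|t| -> F^`()%classic t = 0.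
  move=> Mt; rewrite derive1E.
  have fn0 : {near t, F =1 cst 0}.
    near=> s; apply: F0; rewrite ltW//; near: s.
    apply: (@cvgr_gt _ _ _ _ (fun s : R => `|s|) `|t|) => //.
    exact: norm_continuous.
  by rewrite (near_eq_derive _ fn0) derive_cst.
have ab : - (M + 1) < M + 1 by rewrite gtrN// addr_gt0.
rewrite (_ : (fun t => _) = (EFin \o F^`()%classic) \_ `[- (M + 1), M + 1]); last first.
  apply/funext => t; rewrite patchE; case: ifPn => //=.
  move/negP; rewrite inE/= in_itv/= -ler_norml => /negP; rewrite -ltNge => h.
  by rewrite F'0// (lt_trans _ h)// ltrDl.
rewrite -integral_mkcond.
have FM : F (M + 1) = 0 by apply: F0; rewrite ger0_norm ?lerDl// addr_ge0// ltW.
have FN : F (- (M + 1)) = 0.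
  by apply: F0; rewrite normrN ger0_norm ?lerDl// addr_ge0// ltW.
have c1 : {within `[- (M + 1), M + 1], continuous F^`()%classic}.
  exact: continuous_subspaceT.
have c2 : derivable_oo_LRcontinuous F (- (M + 1)) (M + 1).
  split; [by move=> x _; exact: dF| |].
    by apply: cvg_at_right_filter; exact: cFF.
  by apply: cvg_at_left_filter; exact: cFF.
have := continuous_FTC2 ab c1 c2 (fun _ _ => erefl).
by rewrite FM FN subee.
Unshelve. all: by end_near. Qed.

Section slices.
Context {R : realType} {n : nat}.

Lemma cV_cons0 (x : 'cV[R]_n) t : cV_cons (x, t) ord0 0 = t.
Proof. by rewrite mxE unlift_none. Qed.

Lemma cV_consS (x : 'cV[R]_n) t j : cV_cons (x, t) (lift ord0 j) 0 = x j 0.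
Proof. by rewrite mxE liftK. Qed.

Lemma cV_cons_shift0 (x : 'cV[R]_n) t (h : R) :
  cV_cons (x, h + t) = h *: delta_mx ord0 0 + cV_cons (x, t).
Proof.
apply/matrixP => i j; rewrite [j]ord1 {j}; case: (unliftP ord0 i) => [j|] ->.
  by rewrite cV_consS !mxE liftK eq_sym (negbTE (neq_lift _ _)) mulr0 add0r.
by rewrite cV_cons0 !mxE unlift_none !eqxx mulr1.
Qed.

Lemma cV_cons_shiftS (x : 'cV[R]_n) t (h : R) j :
  cV_cons (h *: delta_mx j 0 + x, t) =
  h *: delta_mx (lift ord0 j) 0 + cV_cons (x, t).
Proof.
apply/matrixP => i k; rewrite [k]ord1 {k}; case: (unliftP ord0 i) => [k|] ->.
  by rewrite cV_consS !mxE liftK (inj_eq lift_inj).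
by rewrite cV_cons0 !mxE unlift_none (negbTE (neq_lift _ _)) mulr0 add0r.
Qed.

Lemma continuous_cV_cons1 (t : R) : continuous (fun x : 'cV[R]_n => cV_cons (x, t)).
Proof.
move=> x A /nbhs_cubeP[e e0 hA]; apply/nbhs_cubeP; exists e => // y h.
apply: hA => i; case: (unliftP ord0 i) => [j|] ->.
  by rewrite !cV_consS; exact: h.
by rewrite !cV_cons0 subrr normr0.
Qed.

Lemma continuous_cV_cons2 (x : 'cV[R]_n) : continuous (fun t : R => cV_cons (x, t)).
Proof.
move=> t A /nbhs_cubeP[e e0 hA]; apply/nbhs_ballP; exists e => // s h.
apply: hA => i; case: (unliftP ord0 i) => [j|] ->.
  by rewrite !cV_consS subrr normr0.
by rewrite !cV_cons0 distrC.
Qed.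

Lemma derivable_slice0 (F : 'cV[R]_n.+1 -> R) x (t : R) :
  derivable F (cV_cons (x, t)) (delta_mx ord0 0) ->
  derivable (fun s => F (cV_cons (x, s))) t 1 /\
  (fun s => F (cV_cons (x, s)))^`()%classic t = 'D_(delta_mx ord0 0) F (cV_cons (x, t)).
Proof.
have E (h : R) : F (cV_cons (x, h *: 1 + t)) =
    F (h *: delta_mx ord0 0 + cV_cons (x, t)).
  by rewrite -cV_cons_shift0 [h *: 1]mulr1.
rewrite derive1E /derivable /derive /= => dF.
under eq_fun do rewrite /= E.
by split.
Qed.

Lemma derivable_sliceS (F : 'cV[R]_n.+1 -> R) (x : 'cV[R]_n) (t : R) j :
  derivable F (cV_cons (x, t)) (delta_mx (lift ord0 j) 0) ->
  derivable (fun y => F (cV_cons (y, t))) x (delta_mx j 0) /\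
  'D_(delta_mx j 0) (fun y => F (cV_cons (y, t))) x =
    'D_(delta_mx (lift ord0 j) 0) F (cV_cons (x, t)).
Proof.
have E (h : R) : F (cV_cons (h *: delta_mx j 0 + x, t)) =
    F (h *: delta_mx (lift ord0 j) 0 + cV_cons (x, t)).
  by rewrite -cV_cons_shiftS.
rewrite /derivable /derive /= => dF.
under eq_fun do rewrite /= E.
by split.
Qed.
End slices.

(** The divergence theorem for compactly supported functions: slicing along the
    first coordinate, the derivative is integrated either by the fundamental
    theorem of calculus or, on each slice, by induction on the dimension. *)
Lemma integral_derive_cpt0 (R : realType) n (i : 'I_n) (F : 'cV[R]_n -> R) M :
  0 < M -> (forall x, derivable F x (delta_mx i 0)) ->
  continuous ('D_(delta_mx i 0) F) ->
  (forall x, ~ cube 0 M x -> F x = 0) ->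
  (\int[leb n]_x ('D_(delta_mx i 0) F x)%:E = 0)%E.
Proof.
move=> M0; elim: n i F => [[]//|n IH] i F dF cD F0.
set G : 'cV[R]_n.+1 -> R := 'D_(delta_mx i 0) F.
have G0 := derive_cube0 (delta_mx i 0) F0.
have M1 : 0 <= M + 1 by rewrite addr_ge0// ltW.
have iG : (leb n.+1).-integrable setT (EFin \o G).
  exact: (continuous_cube_integrable cD M1 G0).
have mG := measurable_int _ iG.
pose m : {measure set _ -> \bar R} := (leb n \x @lebesgue_measure R)%E.
have iGc : m.-integrable setT ((EFin \o G) \o cV_cons).
  apply/integrableP; split.
    have mG1 : measurable_fun setT G by exact: measurable_fun_continuous.
    apply/measurable_EFinP. apply: (measurableT_comp mG1). exact: measurable_cV_cons.
  move/integrableP : iG => [_].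
  have mc := @measurable_cV_cons R n.
  have := @ge0_integral_pushforward _ _ _ _ R _ mc m setT (fun x => `|(G x)%:E|)%E
    measurableT.
  rewrite preimage_setT => <- //.
  by apply: measurableT_comp => //; exact: mG.
have -> : (\int[leb n.+1]_x (G x)%:E = \int[m]_z (G (cV_cons z))%:E)%E.
  have := @integral_pushforward _ _ _ _ R _ (@measurable_cV_cons R n) m setT
    (EFin \o G) mG.
  by rewrite preimage_setT => /(_ iGc measurableT).
case: (unliftP ord0 i) => [j|] ij; subst i.
  have := integral21_prod_meas1 iGc => /= <-.
  apply: integral0_eq => t _; rewrite /fubini_G /=.
  pose Ft x := F (cV_cons (x, t)).
  have dFt x : derivable Ft x (delta_mx j 0) /\
      'D_(delta_mx j 0) Ft x = G (cV_cons (x, t)).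
    exact: derivable_sliceS.
  under eq_integral do rewrite -(dFt _).2.
  apply: IH => [x||x hx].
  - by have [] := dFt x.
  - rewrite (_ : 'D_(delta_mx j 0) Ft = G \o (fun x => cV_cons (x, t))).
      by move=> x; apply: continuous_comp; [exact: continuous_cV_cons1|exact: cD].
    by apply/funext => x; rewrite (dFt x).2.
  - apply: F0 => h; apply: hx => k; have := h (lift ord0 k).
    by rewrite cV_consS !mxE.
have := integral12_prod_meas1 iGc => /= <-.
apply: integral0_eq => x _; rewrite /fubini_F /=.
pose Fx t := F (cV_cons (x, t)).
have dFx t : derivable Fx t 1 /\ Fx^`()%classic t = G (cV_cons (x, t)).
  exact: derivable_slice0.
under eq_integral do rewrite -(dFx _).2.
apply: (@integral_derive1_cpt0 _ Fx _ M0) => [t||t ht].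
- by have [] := dFx t.
- rewrite (_ : Fx^`()%classic = G \o (fun t => cV_cons (x, t))).
    by move=> t; apply: continuous_comp; [exact: continuous_cV_cons2|exact: cD].
  by apply/funext => t; rewrite (dFx t).2.
- apply: F0 => /(_ ord0); rewrite cV_cons0 mxE subr0.
  by rewrite ltNge ht.
Qed.

(** * Smooth functions *)

Section smooth_functions.
Context {R : realType} {n : nat}.
Local Notation V := 'cV[R]_n.
Implicit Types (f g : V -> R) (O : set V) (x : V).

Definition smooth_on O f := forall s x, O x -> differentiable (pderiv s f) x.

Local Notation pd i f := ('D_(delta_mx i 0) f).

Lemma pderiv_rcons s i f : pderiv (rcons s i) f = pderiv s (pderiv [:: i] f).
Proof. by rewrite /pderiv foldr_rcons. Qed.

Lemma pderiv_eq_on O f g s : open O -> (forall x, O x -> f x = g x) ->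
  forall x, O x -> pderiv s f x = pderiv s g x.
Proof.
move=> oO fg; elim: s => [|i s IH] x Ox; first exact: fg.
apply: near_eq_derive; have : nbhs x O by exact: open_nbhs_nbhs.
by apply: filterS => y /IH.
Qed.

(** The difference vanishes near [x], hence has the differential [0] there. *)
Lemma near_eq_differentiable f g x : (\near x, f x = g x) ->
  differentiable g x -> differentiable f x.
Proof.
move=> fg dg; pose e : V -> R := f - g.
have e0 : \near x, e x = 0.
  by apply: filterS fg => y fgy; rewrite /e /= fctE fgy subrr.
suff de : differentiable e x.
  have -> : f = e + g by rewrite /e subrK.
  exact: differentiableD.
have [c0 eE] : continuous (0 : V -> R) /\
    e \o shift x = cst (e x) + \0 +o_ (0 : V) id.
  split; first exact: cst_continuous.
  apply/eqaddoP => eps eps0; rewrite (nbhs_singleton e0).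
  have : \forall h \near (0 : V), e (h + x) = 0.
    by move: e0; rewrite (near_shift 0) subr0.
  apply: filterS => h /= eh; rewrite !fctE /= eh.
  by rewrite !addr0 subrr normr0 mulr_ge0// ltW.
have dE : 'd e x = 0 :> (V -> R) by apply: diff_unique.
by apply/diff_locallyP; rewrite dE.
Qed.

(** Smoothness in one variable is certified by a family of functions which is stable
    under differentiation on [D]; this avoids formulas for the iterated derivatives. *)
Definition derive_closed (D : set R) (G : set (R -> R)) :=
  forall k, G k -> exists2 k', G k' & forall t, D t -> is_derive t 1 k (k' t).

Definition smooth1 (D : set R) (k : R -> R) :=
  exists2 G, derive_closed D G & G k.

Lemma derive_comp1 (g : R -> R) (g' : R) f x (v : V) : differentiable f x ->
  is_derive (f x) 1 g g' ->
  differentiable (g \o f) x /\ 'D_v (g \o f) x = g' * 'D_v f x.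
Proof.
move=> df dg.
have dgf : differentiable g (f x) by apply/derivable1_diffP.
have dgof := differentiable_comp df dgf; split => //.
rewrite (deriveE _ dgof) (diff_comp df dgf) /= (deriveE _ df).
by rewrite (diff1E dgf) derive1E derive_val mulrC.
Qed.

(** This class is stable under partial derivatives, by the sum, product and chain
    rules ([smooth_built_pd]); smoothness then follows by induction on the order of
    the derivative. *)
Inductive smooth_built O : (V -> R) -> Prop :=
| built_base f of smooth_on O f : smooth_built O f
| built_cst c : smooth_built O (fun=> c)
| built_add f g of smooth_built O f & smooth_built O g : smooth_built O (fun x => f x + g x)
| built_mul f g of smooth_built O f & smooth_built O g : smooth_built O (fun x => f x * g x)
| built_comp (D : set R) G (k : R -> R) f of derive_closed D G & G k & smooth_built O f &
    (forall x, O x -> D (f x)) : smooth_built O (fun x => k (f x))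
| built_eq f g of (forall x, O x -> f x = g x) & smooth_built O g : smooth_built O f.

Lemma smooth_built_pd O f : open O -> smooth_built O f ->
  (forall x, O x -> differentiable f x) /\ forall i, smooth_built O (pd i f).
Proof.
move=> oO; elim=> {f}[f sf|c|f g _ [df sf] _ [dg sg]|f g sf [df sdf] sg [dg sdg]
    |D G k f cG Gk sf [df sdf] OD|f g fg _ [dg sdg]].
- split=> [x Ox|i]; first exact: (sf [::] x Ox).
  by apply: built_base => s x Ox; have := sf (rcons s i) x Ox; rewrite pderiv_rcons.
- split=> [x Ox|i]; first exact: differentiable_cst.
  by apply: (built_eq (g := fun=> 0)) => [x _|]; [exact: derive_cst|exact: built_cst].
- split=> [x Ox|i]; first by apply: differentiableD; [exact: df|exact: dg].
  apply: (built_eq (g := fun x => pd i f x + pd i g x)); last exact: built_add.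
  by move=> x Ox; rewrite deriveD//; apply: diff_derivable; [exact: df|exact: dg].
- split=> [x Ox|i]; first by apply: differentiableM; [exact: df|exact: dg].
  apply: (built_eq (g := fun x => f x * pd i g x + g x * pd i f x)).
    by move=> x Ox; rewrite deriveM//; apply: diff_derivable; [exact: df|exact: dg].
  by apply: built_add; apply: built_mul.
- have [k' Gk' dk] := cG _ Gk.
  split=> [x Ox|i].
    by have [] := derive_comp1 0 (df x Ox) (dk _ (OD x Ox)).
  apply: (built_eq (g := fun x => k' (f x) * pd i f x)).
    by move=> x Ox; have [] := derive_comp1 (delta_mx i 0) (df x Ox) (dk _ (OD x Ox)).
  by apply: built_mul => //; exact: (built_comp cG Gk' sf OD).
- have nfg x : O x -> \near x, f x = g x.
    by move=> Ox; have : nbhs x O by [exact: open_nbhs_nbhs]; exact: filterS.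
  split=> [x Ox|i].
    by apply: near_eq_differentiable (dg x Ox); exact: nfg.
  by apply: (built_eq (g := pd i g)) => // x Ox; apply: near_eq_derive; exact: nfg.
Qed.

Lemma smooth_built_smooth O f : open O -> smooth_built O f -> smooth_on O f.
Proof.
move=> oO sf s; elim/last_ind: s f sf => [|s i IH] f sf x Ox.
  exact: (smooth_built_pd oO sf).1.
by rewrite pderiv_rcons; apply: IH => //; exact: (smooth_built_pd oO sf).2.
Qed.

End smooth_functions.

Section smooth_algebra.
Context {R : realType} {n : nat}.
Local Notation V := 'cV[R]_n.
Implicit Types (f g : V -> R) (O : set V) (x : V).
Local Notation pd i f := ('D_(delta_mx i 0) f).

Lemma smooth_on_diff O f x : smooth_on O f -> O x -> differentiable f x.
Proof. by move=> sf Ox; exact: (sf [::]). Qed.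

Lemma smooth_on_derivable O f x v : smooth_on O f -> O x -> derivable f x v.
Proof. by move=> sf Ox; apply: diff_derivable; exact: smooth_on_diff Ox. Qed.

Lemma smooth_on_continuous O f x : smooth_on O f -> O x -> {for x, continuous f}.
Proof.
by move=> sf Ox; apply: differentiable_continuous; exact: smooth_on_diff Ox.
Qed.

Lemma smooth_on_pderiv O f s : smooth_on O f -> smooth_on O (pderiv s f).
Proof.
by move=> sf t x Ox; have := sf (t ++ s) x Ox; rewrite /pderiv foldr_cat.
Qed.

Lemma smooth_on_pd O f i : smooth_on O f -> smooth_on O (pd i f).
Proof. exact: (@smooth_on_pderiv O f [:: i]). Qed.

Lemma smooth_on_subset O O' f : O' `<=` O -> smooth_on O f -> smooth_on O' f.
Proof. by move=> OO' sf s x /OO'; exact: sf. Qed.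

Lemma smooth_onU O O' f : smooth_on O f -> smooth_on O' f -> smooth_on (O `|` O') f.
Proof. by move=> sf sf' s x [Ox|Ox]; [exact: sf|exact: sf']. Qed.

Lemma smooth_on_eq O f g : open O -> (forall x, O x -> f x = g x) ->
  smooth_on O g -> smooth_on O f.
Proof. by move=> oO fg sg; apply: smooth_built_smooth => //; apply: (built_eq fg);
  exact: built_base. Qed.

Lemma smooth_on_cst O (c : R) : open O -> smooth_on O (fun=> c).
Proof. by move=> oO; apply: smooth_built_smooth => //; exact: built_cst. Qed.

Lemma smooth_onD O f g : open O -> smooth_on O f -> smooth_on O g ->
  smooth_on O (fun x => f x + g x).
Proof. by move=> oO sf sg; apply: smooth_built_smooth => //; apply: built_add;
  exact: built_base. Qed.

Lemma smooth_onM O f g : open O -> smooth_on O f -> smooth_on O g ->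
  smooth_on O (fun x => f x * g x).
Proof. by move=> oO sf sg; apply: smooth_built_smooth => //; apply: built_mul;
  exact: built_base. Qed.

Lemma smooth_onZ O (c : R) f : open O -> smooth_on O f ->
  smooth_on O (fun x => c * f x).
Proof. by move=> oO sf; apply: smooth_onM => //; exact: smooth_on_cst. Qed.

Lemma smooth_on_sum O (F : 'I_n -> V -> R) : open O ->
  (forall i, smooth_on O (F i)) -> smooth_on O (fun x => \sum_i F i x).
Proof.
move=> oO sF; elim: (index_enum 'I_n) => [|i s IH].
  by apply: (smooth_on_eq (g := fun=> 0)) => // [x _|];
    [rewrite big_nil|exact: smooth_on_cst].
apply: (smooth_on_eq (g := fun x => F i x + \sum_(j <- s) F j x)) => //.
  by move=> x _; rewrite big_cons.
exact: smooth_onD.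
Qed.

Lemma smooth_on_comp O (D : set R) (k : R -> R) f : open O -> smooth1 D k ->
  smooth_on O f -> (forall x, O x -> D (f x)) -> smooth_on O (fun x => k (f x)).
Proof.
move=> oO [G cG Gk] sf OD; apply: smooth_built_smooth => //.
by apply: (built_comp cG Gk _ OD); exact: built_base.
Qed.

Lemma pd_coord i j x : pd i (fun y : V => y j 0) x = (i == j)%:R.
Proof.
rewrite /derive.
suff -> : (fun h : R => h^-1 *: (((fun y : V => y j 0) \o shift x) (h *: delta_mx i 0)
    - x j 0)) = (fun h : R => h^-1 * h * (i == j)%:R).
  apply: cvg_lim => //; apply: cvg_near_cst.
  near=> h; rewrite mulVf ?mul1r//.
  by near: h; exact: nbhs_dnbhs_neq.
apply/funext => h; rewrite /= !mxE addrK eqxx andbT [i == j]eq_sym.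
exact: mulrA.
Unshelve. all: by end_near. Qed.

End smooth_algebra.

Section one_variable.
Context {R : realType}.

Lemma smooth1_expR : smooth1 setT (@expR R).
Proof.
by exists [set expR] => // _ ->; exists expR => // t _; exact: is_derive_expR.
Qed.

Lemma smooth1_sincos : smooth1 setT (@sin R) /\ smooth1 setT (@cos R).
Proof.
pose G : set (R -> R) := [set k | exists a b : R, k = fun t => a * sin t + b * cos t].
have cG : derive_closed setT G.
  move=> _ [a [b ->]]; exists (fun t => (- b) * sin t + a * cos t); first by exists (- b), a.
  move=> t _; apply: is_derive_eq.
  by rewrite /GRing.scale/=; ring.
split; exists G => //.
  by exists 1, 0; apply/funext => t; rewrite mul1r mul0r addr0.
by exists 0, 1; apply/funext => t; rewrite mul1r mul0r add0r.
Qed.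

Lemma is_derive_invX m (t : R) : t != 0 ->
  is_derive t 1 (fun s : R => s^-1 ^+ m) (- m%:R * t^-1 ^+ m.+1).
Proof.
move=> t0; rewrite (_ : (fun s : R => s^-1 ^+ m) = (fun s : R => s^-1) ^+ m); last first.
  by apply/funext => s; rewrite exprfctE.
apply: is_derive_eq (is_deriveX m (is_deriveV t0 (is_derive_id t 1))) _.
case: m => [|m]; first by rewrite oppr0 !mul0r scale0r.
rewrite /GRing.scale/= -exprVn.
by rewrite (exprS _ m.+1) (exprS _ m); ring.
Qed.

Definition inv_powers : set (R -> R) := [set k | exists (c : R) m, k = fun t => c * t^-1 ^+ m].

Lemma inv_powers_closed (D : set R) : (forall t, D t -> t != 0) ->
  derive_closed D inv_powers.
Proof.
move=> D0 _ [c [m ->]]; exists (fun t => (- c * m%:R) * t^-1 ^+ m.+1).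
  by exists (- c * m%:R), m.+1.
move=> t /D0 t0; apply: is_derive_eq (is_deriveZ c (is_derive_invX m t0)) _.
by rewrite /GRing.scale/=; ring.
Qed.

Lemma smooth1_ln : smooth1 [set t | 0 < t] (@ln R).
Proof.
exists (inv_powers `|` [set @ln R]); last by right.
move=> k [Gk|->].
  have [t|k' Gk' dk] := @inv_powers_closed [set t | 0 < t] _ _ Gk.
    exact: lt0r_neq0.
  by exists k' => //; left.
exists (fun t => t^-1); last by move=> t t0; exact: is_derive1_ln.
by left; exists 1, 1%N; apply/funext => t; rewrite mul1r expr1.
Qed.

(** The functions [t^-k exp(-1/t)], extended by [0]; they are flat at [0] and
    span a space that is stable under differentiation. *)
Definition flat (k : nat) (t : R) : R :=
  if 0 < t then t^-1 ^+ k * expR (- t^-1) else 0.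

Lemma flat_le0 k t : t <= 0 -> flat k t = 0.
Proof. by rewrite /flat leNgt => /negbTE ->. Qed.

Lemma flat_gt0 k t : 0 < t -> 0 < flat k t.
Proof. by move=> t0; rewrite /flat t0 mulr_gt0 ?expR_gt0// exprn_gt0// invr_gt0. Qed.

Lemma flat_ge0 k t : 0 <= flat k t.
Proof. by case: (ltP 0 t) => [/(flat_gt0 k)/ltW//|/(flat_le0 k) ->]. Qed.

(** From [1 + y / k <= exp (y / k)], raised to the power [k]. *)
Lemma exprn_expRN_le k (y : R) : 0 <= y -> y ^+ k * expR (- y) <= k%:R ^+ k.
Proof.
move=> y0; case: k => [|k].
  by rewrite !expr0 mul1r -expR0 ler_expR oppr_le0.
have k0 : (0 : R) < k.+1%:R by rewrite ltr0n.
rewrite expRN ler_pdivrMr ?expR_gt0//.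
have -> : y = k.+1%:R * (y / k.+1%:R) by rewrite mulrC divfK// gt_eqF.
rewrite expRM_natl exprMn ler_pM2l ?exprn_gt0//.
rewrite lerXn2r// ?nnegrE ?expR_ge0 ?divr_ge0//.
by rewrite (le_trans _ (expR_ge1Dx _))// lerDr.
Qed.

Lemma flat_bound k t : flat k t <= k%:R ^+ k.
Proof.
case: (ltP 0 t) => [t0|/(flat_le0 k) ->]; last by rewrite exprn_ge0.
by rewrite /flat t0 exprn_expRN_le// invr_ge0 ltW.
Qed.

Lemma flatS k t : flat k t = t * flat k.+1 t.
Proof.
rewrite /flat; case: ifPn => t0; last by rewrite mulr0.
by rewrite exprS !mulrA divff ?mul1r// gt_eqF.
Qed.

(** At [0] the difference quotient is [t * flat k.+2 t], and [flat k.+2] is bounded. *)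
Lemma is_derive_flat k (t : R) : is_derive t 1 (flat k) (flat k.+2 t - k%:R * flat k.+1 t).
Proof.
have [t0|t0|<-] := ltgtP 0 t.
- apply: (near_eq_is_derive (f := (fun t => t^-1 ^+ k) * (expR \o (- (fun s : R => s^-1 ^+ 1))))).
    have : nbhs t [set s | 0 < s] by exact: lt_nbhsr.
    by apply: filterS => s /= s0; rewrite /flat s0.
  have tn0 : t != 0 by rewrite gt_eqF.
  have dN := is_deriveN (is_derive_invX 1 tn0).
  have dE := @is_derive1_comp R expR (- (fun s : R => s^-1 ^+ 1)) t _ _
    (is_derive_expR _) dN.
  apply: is_derive_eq (is_deriveM (is_derive_invX k tn0) dE) _.
  rewrite /flat t0 /GRing.scale/= (_ : (- _) t = - t^-1)//.
  by rewrite (exprS _ k.+1) (exprS _ k); ring.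
- rewrite !flat_le0 ?ltW// mulr0 subrr.
  apply: (near_eq_is_derive (f := cst 0)).
  have : nbhs t [set s | s < 0] by exact: lt_nbhsl.
  by apply: filterS => s /= s0; rewrite flat_le0// ltW.
- rewrite !flat_le0// mulr0 subrr.
  have H : h^-1 *: ((flat k \o shift 0) (h *: 1) - flat k 0) @[h --> 0^'] --> (0 : R).
    apply/cvgrPdist_le => e e0; pose C : R := k.+2%:R ^+ k.+2.
    have C0 : 0 < C by rewrite exprn_gt0// ltr0n.
    near=> h; rewrite /= addr0 [h *: 1]mulr1 (flat_le0 _ (lexx 0)) subr0.
    rewrite sub0r normrN; have [h0|h0] := ltP 0 h; last first.
      by rewrite (flat_le0 _ h0) scaler0 normr0 ltW.
    rewrite ger0_norm ?mulr_ge0 ?invr_ge0 ?flat_ge0 ?(ltW h0)//.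
    rewrite flatS flatS [leLHS]mulrA mulVf ?gt_eqF// mul1r.
    rewrite (@le_trans _ _ (h * C))//; first by rewrite ler_pM2l// flat_bound.
    rewrite -ler_pdivlMr// (le_trans (ler_norm _))//.
    near: h; apply: dnbhs0_le; exact: divr_gt0.
  apply: DeriveDef; first by apply/cvg_ex; exists 0.
  exact/cvg_lim.
Unshelve. all: by end_near. Qed.

Inductive flat_span : (R -> R) -> Prop :=
| flat_span1 k : flat_span (flat k)
| flat_spanB c f g of flat_span f & flat_span g : flat_span (f - c *: g).

Lemma smooth1_flat k : smooth1 setT (flat k).
Proof.
exists flat_span; last exact: flat_span1.
move=> f; elim=> {f}[m|c f g _ [f' sf df] _ [g' sg dg]].
  exists (flat m.+2 - m%:R *: flat m.+1).
    by apply: flat_spanB; exact: flat_span1.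
  by move=> t _; exact: is_derive_flat.
exists (f' - c *: g'); first exact: flat_spanB.
move=> t _; apply: is_deriveB; first exact: df.
by apply: is_deriveZ; exact: dg.
Qed.

End one_variable.

(** * Test functions and weak derivatives *)

Section test_functions.
Context {R : realType} {n : nat}.
Local Notation V := 'cV[R]_n.
Implicit Types (f g u v phi psi : V -> R) (O D C : set V) (x : V).
Local Notation pd i f := ('D_(delta_mx i 0) f).

Definition supp f : set V := closure [set x | f x != 0].

Lemma supp0 f x : ~ supp f x -> f x = 0.
Proof.
by move=> nx; apply/eqP/negPn/negP => fx; apply: nx; exact: subset_closure.
Qed.

Lemma open_suppC f : open (~` supp f).
Proof. by apply: closed_openC; exact: closed_closure. Qed.

Lemma supp_sub f g : (forall x, f x = 0 -> g x = 0) -> supp g `<=` supp f.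
Proof. by move=> fg; apply: closure_subset => x /=; apply: contra_neq => /fg. Qed.

Lemma smoothP f : smooth f <-> smooth_on setT f.
Proof. by split=> [sf s x _|sf s x]; exact: sf. Qed.

Lemma test_function_smooth O f : test_function O f -> smooth_on setT f.
Proof. by move=> [/smoothP]. Qed.

Lemma test_function_sub O f x : test_function O f -> ~ O x -> f x = 0.
Proof. by move=> [_ _ sO] nOx; apply: supp0 => /sO. Qed.

Lemma test_function_subset O O' f : O `<=` O' -> test_function O f -> test_function O' f.
Proof. by move=> OO' [? ? fO]; split => //; exact: subset_trans OO'. Qed.

(** The product vanishes on the complement of the support of [f], which together with
    [O] covers the space. *)
Lemma test_functionM O psi f : open O -> smooth_on O psi -> test_function O f ->
  test_function O (fun x => psi x * f x).
Proof.
move=> oO spsi [sf cf fO].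
have ss : supp (fun x => psi x * f x) `<=` supp f.
  by apply: supp_sub => x ->; rewrite mulr0.
split; last exact: subset_trans fO.
- apply/smoothP; rewrite (_ : setT = O `|` ~` supp f); last first.
    apply/seteqP; split=> // x _; have [/fO|] := pselect (supp f x); first by left.
    by right.
  apply: smooth_onU.
    by apply: smooth_onM => //; apply: smooth_on_subset (subsetT O) _; exact/smoothP.
  apply: (smooth_on_eq (g := fun=> 0)); first exact: open_suppC.
    by move=> x /supp0 ->; rewrite mulr0.
  by apply: smooth_on_cst; exact: open_suppC.
- by apply: subclosed_compact cf ss; exact: closed_closure.
Qed.

Lemma pderiv_supp s f x : ~ supp f x -> pderiv s f x = 0.
Proof.
have H : forall y, (~` supp f) y -> pderiv s f y = pderiv s (fun=> 0) y.
  apply: pderiv_eq_on; first exact: open_suppC.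
  by move=> y; exact: supp0.
move=> /H ->; elim: s {H} x => //= i s IH x.
rewrite (_ : pderiv s _ = cst 0) ?derive_cst//.
by apply/funext => y; rewrite IH.
Qed.

Lemma test_function_pderiv O f s : test_function O f -> test_function O (pderiv s f).
Proof.
move=> [sf cf fO].
have ss : supp (pderiv s f) `<=` supp f.
  have h : [set x | pderiv s f x != 0] `<=` supp f.
    by move=> x /= hx; apply: contrapT => /(pderiv_supp s); exact/eqP.
  move=> x /(closure_subset h).
  by rewrite -(proj1 (closure_id _) (@closed_closure _ _)).
split; last exact: subset_trans fO.
- by apply/smoothP; apply: smooth_on_pderiv; exact/smoothP.
- by apply: subclosed_compact cf ss; exact: closed_closure.
Qed.

Lemma test_function_continuous O f : test_function O f -> continuous f.
Proof. by move=> /test_function_smooth sf x; apply: smooth_on_continuous sf _. Qed.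

Lemma compact_sub_cube C : compact C -> exists2 M, 0 < M & C `<=` cube 0 M.
Proof.
move=> /compact_bounded[M0 [_ hM]]; exists (`|M0| + 2).
  by rewrite ltr_wpDl.
move=> x Cx i; rewrite mxE subr0.
apply: (le_lt_trans (coord_norm_le x i)).
apply: (@le_lt_trans _ _ (`|M0| + 1)); last by rewrite ltrD2l ltr1n.
by apply: hM => //; rewrite (le_lt_trans (ler_norm _))// ltrDl.
Qed.

Lemma test_function_cube O f : test_function O f ->
  exists2 M, 0 < M & forall x, ~ cube 0 M x -> f x = 0.
Proof.
move=> [_ cf _]; have [M M0 hM] := compact_sub_cube cf.
by exists M => // x hx; apply: supp0 => /hM.
Qed.

Lemma test_function_integrable O f : test_function O f ->
  (leb n).-integrable setT (EFin \o f).
Proof.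
move=> tf; have [M M0 fM] := test_function_cube tf.
by apply: continuous_cube_integrable (ltW M0) fM; exact: test_function_continuous tf.
Qed.

Lemma integral_test_derive0 O f i : test_function O f ->
  \int[leb n]_x pd i f x = 0.
Proof.
move=> tf; have [M M0 fM] := test_function_cube tf.
rewrite /Rintegral (integral_derive_cpt0 M0)//.
- by move=> x; apply: smooth_on_derivable (test_function_smooth tf) _.
- exact: (test_function_continuous (test_function_pderiv [:: i] tf)).
Qed.

(** The derivative of the product is a test function, so its integral is [0]. *)
Lemma integral_by_parts1 O psi f i : open O -> smooth_on O psi -> test_function O f ->
  \int[leb n]_x (psi x * pd i f x) = - \int[leb n]_x (pd i psi x * f x).
Proof.
move=> oO spsi tf.
have t0 := test_functionM oO spsi tf.
have t1 := test_functionM oO spsi (test_function_pderiv [:: i] tf).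
have t2 := test_functionM oO (smooth_on_pd i spsi) tf.
have := integral_test_derive0 i t0.
have -> : pd i (fun x => psi x * f x) = fun x => psi x * pd i f x + pd i psi x * f x.
  apply/funext => x; have [Ox|nOx] := pselect (O x).
    rewrite deriveM; last 2 first.
    - exact: smooth_on_derivable Ox.
    - by apply: smooth_on_derivable (test_function_smooth tf) _.
    by rewrite /GRing.scale /= [pd i psi x * _]mulrC.
  have ns : ~ supp f x by case: tf => _ _ h /h.
  have p0 : pd i f x = 0 := pderiv_supp [:: i] ns.
  rewrite (supp0 ns) p0 !mulr0 addr0.
  apply: (@pderiv_supp [:: i]) => h; apply: ns.
  by apply: supp_sub h => y ->; rewrite mulr0.
rewrite RintegralD//; last 2 first.
- exact: test_function_integrable t1.
- exact: test_function_integrable t2.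
by move/eqP; rewrite addr_eq0 => /eqP.
Qed.

Lemma integral_by_parts O psi f s : open O -> smooth_on O psi -> test_function O f ->
  \int[leb n]_x (psi x * pderiv s f x) =
  (-1) ^+ size s * \int[leb n]_x (pderiv (rev s) psi x * f x).
Proof.
move=> oO; elim: s psi => [|i s IH] psi spsi tf; first by rewrite expr0 mul1r.
rewrite (@integral_by_parts1 O psi (pderiv s f) i)//; last exact: test_function_pderiv.
rewrite IH//; last exact: smooth_on_pd.
by rewrite rev_cons pderiv_rcons /= exprS mulN1r mulNr.
Qed.

Lemma Rintegral_supported D f : (forall x, ~ D x -> f x = 0) ->
  \int[leb n]_(x in D) f x = \int[leb n]_x f x.
Proof.
move=> f0; rewrite Rintegral_mkcond; congr (Rintegral _ _ _).
apply/funext => x; rewrite patchE; case: ifPn => // /negP.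
by rewrite inE => /f0.
Qed.

Lemma compact_measurable_cV C : compact C -> measurable C.
Proof.
move=> cC; rewrite -[C]setCK; apply: measurableC; apply: open_measurable_cV.
by apply: closed_openC; apply: compact_closed => //; exact: norm_hausdorff.
Qed.

Lemma leb_compact_fin C : compact C -> (leb n C < +oo)%E.
Proof.
move=> cC; have [M M0 CM] := compact_sub_cube cC.
by apply: leb_sub_cube_fin CM (ltW M0); exact: compact_measurable_cV.
Qed.

Lemma continuous_compact_bound O f C : (forall x, O x -> {for x, continuous f}) ->
  compact C -> C `<=` O -> exists2 B, 0 < B & forall x, C x -> `|f x| <= B.
Proof.
move=> cf cC CO.
have : bounded_set (f @` C).
  apply: compact_bounded; apply: continuous_compact => //.
  apply: continuous_in_subspaceT => x; rewrite inE => /CO; exact: cf.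
move=> [B0 [_ hB]]; exists (`|B0| + 1); first by rewrite ltr_wpDl.
move=> x Cx; apply: (hB (`|B0| + 1)); last by exists x.
by rewrite (le_lt_trans (ler_norm _))// ltrDl.
Qed.

Lemma smooth_on_L1_loc O D f : open O -> D `<=` O -> measurable D -> smooth_on O f ->
  L1_loc D f.
Proof.
move=> oO DO mD sf.
have mf : measurable_fun O f.
  apply: measurable_fun_continuous_open => // x Ox; exact: smooth_on_continuous Ox.
split; first by apply: measurable_funS mf => //; exact: open_measurable_cV.
move=> C cC CD.
have [B B0 hB] : exists2 B, 0 < B & forall x, C x -> `|f x| <= B.
  apply: (@continuous_compact_bound O) => //; last exact: subset_trans DO.
  move=> x Ox; exact: smooth_on_continuous Ox.
have mC := compact_measurable_cV cC.
apply: (@le_lt_trans _ _ (\int[leb n]_(x in C) B%:E)%E).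
  apply: ge0_le_integral => //.
  apply/measurable_EFinP; apply: measurableT_comp => //.
  by apply: measurable_funS mf; [exact: open_measurable_cV|exact: subset_trans DO].
rewrite (integral_cst _ mC).
by rewrite lte_mul_pinfty ?lee_fin ?(ltW B0)// leb_compact_fin.
Qed.

Lemma smooth_weak_derivative O D s f : open O -> D `<=` O -> measurable D ->
  smooth_on O f -> weak_derivative D s f (pderiv (rev s) f).
Proof.
move=> oO DO mD sf; split.
- exact: smooth_on_L1_loc sf.
- by apply: (smooth_on_L1_loc oO DO mD); exact: smooth_on_pderiv.
move=> phi tphi.
rewrite !(@Rintegral_supported D); last 2 first.
- by move=> x nDx; rewrite (test_function_sub tphi nDx) mulr0.
- move=> x nDx; rewrite (test_function_sub (test_function_pderiv s tphi) nDx).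
  by rewrite mulr0.
by apply: (integral_by_parts s oO) => //; exact: test_function_subset tphi.
Qed.

Lemma L1_loc_test_integrable D u f : measurable D -> L1_loc D u ->
  test_function D f -> (leb n).-integrable setT (EFin \o (fun x => u x * f x)).
Proof.
move=> mD [mu hu] tf; have [sf cf fD] := tf.
have mC := compact_measurable_cV cf.
suff : (leb n).-integrable (supp f) (EFin \o (fun x => u x * f x)).
  move/(integrable_mkcond _ mC); congr (is_true (integrable _ _ _)).
  apply/funext => x; rewrite patchE; case: ifPn => // /negP.
  by rewrite inE => /supp0 /= ->; rewrite mulr0.
have iu : (leb n).-integrable (supp f) (EFin \o u).
  apply/integrableP; split; last exact: hu.
  by apply/measurable_EFinP; apply: measurable_funS mu.
have [B B0 hB] : exists2 B, 0 < B & forall x, supp f x -> `|f x| <= B.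
  apply: (@continuous_compact_bound setT) => // x _.
  exact: (test_function_continuous tf).
have -> : (EFin \o (fun x => u x * f x)) = ((EFin \o u) \* (EFin \o f))%E.
  by apply/funext => x /=; rewrite EFinM.
apply: integrableMl => //.
  by apply: measurable_funTS; apply: measurable_fun_continuous;
    exact: (test_function_continuous tf).
exists B; split; first exact: num_real.
by move=> M /ltW BM x fx; apply: le_trans BM; exact: hB.
Qed.

Lemma weak_derivative_test D D' s u v f : D' `<=` D ->
  weak_derivative D s u v -> test_function D' f ->
  \int[leb n]_x (u x * pderiv s f x) = (-1) ^+ size s * \int[leb n]_x (v x * f x).
Proof.
move=> DD [_ _ h] tf'; have tf := test_function_subset DD tf'.
have := h _ tf; rewrite !(@Rintegral_supported D)//.
- by move=> x nDx; rewrite (test_function_sub tf nDx) mulr0.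
- move=> x nDx; rewrite (test_function_sub (test_function_pderiv s tf) nDx).
  by rewrite mulr0.
Qed.

End test_functions.

(** * Smooth bumps *)

Section flatbump.
Context {R : realType} {n : nat}.
Local Notation V := 'cV[R]_n.
Implicit Types (f g u v phi psi : V -> R) (O D C : set V) (x c : V) (k : R).
Local Notation pd i f := ('D_(delta_mx i 0) f).

Lemma pd_comp (k : R -> R) (k' : R) f i x : differentiable f x ->
  is_derive (f x) 1 k k' -> pd i (fun y => k (f y)) x = k' * pd i f x.
Proof. by move=> df dk; have [] := derive_comp1 (delta_mx i 0) df dk. Qed.

Lemma pdD f g i x : differentiable f x -> differentiable g x ->
  pd i (fun y => f y + g y) x = pd i f x + pd i g x.
Proof. by move=> df dg; apply: (@deriveD _ _ _ f g); exact: diff_derivable. Qed.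

Lemma pdM f g i x : differentiable f x -> differentiable g x ->
  pd i (fun y => f y * g y) x = f x * pd i g x + g x * pd i f x.
Proof. by move=> df dg; apply: (@deriveM _ _ f g); exact: diff_derivable. Qed.

Lemma pdZ (a : R) f i x : differentiable f x -> pd i (fun y => a * f y) x = a * pd i f x.
Proof. by move=> df; apply: (@deriveZ _ _ _ f a); exact: diff_derivable. Qed.

Lemma pd_sum (F : 'I_n -> V -> R) i x : (forall j, differentiable (F j) x) ->
  pd i (fun y => \sum_j F j y) x = \sum_j pd i (F j) x.
Proof.
move=> dF; rewrite (_ : (fun y => \sum_j F j y) = \sum_j F j).
  by rewrite derive_sum// => j; apply: diff_derivable.
by apply/funext => y; rewrite fct_sumE.
Qed.

Lemma pd_cst (a : R) i x : pd i (fun=> a) x = 0.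
Proof. exact: derive_cst. Qed.

Lemma smooth_on_coord O j : smooth_on O (fun y : V => y j 0).
Proof.
apply: smooth_on_subset (subsetT O) _ => s; elim/last_ind: s => [|s i _] x _.
  exact: differentiable_coord.
rewrite pderiv_rcons (_ : pderiv [:: i] _ = fun=> (i == j)%:R).
  exact: (smooth_on_cst _ openT).
by apply/funext => y; exact: pd_coord.
Qed.

Definition sqdist c x : R := \sum_i (x i 0 - c i 0) ^+ 2.

Lemma sqdist_ge0 c x : 0 <= sqdist c x.
Proof. by apply: sumr_ge0 => i _; exact: sqr_ge0. Qed.

Lemma sqdist_ge c x i : (x i 0 - c i 0) ^+ 2 <= sqdist c x.
Proof.
rewrite /sqdist (bigD1 i)//= lerDl; apply: sumr_ge0 => j _; exact: sqr_ge0.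
Qed.

Lemma smooth_coordB c i : smooth_on setT (fun x : V => x i 0 - c i 0).
Proof.
by apply: smooth_onD; [exact: openT|exact: smooth_on_coord|
  apply: smooth_on_cst; exact: openT].
Qed.

Lemma smooth_sqdist c : smooth_on setT (sqdist c).
Proof.
apply: smooth_on_sum => [|i]; first exact: openT.
rewrite (_ : (fun x => _) = fun x : V => (x i 0 - c i 0) * (x i 0 - c i 0)).
  by apply: smooth_onM; [exact: openT|exact: smooth_coordB|exact: smooth_coordB].
by apply/funext => x; rewrite expr2.
Qed.

Lemma pd_coordB c j i x : pd i (fun x : V => x j 0 - c j 0) x = (i == j)%:R.
Proof.
apply: etrans (@pdD (fun x : V => x j 0) (fun=> - c j 0) i x _ _) _.
- exact: differentiable_coord.
- exact: differentiable_cst.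
by rewrite pd_cst addr0 pd_coord.
Qed.

Lemma pd_sqdist c i x : pd i (sqdist c) x = 2 * (x i 0 - c i 0).
Proof.
have dB j := smooth_on_diff (smooth_coordB c j) (I : setT x).
rewrite /sqdist (_ : (fun x => _) =
    fun x : V => \sum_j (x j 0 - c j 0) * (x j 0 - c j 0)); last first.
  by apply/funext => y; apply: eq_bigr => j _; rewrite expr2.
rewrite pd_sum => [|j]; last by apply: differentiableM; exact: dB.
rewrite (bigD1 i)//= big1 => [|j ji]; rewrite pdM//; rewrite !pd_coordB.
  by rewrite eqxx !mulr1 addr0 mulr_natl mulr2n.
by rewrite [i == j]eq_sym (negbTE ji) !mulr0 addr0.
Qed.

(** The support is the closed Euclidean ball of radius [1 / k] around [c]; the index [m]
    is the order of the pole of the factor of [exp (- 1 / t)] in [flat]. *)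
Definition flatbump (m : nat) k c x : R := flat m (1 - k ^+ 2 * sqdist c x).

Lemma smooth_bump_arg k c : smooth_on setT (fun x => 1 - k ^+ 2 * sqdist c x).
Proof.
rewrite (_ : (fun x => _) = (fun x => 1 + (- k ^+ 2) * sqdist c x)); last first.
  by apply/funext => x; rewrite mulNr.
apply: smooth_onD; [exact: openT|by apply: smooth_on_cst; exact: openT|].
by apply: smooth_onZ; [exact: openT|exact: smooth_sqdist].
Qed.

Lemma pd_bump_arg k c i x :
  pd i (fun x => 1 - k ^+ 2 * sqdist c x) x = - (2 * k ^+ 2) * (x i 0 - c i 0).
Proof.
rewrite (_ : (fun x => _) = (fun x => 1 + (- k ^+ 2) * sqdist c x)); last first.
  by apply/funext => y; rewrite mulNr.
have dd := smooth_on_diff (smooth_sqdist c) (I : setT x).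
have ddZ : differentiable (fun y => (- k ^+ 2) * sqdist c y) x.
  by apply: smooth_on_diff (smooth_onZ _ openT (smooth_sqdist c)) _.
apply: etrans (@pdD (fun=> 1) (fun y => (- k ^+ 2) * sqdist c y) i x
  (differentiable_cst _ _) ddZ) _.
by rewrite pd_cst add0r (@pdZ (- k ^+ 2) (sqdist c))// pd_sqdist; ring.
Qed.

Lemma smooth_bump m k c : smooth_on setT (flatbump m k c).
Proof.
apply: (smooth_on_comp (D := setT) (k := flat m)) => //; first exact: openT.
- exact: smooth1_flat.
- exact: smooth_bump_arg.
Qed.

Lemma pd_bump m k c i x : pd i (flatbump m k c) x =
  (flatbump m.+2 k c x - m%:R * flatbump m.+1 k c x) * (- (2 * k ^+ 2) * (x i 0 - c i 0)).
Proof.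
rewrite /flatbump (pd_comp _ _ (is_derive_flat _ _)) ?pd_bump_arg//.
exact: (smooth_on_diff (smooth_bump_arg k c)).
Qed.

Lemma bump_ge0 m k c x : 0 <= flatbump m k c x.
Proof. exact: flat_ge0. Qed.

Lemma bump_center m k c : 0 < flatbump m k c c.
Proof.
rewrite /flatbump (_ : sqdist c c = 0) ?mulr0 ?subr0; last first.
  by rewrite /sqdist big1// => i _; rewrite subrr expr2 mulr0.
exact: flat_gt0.
Qed.

Lemma bump_out m k c x : 0 < k -> ~ cube c k^-1 x -> flatbump m k c x = 0.
Proof.
move=> k0 /existsNP[i /negP]; rewrite -leNgt => hi.
rewrite /flatbump flat_le0// subr_le0.
have h : k^-1 ^+ 2 <= sqdist c x.
  apply: le_trans (sqdist_ge c x i); rewrite -[leRHS]real_normK ?num_real//.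
  by rewrite lerXn2r// nnegrE ?normr_ge0// invr_ge0 ltW.
have k20 : 0 < k ^+ 2 by rewrite exprn_gt0.
by move: h; rewrite exprVn -[X in X <= _ -> _]mulr1 ler_pdivrMl.
Qed.

Lemma test_function_bump m k c r O : 0 < k -> k^-1 < r -> cube c r `<=` O ->
  test_function O (flatbump m k c).
Proof.
move=> k0 kr crO.
have ss : supp (flatbump m k c) `<=` [set x : V | forall i, `|x i 0 - c i 0| <= k^-1].
  rewrite (_ : [set x : V | _] = \bigcap_(i in [set: 'I_n])
     ((fun x : V => `|x i 0 - c i 0|) @^-1` [set t | t <= k^-1])); last first.
    by apply/seteqP; split=> [x h i _|x h i]; [exact: h|exact: (h i)].
  move=> x sx i _; move: x sx.
  have cl : closed ((fun x : V => `|x i 0 - c i 0|) @^-1` [set t | t <= k^-1]).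
    apply: closed_comp; last exact: closed_le.
    move=> x _; apply: (@continuous_comp _ _ _ (fun x : V => x i 0 - c i 0) Num.norm).
      by apply: smooth_on_continuous (smooth_coordB c i) _.
    exact: norm_continuous.
  move=> x; rewrite (proj1 (closure_id _) cl); apply: closure_subset => {}x /= h.
  rewrite leNgt; apply/negP => hi; move/eqP: h; apply.
  by apply: bump_out => // /(_ i) h2; have := lt_trans hi h2; rewrite ltxx.
have sr : supp (flatbump m k c) `<=` cube c r.
  by move=> x /ss /= h i; apply: le_lt_trans kr; exact: h.
split; [by apply/smoothP; exact: smooth_bump| |exact: subset_trans crO].
apply: bounded_closed_compact_cV; last exact: closed_closure.
exists (`|c| + k^-1); split; first exact: num_real.
move=> N hN x /ss /= h.
have N0 : 0 <= N.
  by rewrite (le_trans _ (ltW hN))// addr_ge0// invr_ge0 ltW.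
apply/mx_norm_leP => // i j; rewrite [j]ord1.
rewrite -[x i 0](subrK (c i 0)) (le_trans (ler_normD _ _))// addrC.
by rewrite (le_trans _ (ltW hN))// lerD// coord_norm_le.
Qed.

Definition lap f x : R := \sum_i pd i (pd i f) x.

Lemma lap_bump k c x : lap (flatbump 0 k c) x =
  (flatbump 4 k c x - 2 * flatbump 3 k c x) * (4 * k ^+ 4 * sqdist c x)
  - flatbump 2 k c x * (2 * k ^+ 2 * n%:R).
Proof.
rewrite /lap.
transitivity (\sum_(i < n) ((flatbump 4 k c x - 2 * flatbump 3 k c x) *
    (4 * k ^+ 4 * (x i 0 - c i 0) ^+ 2) - flatbump 2 k c x * (2 * k ^+ 2))).
  apply: eq_bigr => i _.
  rewrite (_ : pd i (flatbump 0 k c) =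
    fun y => flatbump 2 k c y * (- (2 * k ^+ 2) * (y i 0 - c i 0))); last first.
    by apply/funext => y; rewrite pd_bump mul0r subr0.
  have dC := smooth_coordB c i.
  have dZ := smooth_onZ (- (2 * k ^+ 2)) openT dC.
  rewrite pdM; last 2 first.
  - exact: (smooth_on_diff (smooth_bump 2 k c)).
  - exact: (smooth_on_diff dZ).
  rewrite pdZ; last exact: (smooth_on_diff dC).
  by rewrite pd_bump pd_coordB eqxx [true%:R]/(1%:R) /=; ring.
rewrite sumrB; congr (_ - _); first by rewrite -mulr_sumr -mulr_sumr.
by rewrite sumr_const card_ord [RHS]mulrA [RHS]mulr_natr.
Qed.

End flatbump.

(** * Interior maxima of subharmonic functions *)

Section touching_kernel.
Context {R : realType} {n : nat}.
Local Notation V := 'cV[R]_n.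
Implicit Types (x c : V) (k : R).

Let kernel k c x : R := k ^+ n * flatbump 2 k c x.
Let kernel' k c x : R := n%:R * k ^+ n.-1 * flatbump 2 k c x
  + k ^+ n * ((flatbump 4 k c x - 2 * flatbump 3 k c x) * (- (2 * k * sqdist c x))).

Lemma is_derive_kernel k c x : is_derive k 1 (fun k => kernel k c x) (kernel' k c x).
Proof.
have d1 : is_derive k 1 (fun k : R => 1 - k ^+ 2 * sqdist c x) (- (2 * k * sqdist c x)).
  rewrite (_ : (fun k : R => _) = cst 1 - (sqdist c x \*: (id ^+ 2))); last first.
    by apply/funext => s; rewrite !fctE /= mulrC.
  apply: is_derive_eq (is_deriveB (is_derive_cst (1 : R) k (1 : R))
    (is_deriveZ (sqdist c x) (is_deriveX 2 (is_derive_id k (1 : R))))) _.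
  by rewrite /GRing.scale/= expr1; ring.
have d2 := @is_derive1_comp R (flat 2) (fun k : R => 1 - k ^+ 2 * sqdist c x) k _ _
  (is_derive_flat _ _) d1.
have d3 := is_deriveX n (is_derive_id k (1 : R)).
rewrite (_ : (fun k => kernel k c x) =
  (id ^+ n) * (flat 2 \o (fun k : R => 1 - k ^+ 2 * sqdist c x))); last first.
  by apply/funext => s; rewrite !fctE.
apply: is_derive_eq (is_deriveM d3 d2) _.
by rewrite /GRing.scale/= fctE /kernel' /flatbump; ring.
Qed.

(** The radial profiles [flat 2] and [flat 0] are matched so that the scale derivative of
    the kernel is a multiple of a Laplacian: means against the kernel are then
    monotone for subharmonic functions. *)
Lemma kernel_derivative k c x : 0 < k ->
  kernel' k c x = - (k ^+ n / (2 * k ^+ 3)) * lap (flatbump 0 k c) x.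
Proof.
move=> k0; have kn0 : k != 0 by rewrite gt_eqF.
rewrite lap_bump /kernel'.
have -> : n%:R * k ^+ n.-1 = n%:R * k ^+ n / k.
  by case: (n) => [|m]; [rewrite !mul0r|rewrite exprSr mulrA mulfK].
by field.
Qed.

Lemma bump_le m k c x : `|flatbump m k c x| <= m%:R ^+ m.
Proof. by rewrite ger0_norm ?bump_ge0// flat_bound. Qed.

Lemma sqdist_cube_le c r x : cube c r x -> sqdist c x <= r ^+ 2 *+ n.
Proof.
move=> h; rewrite -[X in _ *+ X]card_ord -sumr_const; apply: ler_sum => i _.
have r0 : 0 <= r by rewrite ltW// (le_lt_trans (normr_ge0 _) (h i)).
by rewrite -real_normK ?num_real// lerXn2r ?nnegrE// ltW.
Qed.

Lemma kernel_derivative_le (r v : R) c : exists2 C, 0 <= C &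
  forall k x, 0 <= k -> k <= v -> cube c r x -> `|kernel' k c x| <= C.
Proof.
exists (n%:R * `|v| ^+ n.-1 * 2%:R ^+ 2
  + `|v| ^+ n * ((4%:R ^+ 4 + 2 * 3%:R ^+ 3) * (2 * `|v| * (r ^+ 2 *+ n)))).
  by rewrite addr_ge0// !mulr_ge0// ?exprn_ge0// ?addr_ge0// ?mulr_ge0 ?mulrn_wge0 ?sqr_ge0.
move=> k x k0 kv xr; have kv' : `|k| <= `|v|.
  by rewrite !ger0_norm// (le_trans k0).
rewrite (le_trans (ler_normD _ _))// lerD// !normrM !normrX.
  rewrite [`|n%:R|]ger0_norm//.
  apply: ler_pM => //; rewrite ?mulr_ge0 ?exprn_ge0//; last exact: bump_le.
  by rewrite ler_wpM2l// lerXn2r.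
rewrite normrN !normrM [`|2|]ger0_norm//.
apply: ler_pM => //; rewrite ?mulr_ge0 ?exprn_ge0//.
  by rewrite lerXn2r.
apply: ler_pM => //; rewrite ?mulr_ge0//.
  rewrite (le_trans (ler_normB _ _))// lerD ?bump_le// normrM [`|2|]ger0_norm//.
  by rewrite ler_wpM2l// bump_le.
apply: ler_pM => //; rewrite ?mulr_ge0//.
  by rewrite ler_wpM2l.
by rewrite ger0_norm ?sqdist_ge0// sqdist_cube_le.
Qed.

Lemma bump_measurable m k c : measurable_fun setT (flatbump m k c).
Proof.
by apply: measurable_fun_continuous => x; apply: smooth_on_continuous (smooth_bump m k c) _.
Qed.

Lemma measurable_kernel_derivative k c : measurable_fun setT (kernel' k c).
Proof.
have md : measurable_fun setT (sqdist c).
  by apply: measurable_fun_continuous => x; apply: smooth_on_continuous (smooth_sqdist c) _.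
have mb := fun m => bump_measurable m k c.
apply: measurable_funD; first exact: measurable_funM.
apply: measurable_funM => //; apply: measurable_funM.
  by apply: measurable_funB => //; exact: measurable_funM.
by apply: measurableT_comp => //; exact: measurable_funM.
Qed.

(** A continuous function cannot have an interior maximum, equal to [0], at [c]
    while being strictly subharmonic near [c] in the sense of distributions.
    The means of [Z] against the kernels [k ^+ n * flatbump 2 k c] tend to [Z c]
    as [k] grows, and the derivative of such a mean with respect to [k] is a
    negative multiple of the integral of [Z] against the Laplacian of [flatbump 0 k c]:
    hence the means decrease strictly to [0], although they are nonpositive. *)
Lemma subharmonic_touch (Z : V -> R) c (r B : R) : 0 < r ->
  measurable_fun setT Z -> (forall x, `|Z x| <= B) ->
  (forall x, ~ cube c r x -> Z x = 0) -> (forall x, Z x <= 0) ->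
  Z c = 0 -> {for c, continuous Z} ->
  (forall k, r^-1 < k -> 0 < \int[leb n]_x (Z x * lap (flatbump 0 k c) x)) -> False.
Proof.
move=> r0 mZ ZB Z0 Zle Zc cZ Zlap.
have B0 : 0 <= B := le_trans (normr_ge0 _) (ZB c).
have ri0 : 0 < r^-1 by rewrite invr_gt0.
have mcube := measurable_cube c r.
pose f k x := Z x * kernel k c x.
pose A k := \int[leb n]_(x in cube c r) f k x.
have mw k : measurable_fun setT (kernel k c).
  by apply: measurable_funM => //; exact: bump_measurable.
have mf k : measurable_fun setT (f k) by apply: measurable_funM.
have intT k : (leb n).-integrable setT (EFin \o f k).
  apply: (@integrable_bounded_cube _ _ c r (B * (`|k| ^+ n * 2%:R ^+ 2))) => //.
  - exact: ltW.
  - move=> x; rewrite !normrM normrX; apply: ler_pM => //.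
    by rewrite ler_wpM2l ?exprn_ge0// bump_le.
  - by move=> x /Z0; rewrite /f => ->; rewrite mul0r.
have intf k : (leb n).-integrable (cube c r) (EFin \o f k).
  by apply: integrableS (intT k).
have AE k : A k = \int[leb n]_x f k x.
  by apply: Rintegral_supported => x /Z0; rewrite /f => ->; rewrite mul0r.
have df k x : is_derive k 1 (fun k => f k x) (Z x * kernel' k c x).
  have h := is_deriveZ (Z x) (is_derive_kernel k c x).
  exact: h.
have dA k : r^-1 < k -> is_derive k 1 A (- (k ^+ n / (2 * k ^+ 3)) *
    \int[leb n]_x (Z x * lap (flatbump 0 k c) x)).
  move=> rk; have k0 : 0 < k by exact: lt_trans rk.
  have [C C0 hC] := kernel_derivative_le r (k + 1) c.
  have Ik : `]r^-1, (k + 1)[%classic k by rewrite /= in_itv/= rk ltrDl ltr01.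
  have d1 : forall y x, `]r^-1, (k + 1)[%classic y -> cube c r x -> derivable (f ^~ x) y 1.
    by move=> y x _ _; have [] := df y x.
  have GE y x : partial1of2 f y x = Z x * kernel' y c x.
    by rewrite partial1of2E; apply: derive_val; exact: df.
  have iG : (leb n).-integrable (cube c r) (EFin \o (fun=> B * C)).
    apply: measurable_bounded_integrable => //.
      by apply: leb_cube_fin; exact: ltW.
    exact: bounded_cst.
  have ub : forall y x, `]r^-1, (k + 1)[%classic y -> cube c r x ->
      `|partial1of2 f y x| <= B * C.
    move=> y x; rewrite /= in_itv/= => /andP[ry yk] xr; rewrite GE normrM.
    by apply: ler_pM => //; apply: hC => //; apply: ltW => //; exact: lt_trans ry.
  have D := derivable_under_integral mcube Ik (fun y _ => intf y) d1
    (fun=> mulr_ge0 B0 C0) iG ub.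
  have E := differentiation_under_integral mcube Ik (fun y _ => intf y) d1
    (fun=> mulr_ge0 B0 C0) iG ub.
  apply: DeriveDef => //; rewrite -derive1E [LHS]E.
  have iw : (leb n).-integrable setT (EFin \o (fun x => Z x * kernel' k c x)).
    apply: (@integrable_bounded_cube _ _ c r (B * C)) => //.
    - apply: measurable_funM => //; exact: measurable_kernel_derivative.
    - exact: ltW.
    - move=> x; have [xr|/Z0 ->] := pselect (cube c r x); last first.
        by rewrite mul0r normr0 mulr_ge0.
      by rewrite normrM; apply: ler_pM => //; apply: hC => //; rewrite ?ltW// ltrDl.
    - by move=> x /Z0 ->; rewrite mul0r.
  have q0 : - (k ^+ n / (2 * k ^+ 3)) != 0.
    by rewrite oppr_eq0 mulf_neq0 ?invr_eq0 ?mulf_neq0 ?expf_neq0// gt_eqF.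
  have iL : (leb n).-integrable setT (EFin \o (fun x => Z x * lap (flatbump 0 k c) x)).
    rewrite (_ : EFin \o _ = fun x : V => ((- (k ^+ n / (2 * k ^+ 3)))^-1%:E *
        (Z x * kernel' k c x)%:E)%E); first exact: (integrableZl _ _ iw).
    apply/funext => x /=; rewrite kernel_derivative// -EFinM; congr EFin.
    by rewrite [Z x * (_ * _)]mulrCA mulKf.
  rewrite -RintegralZl// (@Rintegral_supported _ _ (cube c r)); last first.
    by move=> x /Z0 Zx; rewrite GE Zx mul0r.
  apply: eq_Rintegral => x _; rewrite GE kernel_derivative//.
  by rewrite mulrCA.
have decr k1 k2 : r^-1 < k1 -> k1 < k2 -> A k2 < A k1.
  move=> rk1 k12; have dA' k : k1 <= k -> _ := fun h => dA k (lt_le_trans rk1 h).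
  pose dA0 k := - (k ^+ n / (2 * k ^+ 3)) *
      \int[leb n]_x (Z x * lap (flatbump 0 k c) x).
  have d0 k : k \in `]k1, k2[ -> is_derive k 1 A (dA0 k).
    by rewrite in_itv/= => /andP[/ltW h _]; exact: dA'.
  have c0 : {within `[k1, k2], continuous A}.
    apply: derivable_within_continuous => k; rewrite in_itv/= => /andP[h _].
    by have [] := dA' _ h.
  have [k] := MVT k12 d0 c0.
  rewrite in_itv/= => /andP[h _] E; rewrite -subr_lt0 E /dA0.
  have k0 : 0 < k by rewrite (lt_trans ri0)// (lt_trans rk1).
  rewrite mulNr mulNr oppr_lt0 !mulr_gt0 ?subr_gt0 ?invr_gt0 ?mulr_gt0 ?exprn_gt0//.
  by apply: Zlap; exact: lt_trans h.
(* the kernel concentrates at [c], where [Z] is continuous and vanishes *)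
have small e : 0 < e -> exists2 K, 0 < K & forall k, K < k -> - e <= A k.
  move=> e0; pose M : R := 2%:R ^+ 2 * 2%:R ^+ n.
  have M0 : 0 < M by rewrite mulr_gt0// exprn_gt0.
  have eM0 : 0 < e / M by rewrite divr_gt0.
  have : \forall x \near c, `|Z c - Z x| <= e / M by move/cvgrPdist_le : cZ; apply.
  move=> /nbhs_cubeP[d d0 hd]; exists d^-1; first by rewrite invr_gt0.
  move=> k dk; have k0 : 0 < k by rewrite (lt_trans _ dk)// invr_gt0.
  have kd : k^-1 < d by rewrite -[d]invrK ltf_pV2// posrE// invr_gt0.
  rewrite AE -(@Rintegral_supported _ _ (cube c k^-1)); last first.
    by move=> x /(bump_out 2 k0) h; rewrite /f /kernel h !mulr0.
  have mk := measurable_cube c k^-1.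
  have ik0 : 0 <= k^-1 by rewrite invr_ge0 ltW.
  have -> : - e = \int[leb n]_(x in cube c k^-1) (- (e / M * (k ^+ n * 2%:R ^+ 2))).
    rewrite Rintegral_cst//.
    rewrite (_ : fine _ = (k^-1 *+ 2) ^+ n); last first.
      exact: (congr1 fine (leb_cube c ik0)).
    rewrite -(mulr_natr k^-1) exprMn exprVn /M.
    have kn0 : k ^+ n != 0 by rewrite expf_neq0// gt_eqF.
    have n0 : (2 : R) ^+ n != 0 by rewrite expf_neq0// pnatr_eq0.
    by field; rewrite kn0.
  apply: le_Rintegral => //.
  - apply: measurable_bounded_integrable => //; first exact: leb_cube_fin.
    exact: bounded_cst.
  - by apply: integrableS (intT k).
  - move=> x xk; rewrite /f.
    have Zx : `|Z x| <= e / M.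
      have := hd x; rewrite /= Zc sub0r normrN; apply.
      by move=> i; apply: lt_trans kd; exact: xk.
    rewrite lerNl -mulNr; apply: (le_trans (ler_norm _)); rewrite normrM normrN.
    apply: ler_pM => //; rewrite normrM ger0_norm ?exprn_ge0 ?(ltW k0)//.
    by rewrite ler_wpM2l ?exprn_ge0 ?(ltW k0)// bump_le.
have Age0 k : r^-1 < k -> 0 <= A k.
  move=> rk; rewrite leNgt; apply/negP => Ak.
  have [K K0 hK] := small (- A k) ltac:(by rewrite oppr_gt0).
  pose k' := Num.max (k + 1) (K + 1).
  have kk' : k < k' by rewrite lt_max ltrDl ltr01.
  have Kk' : K < k' by rewrite lt_max (ltrDl K) ltr01 orbT.
  by have := hK _ Kk'; rewrite opprK leNgt (decr _ _ rk kk').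
have Ale0 k : 0 < k -> A k <= 0.
  move=> k0; rewrite -[leRHS](mul0r (fine (leb n (cube c r)))) -Rintegral_cst//.
  apply: le_Rintegral => //.
    by apply: integrable0.
  move=> x _; rewrite /f mulr_le0_ge0// mulr_ge0 ?bump_ge0// exprn_ge0//.
  exact: ltW.
have h1 : r^-1 < r^-1 + 1 by rewrite ltrDl.
have h2 : r^-1 + 1 < r^-1 + 2 by rewrite ltrD2l ltr1n.
have := lt_le_trans (decr _ _ h1 h2) (Ale0 _ (lt_trans ri0 h1)).
by rewrite ltNge Age0// (lt_trans h1 h2).
Qed.

End touching_kernel.

(** * Weak subsolutions touched from above *)

Section weak_subsolutions.
Context {R : realType} {n : nat}.
Local Notation V := 'cV[R]_n.
Implicit Types (f g u v phi psi W h : V -> R) (O D U : set V) (x c : V).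
Local Notation pd i f := ('D_(delta_mx i 0) f).

Lemma Rintegral_sum (F : 'I_n -> V -> R) :
  (forall i, (leb n).-integrable setT (EFin \o F i)) ->
  \int[leb n]_x (\sum_i F i x) = \sum_i \int[leb n]_x F i x.
Proof.
move=> iF.
have iS s : (leb n).-integrable setT (EFin \o (fun x => \sum_(i <- s) F i x)).
  rewrite (_ : EFin \o _ = fun x => (\sum_(i <- s) (F i x)%:E)%E).
    apply: (@integrable_sum _ _ _ _ _ measurableT _ s xpredT (fun i x => (F i x)%:E)).
    by move=> i _; exact: iF.
  by apply/funext => x /=; rewrite sumEFin.
elim: (index_enum 'I_n) => [|i s IH].
  under eq_Rintegral do rewrite big_nil.
  by rewrite big_nil Rintegral_cst// mul0r.
under eq_Rintegral do rewrite big_cons.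
by rewrite RintegralD//; rewrite IH big_cons.
Qed.

Lemma ae_ge0_Rintegral f : (leb n).-integrable setT (EFin \o f) ->
  {ae leb n, forall x, 0 <= f x} -> 0 <= \int[leb n]_x f x.
Proof.
move=> If f0.
have mf : measurable_fun setT f by apply/measurable_EFinP; exact: measurable_int If.
have -> : \int[leb n]_x f x = \int[leb n]_x (Num.max (f x) 0).
  congr fine; apply: ae_eq_integral => //.
  - exact/measurable_EFinP.
  - by apply/measurable_EFinP; apply: measurable_maxr.
  - by apply: filterS f0 => x f0 _ /=; rewrite max_l.
by apply: Rintegral_ge0 => x _; rewrite le_max lexx orbT.
Qed.

Lemma bump_Rintegral_gt0 m k c : 0 < k -> 0 < \int[leb n]_x flatbump m k c x.
Proof.
move=> k0; set e := flatbump m k c c / 2.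
have e0 : 0 < e by rewrite divr_gt0// bump_center.
have : \forall x \near c, e < flatbump m k c x.
  have cb : {for c, continuous (flatbump m k c)}.
    by apply: smooth_on_continuous (smooth_bump m k c) _.
  apply: (cvgr_gt _ cb).
  by rewrite /e ltr_pdivrMr// mulr_natr mulr2n ltrDl bump_center.
move=> /nbhs_cubeP[d d0 hd].
have tb : test_function setT (flatbump m k c).
  by apply: (@test_function_bump _ _ m k c (k^-1 + 1)) => //; rewrite ltrDl.
have mc := measurable_cube c d.
apply: (@lt_le_trans _ _ (\int[leb n]_(x in cube c d) e)).
  rewrite Rintegral_cst//= (_ : fine _ = (d *+ 2) ^+ n); last first.
    exact: (congr1 fine (leb_cube c (ltW d0))).
  by rewrite mulr_gt0// exprn_gt0// mulrn_wgt0.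
rewrite Rintegral_mkcond; apply: le_Rintegral => //.
- rewrite -restrict_EFin; apply/(integrable_mkcond _ mc).
  apply: measurable_bounded_integrable => //; first exact: leb_cube_fin (ltW d0).
  exact: bounded_cst.
- exact: test_function_integrable tb.
- move=> x _; rewrite patchE; case: ifPn => [/set_mem/hd/ltW//|_].
  exact: bump_ge0.
Qed.

Section pairing.
Variables (O : set V) (W : V -> R).
Hypotheses (oO : open O) (sW : smooth_on O W).

(** Multiplication by this factor turns the drift [grad W] into a zero order term. *)
Definition half_exp x : R := expR (2^-1 * W x).
Local Notation h := half_exp.

Lemma smooth_half_exp : smooth_on O h.
Proof.
apply: (smooth_on_comp (D := setT) (k := expR)) => //; first exact: smooth1_expR.
exact: smooth_onZ.
Qed.

Lemma pd_half_exp i x : O x -> 2 * pd i h x = h x * pd i W x.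
Proof.
move=> Ox; have dW := smooth_on_diff sW Ox.
have dZ := smooth_on_diff (smooth_onZ 2^-1 oO sW) Ox.
rewrite /half_exp (pd_comp _ dZ (is_derive_expR _)) pdZ//.
by rewrite mulrCA [2 * _]mulrA divff ?mul1r// pnatr_eq0.
Qed.

(** Moves [h] inside the derivatives, so that the weak derivatives of a function can be
    tested against [h * phi] and [grad h * phi]. *)
Lemma pairing_identity i phi : test_function O phi ->
  forall x, h x * pd i (pd i phi) x =
    pd i (pd i (fun y => h y * phi y)) x
    - pd i (fun y => (2 * pd i h y) * phi y) x + pd i (pd i h) x * phi x.
Proof.
move=> tphi x; have sh := smooth_half_exp.
have sphi := test_function_smooth tphi.
have [Ox|nOx] := pselect (O x); last first.
  have nx : ~ supp phi x by case: tphi => _ _ sO /sO.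
  have p0 : pd i (pd i phi) x = 0 := pderiv_supp [:: i; i] nx.
  have nh psi : ~ supp (fun y => psi y * phi y) x.
    by move=> s; apply: nx; apply: supp_sub s => y ->; rewrite mulr0.
  have p1 : pd i (pd i (fun y => h y * phi y)) x = 0 :=
    pderiv_supp [:: i; i] (nh h).
  have p2 : pd i (fun y => (2 * pd i h y) * phi y) x = 0 :=
    pderiv_supp [:: i] (nh (fun y => 2 * pd i h y)).
  by rewrite p0 p1 p2 (supp0 nx) !mulr0 subrr addr0.
have sphiO : smooth_on O phi := smooth_on_subset (@subsetT _ O) sphi.
have dh y (Oy : O y) := smooth_on_diff sh Oy.
have dph y (Oy : O y) := smooth_on_diff sphiO Oy.
have dph1 y (Oy : O y) := smooth_on_diff (smooth_on_pd i sphiO) Oy.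
have dh1 y (Oy : O y) := smooth_on_diff (smooth_on_pd i sh) Oy.
have E1 : pd i (pd i (fun y => h y * phi y)) x =
    pd i (fun y => h y * pd i phi y + phi y * pd i h y) x.
  apply: near_eq_derive; have : nbhs x O by exact: open_nbhs_nbhs.
  by apply: filterS => y Oy; rewrite pdM//; [exact: dh|exact: dph].
rewrite E1 (@pdD _ _ (fun y => h y * pd i phi y) (fun y => phi y * pd i h y)); last 2 first.
- by apply: differentiableM; [exact: dh|exact: dph1].
- by apply: differentiableM; [exact: dph|exact: dh1].
rewrite (@pdM _ _ h (pd i phi)); [|exact: dh|exact: dph1].
rewrite (@pdM _ _ phi (pd i h)); [|exact: dph|exact: dh1].
rewrite (@pdM _ _ (fun y => 2 * pd i h y) phi); last 2 first.
- by apply: smooth_on_diff Ox; apply: smooth_onZ => //; exact: smooth_on_pd.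
- exact: dph.
rewrite (@pdZ _ _ 2 (pd i h)); last exact: dh1.
move: (h x) (phi x) (pd i h x) (pd i phi x) (pd i (pd i phi) x) (pd i (pd i h) x).
by move=> a b a1 b1 b2 a2; ring.
Qed.

(** The part in direction [i] of [h * (lap v + grad W . grad v) + v * lap h], in terms of
    the weak derivatives of [v]; recall that [2 grad h = h grad W]. *)
Definition paired v (dv : seq 'I_n -> V -> R) i x : R :=
  dv [:: i; i] x * h x + dv [:: i] x * (2 * pd i h x) + v x * pd i (pd i h) x.

Lemma weak_pairing D U v dv phi i : measurable D -> U `<=` D -> U `<=` O ->
  open U ->
  (forall s, (size s <= 2)%N -> weak_derivative D s v (dv s)) ->
  test_function U phi ->
  [/\ (leb n).-integrable setT (EFin \o (fun x => v x * (h x * pd i (pd i phi) x))),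
      (leb n).-integrable setT (EFin \o (fun x => paired v dv i x * phi x)) &
      \int[leb n]_x (v x * (h x * pd i (pd i phi) x)) =
      \int[leb n]_x (paired v dv i x * phi x)].
Proof.
move=> mD UD UO oU wv tphi.
have shU := smooth_on_subset UO smooth_half_exp.
have sh1U : smooth_on U (fun y => 2 * pd i h y).
  by apply: smooth_onZ => //; exact: smooth_on_pd.
have sh2U : smooth_on U (pd i (pd i h)) by do 2 apply: smooth_on_pd.
have tO := test_function_subset UO tphi.
have t1 := test_functionM oU shU tphi.
have t2 := test_functionM oU sh1U tphi.
have t3 := test_functionM oU sh2U tphi.
have t0 := test_functionM oU shU (test_function_pderiv [:: i; i] tphi).
have t1' := test_function_pderiv [:: i; i] t1.
have t2' := test_function_pderiv [:: i] t2.
have [w0 w1 w2] := And3 (wv [::] isT) (wv [:: i] isT) (wv [:: i; i] isT).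
have [Lv _ _] := w0; have [_ Lv1 _] := w1; have [_ Lv2 _] := w2.
have I f g (Lf : L1_loc D f) (tg : test_function U g) :=
  L1_loc_test_integrable mD Lf (test_function_subset UD tg).
have i0 := I _ _ Lv t0.
have i1 := I _ _ Lv t1'. have i2 := I _ _ Lv t2'. have i3 := I _ _ Lv t3.
have j1 := I _ _ Lv2 t1. have j2 := I _ _ Lv1 t2.
have e1 := weak_derivative_test UD w2 t1.
have e2 := weak_derivative_test UD w1 t2.
have PE : (fun x => paired v dv i x * phi x) = fun x =>
    (dv [:: i; i] x * (h x * phi x) + dv [:: i] x * (2 * pd i h x * phi x))
    + v x * (pd i (pd i h) x * phi x).
  by apply/funext => x; rewrite /paired; ring.
have j12 : (leb n).-integrable setT (EFin \o (fun x =>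
    dv [:: i; i] x * (h x * phi x) + dv [:: i] x * (2 * pd i h x * phi x))).
  rewrite (_ : EFin \o _ = (fun x : V => (dv [:: i; i] x * (h x * phi x))%:E +
    (dv [:: i] x * (2 * pd i h x * phi x))%:E)%E) //; exact: integrableD.
split => //.
  rewrite PE (_ : EFin \o _ = (fun x : V => (dv [:: i; i] x * (h x * phi x)
     + dv [:: i] x * (2 * pd i h x * phi x))%:E
     + (v x * (pd i (pd i h) x * phi x))%:E)%E) //; exact: integrableD.
rewrite PE RintegralD// RintegralD//.
have k12 : (leb n).-integrable setT (EFin \o (fun x =>
    v x * pderiv [:: i; i] (fun y => h y * phi y) x -
    v x * pderiv [:: i] (fun y => 2 * pd i h y * phi y) x)).
  rewrite (_ : EFin \o _ = (fun x : V =>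
    (v x * pderiv [:: i; i] (fun y => h y * phi y) x)%:E -
    (v x * pderiv [:: i] (fun y => 2 * pd i h y * phi y) x)%:E)%E) //.
  exact: integrableB.
transitivity (\int[leb n]_x ((v x * pderiv [:: i; i] (fun y => h y * phi y) x -
    v x * pderiv [:: i] (fun y => 2 * pd i h y * phi y) x)
    + v x * (pd i (pd i h) x * phi x))).
  by apply: eq_Rintegral => x _; rewrite (pairing_identity i tO) /= mulrDr mulrBr.
rewrite RintegralD// RintegralB// e1 e2 /=.
by rewrite expr1 sqrrN expr1n mul1r mulN1r opprK.
Qed.

End pairing.
End weak_subsolutions.

Section touching.
Context {R : realType} {n : nat}.
Local Notation V := 'cV[R]_n.
Implicit Types (f g u v phi psi W h : V -> R) (O D U : set V) (x c : V).
Local Notation pd i f := ('D_(delta_mx i 0) f).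

Lemma open_cube c (r : R) : 0 < r -> open (cube c r).
Proof. by move=> r0; rewrite -ballE_cube//; exact: ball_open. Qed.

Definition drift_op W psi x : R := lap psi x + \sum_i pd i W x * pd i psi x.

Lemma smooth_on_lap O psi : open O -> smooth_on O psi -> smooth_on O (lap psi).
Proof. by move=> oO sp; apply: smooth_on_sum => // i; do 2 apply: smooth_on_pd. Qed.

Lemma smooth_on_drift_op O W psi : open O -> smooth_on O W -> smooth_on O psi ->
  smooth_on O (drift_op W psi).
Proof.
move=> oO sW sp; apply: smooth_onD => //; first exact: smooth_on_lap.
by apply: smooth_on_sum => // i; apply: smooth_onM => //; exact: smooth_on_pd.
Qed.

(** Weak subsolutions are viscosity subsolutions: a smooth function which touches
    [u] from above at [x0] is itself a subsolution at [x0]. Otherwise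
    [exp (W / 2) * (u - psi)] would be strictly subharmonic near [x0], where it
    attains its maximum [0]. *)
Lemma weak_touch O W D u du O' psi g x0 :
  open O -> smooth_on O W -> open D -> D `<=` O -> open O' -> smooth_on O' psi ->
  D x0 -> O' x0 -> (forall x, D x -> {for x, continuous u}) ->
  (forall s, (size s <= 2)%N -> weak_derivative D s u (du s)) ->
  (\forall x \near x0, u x <= psi x) -> u x0 = psi x0 ->
  {for x0, continuous g} ->
  {ae leb n, forall x, D x ->
    g x <= \sum_i du [:: i; i] x + \sum_i pd i W x * du [:: i] x} ->
  g x0 <= drift_op W psi x0.
Proof.
move=> oO sW oD DO oO' sp Dx0 O'x0 cu wu upsi u0 cg aeg.
rewrite leNgt; apply/negP => Lg.
pose h := half_exp W.
have sh : smooth_on O h := smooth_half_exp oO sW.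
have Ox0 := DO _ Dx0.
have ch : {for x0, continuous h} := smooth_on_continuous sh Ox0.
have cpsi : {for x0, continuous psi} := smooth_on_continuous sp O'x0.
have clh : {for x0, continuous (lap h)} :=
  smooth_on_continuous (smooth_on_lap oO sh) Ox0.
have oOO : open (O `&` O') := openI oO oO'.
have cL : {for x0, continuous (drift_op W psi)}.
  apply: (@smooth_on_continuous _ _ (O `&` O')) => //.
  apply: smooth_on_drift_op => //; first exact: smooth_on_subset sW.
  exact: smooth_on_subset sp.
(* a continuous function, positive at [x0], which bounds the Laplacian of
   [h * (u - psi)] from below almost everywhere near [x0] *)
pose E x := (g x - drift_op W psi x) * h x + (u x - psi x) * lap h x.
have cE : {for x0, continuous E}.
  apply: (@continuousD _ _ _ (fun x => (g x - drift_op W psi x) * h x)).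
    apply: (@continuousM _ _ (fun x => g x - drift_op W psi x)) => //.
    exact: (@continuousB _ _ _ g).
  apply: (@continuousM _ _ (fun x => u x - psi x)) => //.
  by apply: (@continuousB _ _ _ u) => //; exact: cu.
have E0 : 0 < E x0.
  by rewrite /E u0 subrr mul0r addr0 mulr_gt0 ?subr_gt0// expR_gt0.
pose eta := E x0 / 2.
have eta0 : 0 < eta by rewrite divr_gt0.
have nE : \forall x \near x0, eta < E x.
  apply: (cvgr_gt _ cE).
  by rewrite /eta ltr_pdivrMr// mulr_natr mulr2n ltrDl.
pose z x := h x * (u x - psi x).
have cz x : (D `&` O') x -> {for x, continuous z}.
  move=> [Dx O'x]; apply: (@continuousM _ _ h (fun x => u x - psi x)).
    exact: smooth_on_continuous sh (DO _ Dx).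
  by apply: (@continuousB _ _ _ u); [exact: cu|exact: smooth_on_continuous sp O'x].
have z0 : z x0 = 0 by rewrite /z u0 subrr mulr0.
have nz : \forall x \near x0, `|z x| <= 1.
  have /cvgrPdist_le/(_ 1 ltr01) := cz x0 (conj Dx0 O'x0).
  by apply: filterS => x; rewrite z0 sub0r normrN.
have [r r0 hr] : exists2 r, 0 < r & cube x0 r `<=`
    [set x | [/\ D x, O' x, u x <= psi x, eta < E x & `|z x| <= 1]].
  apply/nbhs_cubeP; near=> x; split; near: x => //.
  - exact: open_nbhs_nbhs.
  - exact: open_nbhs_nbhs.
set U := cube x0 r in hr.
have oU : open U := open_cube r0.
have mU : measurable U := measurable_cube x0 r.
have mD : measurable D := open_measurable_cV oD.
have UD : U `<=` D by move=> x /hr[].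
have UO' : U `<=` O' by move=> x /hr[].
have UO : U `<=` O by apply: subset_trans UD DO.
have mz : measurable_fun U z.
  by apply: measurable_fun_continuous_open => // x /hr[Dx O'x _ _ _]; exact: cz.
pose Z := z \_ U.
have Ux0 : U x0 by move=> i; rewrite subrr normr0.
have ZU x : U x -> Z x = z x by move=> Ux; rewrite /Z patchE mem_set.
have ZnU x : ~ U x -> Z x = 0 by move=> nUx; rewrite /Z patchE memNset.
have nZ : \forall x \near x0, z x = Z x.
  have : nbhs x0 U by exact: open_nbhs_nbhs.
  by apply: filterS => x /ZU.
apply: (@subharmonic_touch _ _ Z x0 r 1) => //.
- exact/(measurable_restrictT _ mU).
- move=> x; have [Ux|/ZnU ->] := pselect (U x); last by rewrite normr0.
  by rewrite ZU//; have [] := hr _ Ux.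
- move=> x; have [Ux|/ZnU ->//] := pselect (U x).
  rewrite ZU// /z mulr_ge0_le0 ?expR_ge0// subr_le0; by have [] := hr _ Ux.
- by rewrite ZU.
- rewrite /prop_for /continuous_at -(nbhs_singleton nZ).
  exact: (cvg_trans (near_eq_cvg nZ) (cz _ (conj Dx0 O'x0))).
move=> k rk; have k0 : 0 < k by rewrite (lt_trans _ rk)// invr_gt0.
have kr : k^-1 < r by rewrite -[r]invrK ltf_pV2// posrE invr_gt0.
pose phi := flatbump 0 k x0.
have tphi : test_function U phi by exact: test_function_bump kr _.
have tphiT := test_function_subset (@subsetT _ U) tphi.
pose dpsi s := pderiv (rev s) psi.
have wpsi s : (size s <= 2)%N -> weak_derivative U s psi (dpsi s).
  by move=> _; apply: smooth_weak_derivative sp.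
have wp i := weak_pairing oO sW i mD UD UO oU wu tphi.
have wq i := weak_pairing oO sW i mU (@subset_refl _ U) UO oU wpsi tphi.
pose P i x := paired W u du i x * phi x - paired W psi dpsi i x * phi x.
have iP i : (leb n).-integrable setT (EFin \o P i).
  rewrite (_ : EFin \o _ = (fun x : V => (paired W u du i x * phi x)%:E -
    (paired W psi dpsi i x * phi x)%:E)%E) //.
  by apply: integrableB => //; [have [] := wp i|have [] := wq i].
have -> : \int[leb n]_x (Z x * lap phi x) = \int[leb n]_x (\sum_i P i x).
  rewrite Rintegral_sum//.
  pose Q i x := u x * (h x * pd i (pd i phi) x) - psi x * (h x * pd i (pd i phi) x).
  transitivity (\int[leb n]_x (\sum_i Q i x)).
    apply: eq_Rintegral => x _; rewrite /lap mulr_sumr; apply: eq_bigr => i _.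
    have [Ux|nUx] := pselect (U x); first by rewrite ZU// /z /Q -mulrBl [h x * (_ - _)]mulrC mulrA.
    have p0 : pd i (pd i phi) x = 0.
      exact: (test_function_sub (test_function_pderiv [:: i; i] tphi) nUx).
    by rewrite /Q p0 !mulr0 subrr.
  rewrite Rintegral_sum => [|i].
    apply: eq_bigr => i _; have [a1 a2 a3] := wp i; have [b1 b2 b3] := wq i.
    by rewrite /Q /P !RintegralB// a3 b3.
  have [a1 a2 a3] := wp i; have [b1 b2 b3] := wq i.
  rewrite (_ : EFin \o _ = (fun x : V => (u x * (h x * pd i (pd i phi) x))%:E -
    (psi x * (h x * pd i (pd i phi) x))%:E)%E) //.
  exact: integrableB.
have PE x : U x -> \sum_i P i x = (h x * (\sum_i du [:: i; i] x +
    \sum_i pd i W x * du [:: i] x - drift_op W psi x) + (u x - psi x) * lap h x) * phi x.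
  move=> Ux; rewrite /drift_op /lap -!big_split /= -sumrB mulr_sumr mulr_sumr.
  rewrite -big_split /= mulr_suml; apply: eq_bigr => i _.
  rewrite /P /paired (pd_half_exp oO sW i (UO _ Ux)) -/h /dpsi /=.
  move: (pd i W x) (pd i psi x) (pd i (pd i psi) x) (pd i (pd i h) x).
  move: (h x) (du [:: i; i] x) (du [:: i] x) (u x) (psi x) (phi x) => a d2 d1 s t p.
  by clear; move=> b1 b2 b3 b4; ring.
have iphi := test_function_integrable tphi.
have iEP : (leb n).-integrable setT (EFin \o (fun x => eta * phi x)).
  rewrite (_ : EFin \o _ = (fun x : V => eta%:E * (phi x)%:E)%E) //.
  exact: (integrableZl _ _ iphi).
have iSP : (leb n).-integrable setT (EFin \o (fun x => \sum_i P i x)).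
  rewrite (_ : EFin \o _ = fun x => (\sum_i (P i x)%:E)%E).
    apply: (@integrable_sum _ _ _ _ _ measurableT _ _ xpredT (fun i x => (P i x)%:E)).
    by move=> i _; exact: iP.
  by apply/funext => x /=; rewrite sumEFin.
rewrite (@lt_le_trans _ _ (\int[leb n]_x (eta * phi x)))//.
  by rewrite RintegralZl// mulr_gt0// bump_Rintegral_gt0.
rewrite -subr_ge0 -RintegralB//; apply: ae_ge0_Rintegral.
  rewrite (_ : EFin \o _ = (fun x : V => (\sum_i P i x)%:E - (eta * phi x)%:E)%E) //.
  exact: integrableB.
apply: filterS aeg => x hx; have [Ux|nUx] := pselect (U x); last first.
  rewrite big1 ?(test_function_sub tphi nUx) ?mulr0 ?subrr// => i _.
  by rewrite /P (test_function_sub tphi nUx) !mulr0 subrr.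
rewrite PE// -mulrBl mulr_ge0 ?bump_ge0// subr_ge0.
have [Dx _ _ /ltW hE _] := hr _ Ux.
apply: (le_trans hE); rewrite /E lerD2r [leLHS]mulrC.
apply: ler_wpM2l; first exact: expR_ge0.
by rewrite lerD2r; exact: hx.
Unshelve. all: by end_near. Qed.

End touching.

(** * Radial functions *)

Section radial.
Context {R : realType} {n : nat}.
Local Notation V := 'cV[R]_n.
Implicit Types (f g u v phi psi h : V -> R) (O D U : set V) (x c : V).
Local Notation pd i f := ('D_(delta_mx i 0) f).

Definition punctured : set V := [set x | x != 0].

Lemma sqdist0_gt0 x : (0 < sqdist 0 x) = (x != 0).
Proof.
rewrite lt_neqAle sqdist_ge0 andbT eq_sym; congr negb; apply/eqP/eqP => [h|->].
  apply/matrixP => i j; rewrite [j]ord1 !mxE; apply/eqP.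
  have := sqdist_ge 0 x i; rewrite h mxE subr0 => h2.
  by rewrite -sqrf_eq0 eq_le h2 sqr_ge0.
by rewrite /sqdist big1// => i _; rewrite subrr expr2 mulr0.
Qed.

Lemma continuous_sqdist c : continuous (sqdist c).
Proof. by move=> x; apply: smooth_on_continuous (smooth_sqdist c) _. Qed.

Lemma open_punctured : open punctured.
Proof.
rewrite (_ : punctured = sqdist 0 @^-1` [set t | 0 < t]).
  by apply: open_comp; [move=> x _; exact: continuous_sqdist|exact: open_gt].
by apply/seteqP; split=> x; rewrite /= sqdist0_gt0.
Qed.

Definition lognorm x : R := 2^-1 * ln (sqdist 0 x).

Lemma smooth_sqdist0 : smooth_on punctured (sqdist 0).
Proof. exact: smooth_on_subset (@subsetT _ _) (smooth_sqdist 0). Qed.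

Lemma smooth_ln_sqdist0 : smooth_on punctured (fun x => ln (sqdist 0 x)).
Proof.
apply: (smooth_on_comp (D := [set t | 0 < t])) => //; first exact: open_punctured.
- exact: smooth1_ln.
- exact: smooth_sqdist0.
- by move=> x; rewrite /= sqdist0_gt0.
Qed.

Lemma smooth_lognorm : smooth_on punctured lognorm.
Proof. by apply: smooth_onZ; [exact: open_punctured|exact: smooth_ln_sqdist0]. Qed.

Lemma pd_sqdist0 i x : pd i (sqdist 0) x = 2 * x i 0.
Proof. by apply: etrans (pd_sqdist 0 i x) _; rewrite mxE subr0. Qed.

Lemma pd_lognorm i x : punctured x -> pd i lognorm x = x i 0 / sqdist 0 x.
Proof.
move=> x0; have r0 : 0 < sqdist 0 x by rewrite sqdist0_gt0.
rewrite /lognorm (@pdZ _ _ 2^-1 (fun x => ln (sqdist 0 x))); last first.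
  exact: smooth_on_diff smooth_ln_sqdist0 _.
have dd : differentiable (sqdist 0) x := smooth_on_diff smooth_sqdist0 x0.
rewrite (pd_comp i dd (is_derive1_ln r0)) pd_sqdist0; field; exact: lt0r_neq0.
Qed.

Lemma pd_radial (D : set R) (f f1 f2 : R -> R) x i : open D ->
  (forall t, D t -> is_derive t 1 f (f1 t)) ->
  (forall t, D t -> is_derive t 1 f1 (f2 t)) -> punctured x -> D (lognorm x) ->
  pd i (fun y => f (lognorm y)) x = f1 (lognorm x) * (x i 0 / sqdist 0 x) /\
  pd i (pd i (fun y => f (lognorm y))) x =
    (f2 (lognorm x) - 2 * f1 (lognorm x)) * (x i 0 ^+ 2 / sqdist 0 x ^+ 2) +
    f1 (lognorm x) / sqdist 0 x.
Proof.
move=> oD df df1 x0 Dx.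
have d1 y : punctured y -> D (lognorm y) ->
    pd i (fun y => f (lognorm y)) y = f1 (lognorm y) * (y i 0 / sqdist 0 y).
  move=> y0 Dy; have dl : differentiable lognorm y := smooth_on_diff smooth_lognorm y0.
  by rewrite (pd_comp i dl (df _ Dy)) pd_lognorm.
split; first exact: d1.
have r0 : 0 < sqdist 0 x by rewrite sqdist0_gt0.
have rn0 : sqdist 0 x != 0 by exact: lt0r_neq0.
have dlg : differentiable lognorm x := smooth_on_diff smooth_lognorm x0.
have E : pd i (pd i (fun y => f (lognorm y))) x =
    pd i (fun y => f1 (lognorm y) * (y i 0 * (sqdist 0 y)^-1)) x.
  apply: near_eq_derive.
  have o : nbhs x (punctured `&` lognorm @^-1` D).
    apply: filterI; first by apply: open_nbhs_nbhs; split => //; exact: open_punctured.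
    apply: (differentiable_continuous dlg).
    by apply: open_nbhs_nbhs.
  by apply: filterS o => y [y0 Dy]; exact: d1.
have [df1x pf1x] := derive_comp1 (delta_mx i 0) dlg (df1 _ Dx).
have dsqdist : differentiable (sqdist 0) x := smooth_on_diff smooth_sqdist0 x0.
have [dinv pinv] := @derive_comp1 _ _ (fun t : R => t^-1) (- (sqdist 0 x) ^- 2)
  (sqdist 0) x (delta_mx i 0) dsqdist ltac:(
    by apply: is_derive_eq (is_deriveV rn0 (is_derive_id (sqdist 0 x) (1 : R))) _;
       rewrite /GRing.scale/= mulr1).
have dco := differentiable_coord x i 0.
have dmul : differentiable (fun y : V => y i 0 * (sqdist 0 y)^-1) x.
  exact: (@differentiableM _ _ (fun y : V => y i 0) (fun y => (sqdist 0 y)^-1)).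
rewrite E (@pdM _ _ (fun y => f1 (lognorm y)) (fun y : V => y i 0 * (sqdist 0 y)^-1))//.
rewrite (@pdM _ _ (fun y : V => y i 0) (fun y => (sqdist 0 y)^-1))//.
rewrite [X in _ * (_ * X + _) + _]pinv [X in _ + _ * X]pf1x pd_lognorm// pd_sqdist0 pd_coord eqxx.
move: (f1 _) (f2 _) (x i 0) rn0 => a b t; move: (sqdist 0 x) => d d0.
by rewrite -mulr_natr /=; field.
Qed.

Lemma lap_radial (D : set R) (f f1 f2 : R -> R) x : open D ->
  (forall t, D t -> is_derive t 1 f (f1 t)) ->
  (forall t, D t -> is_derive t 1 f1 (f2 t)) -> punctured x -> D (lognorm x) ->
  lap (fun y => f (lognorm y)) x = (f2 (lognorm x) + (n%:R - 2) * f1 (lognorm x)) / sqdist 0 x.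
Proof.
move=> oD df df1 x0 Dx; have rn0 : sqdist 0 x != 0 by rewrite lt0r_neq0// sqdist0_gt0.
rewrite /lap; under eq_bigr do rewrite (pd_radial _ oD df df1 x0 Dx).2.
rewrite big_split /= -mulr_sumr -mulr_suml sumr_const card_ord.
rewrite (_ : \sum_i x i 0 ^+ 2 = sqdist 0 x); last first.
  by apply: eq_bigr => i _; rewrite mxE subr0.
rewrite -mulr_natr; move: (f1 _) (f2 _) rn0 => a b; move: (sqdist 0 x) => d d0.
by field.
Qed.

Lemma drift_op_radial (D : set R) (f f1 f2 w w1 : R -> R) x : open D ->
  (forall t, D t -> is_derive t 1 f (f1 t)) ->
  (forall t, D t -> is_derive t 1 f1 (f2 t)) ->
  (forall t : R, is_derive t 1 w (w1 t)) -> punctured x -> D (lognorm x) ->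
  drift_op (fun y => w (lognorm y)) (fun y => f (lognorm y)) x =
    (f2 (lognorm x) + (n%:R - 2 + w1 (lognorm x)) * f1 (lognorm x)) / sqdist 0 x.
Proof.
move=> oD df df1 dw x0 Dx; have rn0 : sqdist 0 x != 0 by rewrite lt0r_neq0// sqdist0_gt0.
rewrite /drift_op (lap_radial oD df df1)//.
have pw i : pd i (fun y => w (lognorm y)) x = w1 (lognorm x) * (x i 0 / sqdist 0 x).
  have dl : differentiable lognorm x := smooth_on_diff smooth_lognorm x0.
  by rewrite (pd_comp i dl (dw _)) pd_lognorm.
have -> : \sum_i pd i (fun y => w (lognorm y)) x * pd i (fun y => f (lognorm y)) x =
    w1 (lognorm x) * f1 (lognorm x) / sqdist 0 x.
  transitivity (\sum_i (w1 (lognorm x) * f1 (lognorm x) / sqdist 0 x ^+ 2) * x i 0 ^+ 2).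
    apply: eq_bigr => i _; rewrite pw (pd_radial _ oD df df1 x0 Dx).1.
    move: (f1 _) (w1 _) (x i 0) rn0 => a b t; move: (sqdist 0 x) => d d0.
    by field.
  rewrite -mulr_sumr (_ : \sum_i x i 0 ^+ 2 = sqdist 0 x); last first.
    by apply: eq_bigr => i _; rewrite mxE subr0.
  by move: (f1 _) (w1 _) rn0 => a b; move: (sqdist 0 x) => d d0; field.
by move: (f1 _) (w1 _) (f2 _) rn0 => a b e; move: (sqdist 0 x) => d d0; field.
Qed.

End radial.

(** * The oscillating weight *)

Section profile.
Context {R : realType} {n : nat}.
Local Notation V := 'cV[R]_n.
Implicit Types (x : V) (t : R).
Local Notation pd i f := ('D_(delta_mx i 0) f).
Variables (om mb : R).
Hypotheses (om1 : 1 <= om).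

Let om0 : 0 < om := lt_le_trans ltr01 om1.
Let omn0 : om != 0 := lt0r_neq0 om0.

(** The derivative of [stretch] stays in [[1/2, 3/2]] and [stretch t - t] is bounded,
    while its second derivative has the amplitude [om / 2]. *)
Definition stretch t : R := t + (2 * om)^-1 * sin (om * t).
Definition stretch1 t : R := 1 + 2^-1 * cos (om * t).
Definition stretch2 t : R := - (om / 2) * sin (om * t).

Let is_derive_om t : is_derive t 1 (fun s : R => om * s) om.
Proof.
have h := is_deriveZ om (is_derive_id t (1 : R)).
by apply: is_derive_eq h _; rewrite /GRing.scale/= mulr1.
Qed.

Lemma is_derive_stretch t : is_derive t 1 stretch (stretch1 t).
Proof.
have h1 := @is_derive1_comp R (@sin R) (fun s : R => om * s) t _ _
  (is_derive_sin _) (is_derive_om t).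
have h := is_deriveD (is_derive_id t (1 : R)) (is_deriveZ (2 * om)^-1 h1).
rewrite (_ : stretch = id + ((2 * om)^-1 \*: (@sin R \o (fun s : R => om * s))))//.
by apply: is_derive_eq h _; rewrite /GRing.scale/= /stretch1; field.
Qed.

Lemma is_derive_stretch1 t : is_derive t 1 stretch1 (stretch2 t).
Proof.
have h1 := @is_derive1_comp R (@cos R) (fun s : R => om * s) t _ _
  (is_derive_cos _) (is_derive_om t).
have h := is_deriveD (is_derive_cst (1 : R) t (1 : R)) (is_deriveZ 2^-1 h1).
rewrite (_ : stretch1 = cst 1 + (2^-1 \*: (@cos R \o (fun s : R => om * s))))//.
by apply: is_derive_eq h _; rewrite /GRing.scale/= /stretch2; field.
Qed.

Lemma stretch1_ge t : 2^-1 <= stretch1 t.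
Proof. by rewrite /stretch1; have := cos_geN1 (om * t); lra. Qed.

Lemma stretch1_le t : stretch1 t <= 3 / 2.
Proof. by rewrite /stretch1; have := cos_le1 (om * t); lra. Qed.

Lemma stretch1_gt0 t : 0 < stretch1 t.
Proof. by apply: lt_le_trans (stretch1_ge t); rewrite invr_gt0. Qed.

Lemma stretch_dist t : `|stretch t - t| <= 2^-1.
Proof.
rewrite /stretch addrC addKr normrM.
have h1 : `|(2 * om)^-1| <= 2^-1.
  have p0 : 0 < 2 * om by rewrite mulr_gt0.
  rewrite ger0_norm; last by rewrite invr_ge0 ltW.
  by rewrite lef_pV2 ?posrE// ler_peMr.
have h2 : `|sin (om * t)| <= 1 by rewrite ler_norml sin_geN1 sin_le1.
by rewrite -[leRHS]mulr1; apply: ler_pM.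
Qed.

(** Its slope is determined by [n - 2 + w' = - s'' / s' + mb s'], the first order
    coefficient which turns into the constant [mb] in the variable [s = stretch t]. *)
Definition weight_profile t : R := (2 - n%:R) * t - ln (stretch1 t) + mb * stretch t.
Definition weight_slope t : R := (2 - n%:R) - stretch2 t / stretch1 t + mb * stretch1 t.

Lemma is_derive_weight_profile t : is_derive t 1 weight_profile (weight_slope t).
Proof.
have h1 := @is_derive1_comp R (@ln R) stretch1 t _ _
  (is_derive1_ln (stretch1_gt0 t)) (is_derive_stretch1 t).
have h2 := is_deriveZ (2 - n%:R) (is_derive_id t (1 : R)).
have h3 := is_deriveZ mb (is_derive_stretch t).
have h := is_deriveD (is_deriveB h2 h1) h3.
apply: is_derive_eq h _.
by rewrite /GRing.scale/= mulr1 [_^-1 * _]mulrC.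
Qed.

Definition weight x : R := weight_profile (lognorm x).

Lemma smooth_trig (a : R) : smooth_on punctured (fun x : V => sin (a * lognorm x)) /\
  smooth_on punctured (fun x : V => cos (a * lognorm x)).
Proof.
have oP : open (punctured : set V) := open_punctured.
split; apply: (smooth_on_comp (D := setT)) => //.
- exact: smooth1_sincos.1.
- by apply: smooth_onZ => //; exact: smooth_lognorm.
- exact: smooth1_sincos.2.
- by apply: smooth_onZ => //; exact: smooth_lognorm.
Qed.

Lemma smooth_stretch : smooth_on punctured (fun x : V => stretch (lognorm x)).
Proof.
have oP : open (punctured : set V) := open_punctured.
apply: smooth_onD => //; first exact: smooth_lognorm.
by apply: smooth_onZ => //; have [] := smooth_trig om.
Qed.

Lemma smooth_stretch1 : smooth_on punctured (fun x : V => stretch1 (lognorm x)).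
Proof.
have oP : open (punctured : set V) := open_punctured.
apply: smooth_onD => //; first exact: smooth_on_cst.
by apply: smooth_onZ => //; have [] := smooth_trig om.
Qed.

Lemma smooth_weight : smooth_on punctured weight.
Proof.
have oP : open (punctured : set V) := open_punctured.
apply: smooth_onD => //; last by apply: smooth_onZ => //; exact: smooth_stretch.
apply: smooth_onD => //; first by apply: smooth_onZ => //; exact: smooth_lognorm.
apply: (smooth_on_eq (g := fun x => -1 * ln (stretch1 (lognorm x)))) => //.
  by move=> x _; rewrite mulN1r.
apply: smooth_onZ => //.
apply: (smooth_on_comp (D := [set t | 0 < t])) => //; first exact: smooth1_ln.
- exact: smooth_stretch1.
- by move=> x _; exact: stretch1_gt0.
Qed.

Definition drift x : V := \col_i (weight_slope (lognorm x) * (x i 0 / sqdist 0 x)).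

Lemma pd_weight i x : punctured x -> pd i weight x = drift x i 0.
Proof.
move=> x0; have dl : differentiable lognorm x := smooth_on_diff smooth_lognorm x0.
by rewrite (pd_comp i dl (is_derive_weight_profile _)) pd_lognorm// mxE.
Qed.

(** The first order terms [- s'' / s'] of the weight and [s''] of the chain rule cancel,
    so that in the variable [s = stretch (lognorm x)] the operator is a multiple of
    [F'' + mb F'] and annihilates [exp (- mb s)]. *)
Lemma drift_op_profile (D : set R) (F F1 F2 : R -> R) x : open D ->
  (forall t, D t -> is_derive t 1 F (F1 t)) ->
  (forall t, D t -> is_derive t 1 F1 (F2 t)) -> punctured x -> D (stretch (lognorm x)) ->
  drift_op weight (fun y => F (stretch (lognorm y))) x =
    stretch1 (lognorm x) ^+ 2 / sqdist 0 x *
    (F2 (stretch (lognorm x)) + mb * F1 (stretch (lognorm x))).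
Proof.
move=> oD dF dF1 x0 Dx.
have oS : open (stretch @^-1` D).
  apply: open_comp => // t _; apply: differentiable_continuous.
  by apply/derivable1_diffP; have [] := is_derive_stretch t.
have d1 t : (stretch @^-1` D) t ->
    is_derive t 1 (fun t => F (stretch t)) (F1 (stretch t) * stretch1 t).
  by move=> Dt; exact: (is_derive1_comp (dF _ Dt) (is_derive_stretch t)).
have d2 t : (stretch @^-1` D) t -> is_derive t 1 (fun t => F1 (stretch t) * stretch1 t)
    (F2 (stretch t) * stretch1 t ^+ 2 + F1 (stretch t) * stretch2 t).
  move=> Dt; have h := is_deriveM (is_derive1_comp (dF1 _ Dt) (is_derive_stretch t))
    (is_derive_stretch1 t).
  by apply: is_derive_eq h _; rewrite /GRing.scale/=; ring.
have E := drift_op_radial oS d1 d2 is_derive_weight_profile x0 Dx.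
rewrite E /weight_slope.
have s0 : stretch1 (lognorm x) != 0 by rewrite lt0r_neq0// stretch1_gt0.
have rn0 : sqdist 0 x != 0 by rewrite lt0r_neq0// sqdist0_gt0.
move: (F1 _) (F2 _) (stretch2 _) rn0 => a b e; move: (sqdist 0 x) (stretch1 _) s0 => d s s0 d0.
by field; rewrite d0 s0.
Qed.

Lemma weight_slope_le t : `|weight_slope t| <= 2 + n%:R + om + `|mb| * 2.
Proof.
rewrite /weight_slope (le_trans (ler_normD _ _))// lerD//; last first.
  rewrite normrM ler_wpM2l// (ger0_norm (ltW (stretch1_gt0 t))).
  by apply: le_trans (stretch1_le t) _; lra.
rewrite (le_trans (ler_normB _ _))// lerD//.
  by rewrite (le_trans (ler_normB _ _))// !ger0_norm.
rewrite normrM normfV (ger0_norm (ltW (stretch1_gt0 t))) ler_pdivrMr ?stretch1_gt0//.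
have om20 : 0 <= om / 2 by rewrite divr_ge0// ltW.
rewrite /stretch2 normrM normrN (ger0_norm om20).
have h2 : `|sin (om * t)| <= 1 by rewrite ler_norml sin_geN1 sin_le1.
apply: (@le_trans _ _ (om / 2 * 1)); first by rewrite ler_wpM2l.
by rewrite mulr1 ler_wpM2l ?stretch1_ge// ltW.
Qed.

End profile.

(** * Euclidean balls and annuli *)

Section euclidean_geometry.
Context {R : realType} {n : nat}.
Local Notation V := 'cV[R]_n.
Implicit Types (x : V).

Lemma dotE x : dot x x = sqdist 0 x.
Proof. by apply: eq_bigr => i _; rewrite mxE subr0 expr2. Qed.

Lemma enormE x : enorm x ^+ 2 = sqdist 0 x.
Proof. by rewrite /enorm sqr_sqrtr dotE// sqdist_ge0. Qed.

Lemma enorm_ge0 x : 0 <= enorm x. Proof. exact: sqrtr_ge0. Qed.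

Lemma enorm_gt0 x : (0 < enorm x) = (x != 0).
Proof. by rewrite /enorm sqrtr_gt0 dotE sqdist0_gt0. Qed.

Lemma continuous_enorm : continuous (@enorm R n).
Proof.
move=> x; rewrite (_ : enorm = Num.sqrt \o sqdist 0).
  by apply: continuous_comp; [exact: continuous_sqdist|exact: sqrt_continuous].
by apply/funext => y; rewrite /enorm dotE.
Qed.

Lemma coord_enorm_le x i : `|x i 0| <= enorm x.
Proof.
rewrite -(@ler_pXn2r _ 2)// ?nnegrE ?enorm_ge0// enormE real_normK ?num_real//.
by have := sqdist_ge 0 x i; rewrite mxE subr0.
Qed.

Lemma open_eball r : open (@eball R n r).
Proof.
rewrite (_ : eball r = @enorm R n @^-1` [set t | t < r])//.
by apply: open_comp; [move=> x _; exact: continuous_enorm|exact: open_lt].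
Qed.

Lemma pballE r x : pball r x <-> enorm x < r /\ punctured x.
Proof. by split=> [[h /eqP]|[h /eqP]]; split. Qed.

Lemma open_annulus e r : open (@annulus R n e r).
Proof.
rewrite (_ : annulus e r = @enorm R n @^-1` `]e, r[%classic); last first.
  by apply/seteqP; split=> x; rewrite /annulus /= in_itv.
apply: open_comp; [move=> x _; exact: continuous_enorm|exact: interval_open].
Qed.

Lemma annulus_punctured e r : 0 <= e -> @annulus R n e r `<=` punctured.
Proof. by move=> e0 x /andP[ex _]; rewrite /punctured /= -enorm_gt0 (le_lt_trans e0). Qed.

Lemma enorm_ball_cube r : @eball R n r `<=` cube 0 r.
Proof.
by move=> x xr i; rewrite mxE subr0; exact: le_lt_trans (coord_enorm_le x i) xr.
Qed.

Definition shell e r : set V := [set x | e <= enorm x <= r].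

Lemma compact_shell e r : compact (shell e r).
Proof.
apply: (@subclosed_compact _ _ [set x : V | forall i, `|x i 0| <= r]).
- rewrite (_ : shell e r = @enorm R n @^-1` `[e, r]%classic); last first.
    by apply/seteqP; split=> x; rewrite /shell /= in_itv.
  apply: closed_comp; [move=> x _; exact: continuous_enorm|exact: interval_closed].
- exact: compact_ccube.
- by move=> x /andP[_ xr] i; exact: le_trans (coord_enorm_le x i) xr.
Qed.

Lemma annulus_shell e r : @annulus R n e r `<=` shell e r.
Proof. by move=> x /andP[/ltW h1 /ltW h2]; apply/andP. Qed.

Lemma shell_punctured e r : 0 < e -> shell e r `<=` punctured.
Proof. by move=> e0 x /andP[ex _]; rewrite /punctured /= -enorm_gt0 (lt_le_trans e0). Qed.

Lemma expR_lognorm x : punctured x -> expR (2 * lognorm x) = sqdist 0 x.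
Proof.
by move=> x0; rewrite /lognorm mulrA divff ?pnatr_eq0// mul1r lnK// posrE sqdist0_gt0.
Qed.

Lemma expR_lognorm_enorm x : punctured x -> expR (lognorm x) = enorm x.
Proof.
move=> x0; apply/eqP; rewrite -(@eqrXn2 _ 2)// ?expR_ge0 ?enorm_ge0//.
by rewrite enormE -expR_lognorm// -expRM_natl.
Qed.

(** The annulus is contained in a compact subset of the punctured space, on which the
    derivatives of [f] are bounded. *)
Lemma smooth_sobolev k p e r (f : V -> R) : 0 < e -> 0 < p ->
  smooth_on punctured f ->
  sobolev_with k p (annulus e r) f (fun s => pderiv (rev s) f).
Proof.
move=> e0 p0 sf s _.
have oA := @open_annulus e r; have mA := open_measurable_cV oA.
have sA := @annulus_punctured e r (ltW e0).
have sfs := smooth_on_pderiv (rev s) sf.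
split; first exact: (smooth_weak_derivative _ open_punctured).
have mf : measurable_fun (annulus e r) (pderiv (rev s) f).
  apply: measurable_fun_continuous_open => // x /sA; exact: smooth_on_continuous.
split => //.
have [B B0 hB] : exists2 B, 0 < B &
    forall x, shell e r x -> `|pderiv (rev s) f x| <= B.
  apply: (@continuous_compact_bound _ _ punctured).
  - by move=> x; exact: smooth_on_continuous.
  - exact: compact_shell.
  - exact: shell_punctured.
apply: (@le_lt_trans _ _ (\int[leb n]_(x in annulus e r) (B `^ p)%:E)%E).
  have m1 : measurable_fun (annulus e r) (fun x => `|pderiv (rev s) f x|).
    exact: measurableT_comp.
  have m2 : measurable_fun (annulus e r) (fun x => (`|pderiv (rev s) f x| `^ p)%:E).
    by apply/measurable_EFinP; exact: (measurableT_comp (measurable_powR p) m1).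
  apply: ge0_le_integral => // x Ax; rewrite ?lee_fin ?powR_ge0//.
  by rewrite ge0_ler_powR ?nnegrE ?(ltW p0) ?(ltW B0)//; apply: hB; exact: annulus_shell.
rewrite integral_cst// lte_mul_pinfty ?lee_fin ?powR_ge0//.
have [M M0 hM] := compact_sub_cube (@compact_shell e r).
exact: (@leb_sub_cube_fin _ _ 0 M _ mA (fun x h => hM _ (annulus_shell h)) (ltW M0)).
Qed.

End euclidean_geometry.

(** * Singular solutions below the critical exponent *)

Section existence.
Context {R : realType} {n : nat}.
Local Notation V := 'cV[R]_n.
Implicit Types (x : V).
Local Notation pd i f := ('D_(delta_mx i 0) f).
Variables (om mb : R).
Hypotheses (om1 : 1 <= om) (n0 : (0 < n)%N).

Definition lap_coef : V -> 'M[R]_n := fun=> 1%:M.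

Lemma Lop_lapE (b : V -> V) (du : seq 'I_n -> V -> R) x :
  Lop lap_coef b du x = \sum_i du [:: i; i] x + \sum_i b x i 0 * du [:: i] x.
Proof.
rewrite /Lop; congr (_ + _); apply: eq_bigr => i _.
rewrite (bigD1 i)//= mxE eqxx mul1r big1 ?addr0// => j ji.
by rewrite mxE eq_sym (negbTE ji) mul0r.
Qed.

Lemma Lop_drift (du : seq 'I_n -> V -> R) x : punctured x ->
  Lop lap_coef (drift om mb) du x =
  \sum_i du [:: i; i] x + \sum_i pd i (weight om mb) x * du [:: i] x.
Proof.
move=> x0; rewrite Lop_lapE; congr (_ + _).
by apply: eq_bigr => i _; rewrite pd_weight.
Qed.

Lemma limf_esup_dnbhs_pinfty (u : V -> R) :
  (forall M, exists2 d, 0 < d & forall t, 0 < t -> t < d ->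
     exists2 x, sqdist 0 x = t ^+ 2 & M <= u x) ->
  limf_esup (EFin \o u) (0 : V)^' = +oo%E.
Proof.
move=> H; rewrite limf_esupE; apply/eqP; rewrite -leye_eq.
apply: le_ereal_inf_tmp => _ [A A0 <-]; rewrite leye_eq; apply/eqP.
apply/eqyP => M _; have [d d0 hd] := H M.
move: A0 => /nbhs_cubeP[e e0 he].
pose t := Num.min d e / 2.
have de0 : 0 < Num.min d e by rewrite lt_min d0 e0.
have t0 : 0 < t by rewrite divr_gt0.
have tde : t < Num.min d e by rewrite /t ltr_pdivrMr// mulr_natr mulr2n ltrDl.
have [td te] : t < d /\ t < e by move: tde; rewrite lt_min => /andP.
have [x xt ux] := hd _ t0 td.
apply: (@le_trans _ _ (u x)%:E); first by rewrite lee_fin.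
apply: ereal_sup_ubound; exists x => //; apply: he.
- apply: enorm_ball_cube; rewrite /eball /=.
  rewrite -(@ltr_pXn2r _ 2)// ?nnegrE ?enorm_ge0 ?(ltW e0)// enormE xt.
  by rewrite ltr_pXn2r ?nnegrE ?ltW.
- by rewrite -sqdist0_gt0 xt exprn_gt0.
Qed.

Definition power_solution (al : R) x : R := expR (- al * stretch om (lognorm x)).

Lemma smooth_power_solution al : smooth_on punctured (power_solution al).
Proof.
apply: (smooth_on_comp (D := setT) (k := expR)) => //.
- exact: open_punctured.
- exact: smooth1_expR.
- by apply: smooth_onZ; [exact: open_punctured|exact: smooth_stretch].
Qed.

Lemma drift_op_power_solution al x : punctured x ->
  drift_op (weight om mb) (power_solution al) x =
  stretch1 om (lognorm x) ^+ 2 / sqdist 0 x * (al * (al - mb)) * power_solution al x.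
Proof.
move=> x0.
have dZ (t : R) : is_derive t 1 (fun s : R => - al * s) (- al).
  have h := is_deriveZ (- al) (is_derive_id t (1 : R)).
  by apply: is_derive_eq h _; rewrite /GRing.scale/= mulr1.
have dF (a t : R) : is_derive t 1 (fun s : R => a * expR (- al * s)) (a * (- al) * expR (- al * t)).
  have h := is_deriveZ a (@is_derive1_comp R (@expR R) (fun s : R => - al * s) t _ _
    (is_derive_expR _) (dZ t)).
  by apply: is_derive_eq h _; rewrite /GRing.scale/=; ring.
have d1 (t : R) : setT t -> is_derive t 1 (fun s : R => expR (- al * s)) (- al * expR (- al * t)).
  move=> _; have h := dF 1 t; rewrite mul1r in h.
  by rewrite (_ : (fun s : R => expR (- al * s)) = fun s => 1 * expR (- al * s))//;
    apply/funext => s; rewrite mul1r.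
have d2 (t : R) : setT t -> is_derive t 1 (fun s : R => - al * expR (- al * s))
    (- al * - al * expR (- al * t)).
  by move=> _; exact: dF.
have := drift_op_profile (n := n) mb om1 openT d1 d2 x0 I.
rewrite /power_solution => ->; ring.
Qed.

Lemma sqdist0_stretch x : punctured x -> sqdist 0 x <= expR (2 * stretch om (lognorm x) + 1).
Proof.
move=> x0; rewrite -expR_lognorm// ler_expR.
have := stretch_dist om1 (lognorm x); rewrite ler_norml => /andP[]; lra.
Qed.

Lemma lognorm_lt (L : R) x : punctured x -> enorm x < expR L -> lognorm x < L.
Proof. by move=> x0; rewrite -expR_lognorm_enorm// ltr_expR. Qed.

(** For [mb < al < 2 / (p - 1)], the function [exp (- al s)], [s = stretch (lognorm x)], is a
    subsolution near the origin: the operator multiplies it by a positive multiple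
    of [1 / |x|^2], which is comparable to [exp (- 2 s)] and dominates the power
    [p - 1] of the function. *)
Lemma singular_solution_exists (r : R) K (p al Km : R) : 0 < r ->
  0 <= mb -> mb < al -> al * (p - 1) < 2 -> 0 < Km ->
  {ae leb n, forall x, eball r x -> K x <= Km} ->
  singular_solution r lap_coef (drift om mb) K p (power_solution al).
Proof.
move=> r0 mb0 mbal alp Km0 aeK.
have al0 : 0 < al by exact: le_lt_trans mbal.
pose u := power_solution al.
have su : smooth_on punctured u := smooth_power_solution al.
pose ga := 2 - al * (p - 1).
have ga0 : 0 < ga by rewrite subr_gt0.
pose c0 := 4^-1 * (al * (al - mb)) * expR (- 1).
have c00 : 0 < c0 by rewrite !mulr_gt0 ?invr_gt0 ?subr_gt0 ?expR_gt0.
(* [c0] bounds the coefficient of [exp (- 2 s)] from below and [ga] is the surplus of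
   decay; since [s - t <= 1/2], having [t < L] gives [Km <= c0 * exp (- ga s)] *)
pose L := - 2^-1 - ln (Km / c0) / ga.
have Kc0 : 0 < Km / c0 by rewrite divr_gt0.
split; last first.
  apply: limf_esup_dnbhs_pinfty => M.
  exists (expR (- 2^-1 - ln (Num.max M 1) / al)); first exact: expR_gt0.
  move=> t t0 tL; pose i : 'I_n := Ordinal n0.
  have xE : sqdist 0 (t *: delta_mx i 0 : V) = t ^+ 2.
    rewrite /sqdist (bigD1 i)//= big1 => [|j ji].
      by rewrite addr0 !mxE !eqxx mulr1 subr0.
    by rewrite !mxE (negbTE ji) /= mulr0 subr0 expr2 mulr0.
  exists (t *: delta_mx i 0) => //; rewrite /power_solution.
  set x := t *: _ in xE *.
  have x0 : punctured x by rewrite /punctured /= -sqdist0_gt0 xE exprn_gt0.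
  have lL : lognorm x < - 2^-1 - ln (Num.max M 1) / al.
    apply: lognorm_lt => //; apply: le_lt_trans tL.
    by rewrite -(@ler_pXn2r _ 2) ?nnegrE ?enorm_ge0 ?(ltW t0)// enormE xE.
  have M1 : 0 < Num.max M 1 by rewrite lt_max ltr01 orbT.
  apply: (@le_trans _ _ (Num.max M 1)); first by rewrite le_max lexx.
  rewrite -[leLHS]lnK ?posrE// ler_expR.
  have := stretch_dist om1 (lognorm x); rewrite ler_norml => /andP[_ h].
  have h2 : stretch om (lognorm x) <= - (ln (Num.max M 1) / al) by lra.
  by rewrite mulNr lerNr -ler_pdivlMl// mulrN mulrC.
exists (Num.min r (expR L)).
  by rewrite lt_min r0 expR_gt0/= ge_min lexx.
exists (fun s => pderiv (rev s) u); split.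
- by move=> x _; exact: expR_gt0.
- by move=> x /pballE[_ x0]; exact: smooth_on_continuous su x0.
- by move=> e /andP[e0 _]; apply: smooth_sobolev; rewrite ?ltr0n.
apply: filterS aeK => x hK /pballE[]; rewrite lt_min => /andP[xr xL] x0.
have {hK} Kx := hK xr.
have lL := lognorm_lt x0 xL.
rewrite Lop_drift//.
have -> : \sum_i pderiv (rev [:: i; i]) u x + \sum_i pd i (weight om mb) x *
    pderiv (rev [:: i]) u x = drift_op (weight om mb) u x by [].
rewrite drift_op_power_solution// /u /power_solution.
set s := stretch om (lognorm x).
have sL : s <= - (ln (Km / c0) / ga).
  have := stretch_dist om1 (lognorm x); rewrite ler_norml => /andP[_ h].
  by rewrite /s; move: lL h; rewrite /L; lra.
apply: (@le_trans _ _ (Km * expR (- al * s) `^ p)).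
  by rewrite ler_wpM2r// powR_ge0.
rewrite -expRM.
apply: (@le_trans _ _ (4^-1 / expR (2 * s + 1) * (al * (al - mb)) * expR (- al * s))).
  have -> : 4^-1 / expR (2 * s + 1) * (al * (al - mb)) * expR (- al * s) =
      c0 * expR (- s * ga) * expR (- al * s * p).
    have E : expR (- (2 * s + 1)) * expR (- al * s) =
        expR (- 1) * expR (- s * ga) * expR (- al * s * p).
      by rewrite -!expRD; congr expR; rewrite /ga; ring.
    rewrite /c0 -expRN.
    transitivity (4^-1 * (al * (al - mb)) * (expR (- (2 * s + 1)) * expR (- al * s))).
      by ring.
    by rewrite E; ring.
  rewrite ler_wpM2r ?expR_ge0// mulrC -ler_pdivrMr//.
  rewrite -[leLHS]lnK ?posrE// ler_expR mulNr lerNr -ler_pdivlMr//.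
  by rewrite mulNr.
rewrite ler_wpM2r ?expR_ge0// ler_wpM2r ?mulr_ge0 ?subr_ge0 ?(ltW al0) ?(ltW mbal)//.
have d0 : 0 < sqdist 0 x by rewrite sqdist0_gt0.
apply: ler_pM; rewrite ?invr_ge0 ?expR_ge0//.
  rewrite (_ : 4^-1 = 2^-1 ^+ 2); last by rewrite exprVn -natrX.
  by rewrite lerXn2r ?nnegrE ?stretch1_ge ?invr_ge0// ltW// stretch1_gt0.
by rewrite lef_pV2 ?posrE ?expR_gt0// sqdist0_stretch.
Qed.

End existence.

(** * Barriers *)

Section barrier.
Context {R : realType}.
Variables (D T : R) (m : nat).
Hypotheses (D0 : 0 < D) (T0 : 0 < T).
Implicit Types (s t : R).

Definition blow t : R := (1 - t / T)^-1.

(** Under the substitution [t = tau x], [barrier] vanishes linearly far from the origin and is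
    infinite where [tau x] reaches [T], that is, near the origin. *)
Definition barrier t : R := D * t * blow t ^+ m.
Definition barrier1 t : R := D * (blow t ^+ m + t * (m%:R * blow t ^+ m.+1 / T)).
Definition barrier2 t : R :=
  D * (2 * (m%:R * blow t ^+ m.+1 / T) + t * (m%:R * (m.+1%:R * blow t ^+ m.+2) / T ^+ 2)).

Let Tn0 : T != 0 := lt0r_neq0 T0.

Lemma blow_arg_gt0 t : t < T -> 0 < 1 - t / T.
Proof. by move=> tT; rewrite subr_gt0 ltr_pdivrMr// mul1r. Qed.

Lemma blow_gt0 t : t < T -> 0 < blow t.
Proof. by move=> tT; rewrite invr_gt0 blow_arg_gt0. Qed.

Lemma blow_ge1 t : 0 <= t -> t < T -> 1 <= blow t.
Proof.
move=> t0 tT; rewrite /blow invf_ge1 ?blow_arg_gt0//.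
by rewrite gerBl divr_ge0// ltW.
Qed.

Lemma is_derive_blow k t : t < T ->
  is_derive t 1 (fun s => blow s ^+ k) (k%:R * blow t ^+ k.+1 / T).
Proof.
move=> tT; have a0 : 1 - t / T != 0 := lt0r_neq0 (blow_arg_gt0 tT).
have hg : is_derive t 1 (fun s : R => 1 - s / T) (- T^-1).
  have h := is_deriveB (is_derive_cst (1 : R) t (1 : R))
    (is_deriveZ T^-1 (is_derive_id t (1 : R))).
  rewrite (_ : (fun s : R => 1 - s / T) = cst 1 - (T^-1 \*: id)); last first.
    by apply/funext => s; rewrite mulrC.
  by apply: is_derive_eq h _; rewrite /GRing.scale/= mulr1 sub0r.
have h := @is_derive1_comp R (fun s : R => s^-1 ^+ k) (fun s : R => 1 - s / T) t _ _
  (is_derive_invX k a0) hg.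
by apply: is_derive_eq h _; rewrite /blow; ring.
Qed.

Lemma is_derive_barrier t : t < T -> is_derive t 1 barrier (barrier1 t).
Proof.
move=> tT; have h := is_deriveM (is_deriveZ D (is_derive_id t (1 : R)))
  (is_derive_blow m tT).
apply: is_derive_eq h _; rewrite /barrier1 /= /GRing.scale/=.
by move: (blow t ^+ m) (blow t ^+ m.+1) => a b; ring.
Qed.

Lemma is_derive_barrier1 t : t < T -> is_derive t 1 barrier1 (barrier2 t).
Proof.
move=> tT.
have h1 := is_deriveM (is_derive_id t (1 : R))
  (is_deriveZ (m%:R / T) (is_derive_blow m.+1 tT)).
have h := is_deriveZ D (is_deriveD (is_derive_blow m tT) h1).
rewrite (_ : barrier1 = D \*: ((fun s => blow s ^+ m) +
    (id * ((m%:R / T) \*: (fun s => blow s ^+ m.+1))))); last first.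
  apply/funext => s.
  transitivity (D * (blow s ^+ m + s * ((m%:R / T) * blow s ^+ m.+1))) => //.
  rewrite /barrier1; move: (blow s ^+ m) (blow s ^+ m.+1) => a b; ring.
apply: is_derive_eq h _; rewrite /barrier2 /= /GRing.scale/=.
move: (blow t ^+ m.+1) (blow t ^+ m.+2) (m.+1%:R : R) (m%:R : R) => a b c d.
by rewrite ?fctE; field.
Qed.

Lemma barrier_gt0 t : 0 < t -> t < T -> 0 < barrier t.
Proof. by move=> t0 tT; rewrite /barrier !mulr_gt0// exprn_gt0// blow_gt0. Qed.

(** The barrier is a supersolution of the Keller-Osserman type inequality
    [C t ^ (q + 1) Q'' <= k Q ^ p] when [q < p <= q + 1] and [T] is large: the
    exponent [m] makes the powers of [blow] match, and the condition [p <= q + 1]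
    allows to replace [t ^ (q + 1 - p)] by its value at [T]. *)
Lemma barrier_supersolution (C k p q : R) : 0 < C -> 0 < k -> 1 < p -> q < p ->
  p <= q + 1 -> 2 <= m%:R * (p - 1) ->
  C * (2 * m%:R + m%:R * m.+1%:R) <= k * D `^ (p - 1) * T `^ (p - q) ->
  forall t, 0 < t -> t < T -> C * t `^ (q + 1) * barrier2 t <= k * barrier t `^ p.
Proof.
move=> C0 k0 p1 qp pq mp CT t t0 tT.
have z1 := blow_ge1 (ltW t0) tT; have z0 := blow_gt0 tT.
pose Cm : R := 2 * m%:R + m%:R * m.+1%:R.
have b2 : barrier2 t <= D / T * Cm * blow t ^+ m.+2.
  have zz : blow t ^+ m.+1 <= blow t ^+ m.+2 by rewrite ler_weXn2l.
  have tT1 : t / T <= 1 by rewrite ler_pdivrMr// mul1r ltW.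
  rewrite (_ : barrier2 t = D / T * (2 * m%:R * blow t ^+ m.+1 +
     (t / T) * (m%:R * m.+1%:R * blow t ^+ m.+2))); last first.
    rewrite /barrier2.
    by move: (blow t ^+ m.+1) (blow t ^+ m.+2) (m.+1%:R : R) (m%:R : R) => a b c d; field.
  rewrite -[leRHS]mulrA ler_pM2l ?divr_gt0// /Cm [leRHS]mulrDl lerD//.
    by rewrite ler_wpM2l// mulr_ge0.
  by apply: ler_piMl => //; apply: mulr_ge0; [exact: mulr_ge0|rewrite exprn_ge0// ltW].
have tq : t `^ (q + 1) = t `^ (q + 1 - p) * t `^ p.
  rewrite -powRD ?subrK//; apply/implyP => _; exact: lt0r_neq0.
have Dp0 := ltW D0. have tp0 := ltW t0. have Tp0 := ltW T0. have zp0 := ltW z0.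
have tle : t `^ (q + 1 - p) <= T `^ (q + 1 - p).
  by rewrite ge0_ler_powR ?subr_ge0 ?nnegrE// ltW.
have TT : T `^ (q + 1 - p) * T `^ (p - q) = T.
  rewrite -powRD; last by apply/implyP => _; exact: lt0r_neq0.
  by rewrite (_ : _ + _ = 1) ?powRr1 ?ltW//; ring.
have DD : D `^ p = D `^ (p - 1) * D.
  by rewrite mulrC mulr_powRB1// (lt_trans ltr01).
have QE : barrier t `^ p = D `^ p * t `^ p * blow t `^ (m%:R * p).
  have zm0 : 0 <= blow t ^+ m by rewrite exprn_ge0.
  rewrite /barrier powRM//; last exact: mulr_ge0.
  by rewrite powRM// -powR_mulrn// powRrM.
have zle : blow t ^+ m.+2 <= blow t `^ (m%:R * p).
  rewrite -powR_mulrn// ler_powR//.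
  by move: mp; rewrite mulrBr mulr1 lerBrDr -(natrD _ 2 m).
rewrite QE.
apply: (@le_trans _ _ (C * t `^ (q + 1) * (D / T * Cm * blow t ^+ m.+2))).
  by rewrite ler_wpM2l// mulr_ge0 ?powR_ge0// ltW.
rewrite (_ : C * t `^ (q + 1) * (D / T * Cm * blow t ^+ m.+2) =
   (C * Cm * t `^ (q + 1 - p) / T) * (D * t `^ p) * blow t ^+ m.+2); last first.
  by rewrite tq; ring.
rewrite (_ : k * (_ * _ * _) = (k * D `^ (p - 1)) * (D * t `^ p) * blow t `^ (m%:R * p));
  last by rewrite DD; ring.
have Cm0 : 0 <= Cm by rewrite addr_ge0// mulr_ge0.
apply: ler_pM => //.
- by rewrite !mulr_ge0 ?powR_ge0 ?invr_ge0// ltW.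
- by rewrite exprn_ge0.
rewrite ler_wpM2r ?mulr_ge0 ?powR_ge0 ?(ltW D0)//.
rewrite ler_pdivrMr//.
apply: (@le_trans _ _ (C * Cm * T `^ (q + 1 - p))).
  by rewrite ler_wpM2l// mulr_ge0// ltW.
by rewrite -[X in _ <= _ * X]TT [leRHS]mulrCA [leLHS]mulrC ler_wpM2l ?powR_ge0.
Qed.

End barrier.

Section nonexistence.
Context {R : realType} {n : nat}.
Local Notation V := 'cV[R]_n.
Implicit Types (x : V).
Variables (om mb : R).
Hypotheses (om1 : 1 <= om) (mb0 : 0 < mb).

(* this solution of the homogeneous equation serves as a coordinate *)
Local Notation tau := (@power_solution R n om mb).

Lemma tau_gt0 x : 0 < tau x. Proof. exact: expR_gt0. Qed.

Lemma smooth_tau : smooth_on punctured tau.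
Proof. exact: smooth_power_solution. Qed.

Lemma inv_sqdist0_tau x : punctured x ->
  (sqdist 0 x)^-1 <= expR 1 * tau x `^ (2 / mb).
Proof.
move=> x0; have d0 : 0 < sqdist 0 x by rewrite sqdist0_gt0.
rewrite -expR_lognorm// -expRN /power_solution -expRM -expRD ler_expR.
rewrite (_ : - mb * _ * _ = - 2 * stretch om (lognorm x)); last by field; exact: lt0r_neq0.
have := stretch_dist om1 (lognorm x); rewrite ler_norml => /andP[_]; lra.
Qed.

Section barrier_in_space.
Variables (D T A : R) (m : nat).
Hypotheses (D0 : 0 < D) (T0 : 0 < T).

Definition sublevel : set V := [set x | punctured x /\ tau x < T].

Lemma open_sublevel : open sublevel.
Proof.
rewrite openE => x [x0 xT]; apply: filterI.
  by apply: open_nbhs_nbhs; split => //; exact: open_punctured.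
exact: (cvgr_lt _ (smooth_on_continuous smooth_tau x0)).
Qed.

Lemma sublevel_punctured : sublevel `<=` punctured. Proof. by move=> x []. Qed.

Lemma smooth_barrier : smooth_on sublevel (fun x => A + barrier D T m (tau x)).
Proof.
have oS := open_sublevel.
have st : smooth_on sublevel tau := smooth_on_subset sublevel_punctured smooth_tau.
apply: smooth_onD => //; first exact: smooth_on_cst.
apply: smooth_onM => //; first exact: smooth_onZ.
apply: (smooth_on_comp (D := [set t | t != 0]) (k := fun t : R => t^-1 ^+ m)) => //.
- exists (@inv_powers R); first exact: inv_powers_closed.
  by exists 1, m; apply/funext => t; rewrite mul1r.
- apply: (smooth_on_eq (g := fun x => 1 + (- T^-1) * tau x)) => //.
    by move=> x _; rewrite mulNr mulrC.
  by apply: smooth_onD => //; [exact: smooth_on_cst|exact: smooth_onZ].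
- by move=> x [_ xT]; exact: lt0r_neq0 (blow_arg_gt0 T0 xT).
Qed.

(** Constants and [tau] are annihilated by the operator, so that only the second
    derivative with respect to [tau] remains. *)
Lemma drift_op_barrier x : sublevel x ->
  drift_op (weight om mb) (fun x => A + barrier D T m (tau x)) x =
  stretch1 om (lognorm x) ^+ 2 / sqdist 0 x * (mb ^+ 2 * tau x ^+ 2 * barrier2 D T m (tau x)).
Proof.
move=> [x0 xT].
pose e (s : R) := expR (- mb * s).
pose Dom : set R := [set s | e s < T].
have de (s : R) : is_derive s 1 e (- mb * e s).
  have dZ : is_derive s 1 (fun s : R => - mb * s) (- mb).
    have h := is_deriveZ (- mb) (is_derive_id s (1 : R)).
    by apply: is_derive_eq h _; rewrite /GRing.scale/= mulr1.
  have h := @is_derive1_comp R (@expR R) (fun s : R => - mb * s) s _ _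
    (is_derive_expR _) dZ.
  by apply: is_derive_eq h _; rewrite mulrC.
have oDom : open Dom.
  apply: (@open_comp _ _ e [set t | t < T]); last exact: open_lt.
  move=> s _; apply: differentiable_continuous; apply/derivable1_diffP.
  by have [] := de s.
have d1 s : Dom s -> is_derive s 1 (fun s => A + barrier D T m (e s))
    (barrier1 D T m (e s) * (- mb * e s)).
  move=> Ds; have h1 := is_derive1_comp (is_derive_barrier D m T0 Ds) (de s).
  have h := is_deriveD (is_derive_cst (A : R) s (1 : R)) h1.
  by apply: is_derive_eq h _; rewrite add0r.
have d2 s : Dom s -> is_derive s 1 (fun s => barrier1 D T m (e s) * (- mb * e s))
    (barrier2 D T m (e s) * (mb ^+ 2 * e s ^+ 2) + barrier1 D T m (e s) * (mb ^+ 2 * e s)).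
  move=> Ds; have h1 := is_derive1_comp (is_derive_barrier1 D m T0 Ds) (de s).
  have h := is_deriveM h1 (is_deriveZ (- mb) (de s)).
  apply: is_derive_eq h _; rewrite /= /GRing.scale/=.
  by move: (barrier1 D T m (e s)) (barrier2 D T m (e s)) => a b; ring.
have E : tau x = e (stretch om (lognorm x)) by [].
rewrite E; apply: etrans (drift_op_profile (n := n) mb om1 oDom d1 d2 x0 xT) _.
congr (_ * _); set c := e _.
by move: (barrier1 D T m c) (barrier2 D T m c) => a b; ring.
Qed.

Lemma drift_op_barrier_le x (q : R) : sublevel x -> q = 1 + 2 / mb ->
  drift_op (weight om mb) (fun x => A + barrier D T m (tau x)) x <=
  (9 / 4 * expR 1 * mb ^+ 2) * tau x `^ (q + 1) * barrier2 D T m (tau x).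
Proof.
move=> xT qE; rewrite drift_op_barrier//; have [x0 tT] := xT.
have t0 := tau_gt0 x.
have z0 := blow_gt0 T0 tT.
have zk k : 0 <= blow T (tau x) ^+ k by rewrite exprn_ge0// ltW.
have b20 : 0 <= barrier2 D T m (tau x).
  rewrite /barrier2; apply: mulr_ge0; first exact: ltW.
  apply: addr_ge0; apply: mulr_ge0; rewrite ?(ltW t0)//.
    by apply: divr_ge0; [exact: mulr_ge0|exact: ltW].
  by apply: divr_ge0; [do 2 apply: mulr_ge0 => //|exact: sqr_ge0].
have tq : tau x `^ (q + 1) = tau x `^ (2 / mb) * tau x ^+ 2.
  rewrite -powR_mulrn ?ltW// -powRD; last by apply/implyP => _; exact: lt0r_neq0.
  by congr (_ `^ _); rewrite qE; ring.
have d0 : 0 < sqdist 0 x by rewrite sqdist0_gt0.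
have s1 : stretch1 om (lognorm x) ^+ 2 <= 9 / 4.
  rewrite (_ : 9 / 4 = (3 / 2) ^+ 2); last by field.
  by rewrite lerXn2r ?nnegrE ?stretch1_le// ?divr_ge0// ltW// stretch1_gt0.
have h : stretch1 om (lognorm x) ^+ 2 / sqdist 0 x <= 9 / 4 * (expR 1 * tau x `^ (2 / mb)).
  apply: ler_pM => //; rewrite ?sqr_ge0 ?invr_ge0 ?(ltW d0)//.
  exact: inv_sqdist0_tau.
have -> : 9 / 4 * expR 1 * mb ^+ 2 * tau x `^ (q + 1) * barrier2 D T m (tau x) =
    9 / 4 * (expR 1 * tau x `^ (2 / mb)) * (mb ^+ 2 * tau x ^+ 2 * barrier2 D T m (tau x)).
  by rewrite tq; ring.
apply: ler_wpM2r => //; apply: mulr_ge0 => //.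
by apply: mulr_ge0; exact: sqr_ge0.
Qed.

End barrier_in_space.

Lemma tau_large (T : R) : 0 < T -> exists2 e, 0 < e &
  forall x, punctured x -> enorm x <= e -> T < tau x.
Proof.
move=> T0; pose L := - 1 - ln T / mb.
exists (expR L); first exact: expR_gt0.
move=> x x0; rewrite -expR_lognorm_enorm// ler_expR => xL.
rewrite -[X in X < _]lnK ?posrE// /power_solution ltr_expR mulNr ltrNr.
rewrite -ltr_pdivlMl//; have := stretch_dist om1 (lognorm x); rewrite ler_norml => /andP[_ h].
rewrite mulrN; move: xL; rewrite /L [mb^-1 * _]mulrC; lra.
Qed.

Lemma powR_continuous (p a : R) : 0 < a -> {for a, continuous (fun t : R => t `^ p)}.
Proof.
move=> a0; apply: differentiable_continuous; apply/derivable1_diffP.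
by have [] := is_derive1_powR p a0.
Qed.

End nonexistence.

(** * Comparison above the critical exponent *)

Section comparison.
Context {R : realType} {n : nat}.
Local Notation V := 'cV[R]_n.
Implicit Types (x : V).
Local Notation pd i f := ('D_(delta_mx i 0) f).
Variables (om mb : R).
Hypotheses (om1 : 1 <= om) (mb0 : 0 < mb).
Local Notation tau := (@power_solution R n om mb).

(** The barrier, raised to touch [u], would be a subsolution at [x0] by [weak_touch];
    but it is a strict supersolution there, as [u x0] exceeds the barrier itself. *)
Lemma barrier_touch (r r' k0 p q D T A M : R) m K u du x0 :
  q = 1 + 2 / mb -> q < p -> p <= q + 1 -> 0 < k0 -> 0 < D -> 0 < T ->
  0 <= A -> 0 < M -> 2 <= m%:R * (p - 1) ->
  9 / 4 * expR 1 * mb ^+ 2 * (2 * m%:R + m%:R * m.+1%:R) <=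
    k0 * D `^ (p - 1) * T `^ (p - q) ->
  r' <= r -> {ae leb n, forall x, eball r x -> k0 <= K x} ->
  (forall x, pball r' x -> {for x, continuous u}) ->
  (forall e : R, 0 < e < r' -> sobolev_with 2 n%:R (annulus e r') u du) ->
  {ae leb n, forall x, pball r' x ->
    K x * u x `^ p <= Lop lap_coef (drift om mb) du x} ->
  pball r' x0 -> tau x0 < T ->
  (\forall x \near x0, u x <= M + A + barrier D T m (tau x)) ->
  u x0 = M + A + barrier D T m (tau x0) -> False.
Proof.
move=> qE qp pq k00 D0 T0 A0 M0 mp CT rr aeK cu su aeu px0 xT nu ux0.
have [x0r x00] : enorm x0 < r' /\ punctured x0 by apply/pballE.
have e0 : 0 < enorm x0 by rewrite enorm_gt0.
have p1 : 1 < p by apply: lt_trans qp; rewrite qE ltrDl divr_gt0.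
pose e := enorm x0 / 2.
have ee : 0 < e < r'.
  apply/andP; split; first by rewrite divr_gt0.
  by apply: lt_trans x0r; rewrite /e ltr_pdivrMr// mulr_natr mulr2n ltrDl.
have oA := @open_annulus R n e r'.
have De : annulus e r' x0.
  by apply/andP; split => //; rewrite /e ltr_pdivrMr// mulr_natr mulr2n ltrDl.
have e_ge0 : 0 <= e by case/andP: ee => /ltW.
have AP : annulus e r' `<=` @punctured R n := annulus_punctured e_ge0.
have Apb x : annulus e r' x -> pball r' x.
  by move=> Ax; apply/pballE; split; [case/andP: Ax|exact: AP].
have Q0 : 0 < barrier D T m (tau x0) by apply: barrier_gt0 => //; exact: tau_gt0.
have ux00 : 0 < u x0 by rewrite ux0 addr_gt0// ltr_wpDr.
pose g x := k0 * u x `^ p.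
have cg : {for x0, continuous g}.
  apply: (@continuousM _ _ (fun=> k0) (fun x => u x `^ p)); first exact: cst_continuous.
  apply: (@continuous_comp _ _ _ u (fun t : R => t `^ p)); first exact: cu.
  exact: powR_continuous.
have := weak_touch (O := punctured) (W := weight om mb) (D := annulus e r')
  (u := u) (du := du) (O' := sublevel om mb T)
  (psi := fun x => M + A + barrier D T m (tau x)) (g := g) (x0 := x0)
  open_punctured (smooth_weight om mb) oA AP (@open_sublevel _ _ om mb T)
  (smooth_barrier D (M + A) m T0) De (conj x00 xT)
  (fun x Ax => cu x (Apb x Ax)) (fun s ss => (su e ee s ss).1) nu ux0 cg.
have ae1 : {ae leb n, forall x, annulus e r' x -> g x <= \sum_i du [:: i; i] x +
    \sum_i pd i (weight om mb) x * du [:: i] x}.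
  apply: filterS (filterI aeK aeu) => x [hK hu] Ax.
  have px := Apb x Ax; rewrite -Lop_drift//; last exact: AP.
  apply: le_trans (hu px); rewrite /g ler_wpM2r ?powR_ge0//; apply: hK.
  by case/andP: Ax => _ xr; exact: lt_le_trans rr.
move=> /(_ ae1); apply/negP; rewrite -ltNge.
apply: (le_lt_trans (drift_op_barrier_le om1 mb0 (M + A) m D0 T0 (conj x00 xT) qE)).
have C0 : 0 < 9 / 4 * expR 1 * mb ^+ 2.
  by rewrite mulr_gt0 ?exprn_gt0// mulr_gt0 ?expR_gt0// divr_gt0.
apply: (le_lt_trans (barrier_supersolution D0 T0 C0 k00 p1 qp pq mp CT
  (tau_gt0 om mb x0) xT)).
rewrite /g ltr_pM2l// gt0_ltr_powR ?nnegrE ?(ltW Q0) ?(ltW ux00)//.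
  exact: lt_trans p1.
by rewrite ux0 ltrDr ltr_wpDr.
Qed.

(** Suppose that [u x1 > A]. The factor [D] is so small that the barrier is below the
    excess [u x1 - A] at [x1], and then [T] is so large that the barrier is a
    supersolution. The difference of [u] and [A + barrier] has a positive maximum, which is
    interior because the barrier dominates [u] where [tau] is close to [T] and
    [u <= A] on the sphere; this is excluded by [barrier_touch]. *)
Lemma solution_le_sphere (r r' k0 p q A : R) K u du :
  q = 1 + 2 / mb -> q < p -> p <= q + 1 -> 0 < k0 -> 0 <= A ->
  0 < r' <= r -> {ae leb n, forall x, eball r x -> k0 <= K x} ->
  (forall x, pball r' x -> {for x, continuous u}) ->
  (forall e : R, 0 < e < r' -> sobolev_with 2 n%:R (annulus e r') u du) ->
  {ae leb n, forall x, pball r' x ->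
    K x * u x `^ p <= Lop lap_coef (drift om mb) du x} ->
  (forall x, enorm x = r' / 2 -> u x <= A) ->
  forall x, 0 < enorm x <= r' / 2 -> u x <= A.
Proof.
move=> qE qp pq k00 A0 /andP[r'0 rr] aeK cu su aeu uA x1 /andP[x10 x1r].
rewrite leNgt; apply/negP => ux1.
have px1 : punctured x1 by rewrite /punctured /= -enorm_gt0.
have p1 : 1 < p by apply: lt_trans qp; rewrite qE ltrDl divr_gt0.
pose t1 := tau x1; have t10 : 0 < t1 := tau_gt0 om mb x1.
have [m mp m1] : exists2 m : nat, 2 <= m%:R * (p - 1) & (0 < m)%N.
  exists (Num.truncn (2 / (p - 1))).+1 => //.
  by rewrite -ler_pdivrMr ?subr_gt0// ltW// truncnS_gt.
(* the factor [2 ^+ m] bounds [blow T t1 ^+ m] as soon as [2 * t1 <= T] *)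
have [D D0 DE] : exists2 D : R, 0 < D & D * t1 * 2 ^+ m = (u x1 - A) / 2.
  exists ((u x1 - A) / (2 * (t1 * 2 ^+ m))).
    by rewrite divr_gt0 ?subr_gt0// !mulr_gt0// exprn_gt0.
  have m0 : (2 : R) ^+ m != 0 by rewrite expf_neq0// pnatr_eq0.
  by field; rewrite m0 lt0r_neq0.
pose C := 9 / 4 * expR 1 * mb ^+ 2 * (2 * m%:R + m%:R * m.+1%:R).
have C0 : 0 < C.
  rewrite mulr_gt0//; first by rewrite mulr_gt0 ?exprn_gt0// mulr_gt0 ?expR_gt0// divr_gt0.
  by rewrite addr_gt0 ?mulr_gt0 ?ltr0n.
have kD0 : 0 < k0 * D `^ (p - 1) by rewrite mulr_gt0// powR_gt0.
have [T T2 CT] : exists2 T : R, 2 * t1 <= T & C <= k0 * D `^ (p - 1) * T `^ (p - q).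
  pose X := C / (k0 * D `^ (p - 1)).
  have X0 : 0 <= X by rewrite divr_ge0// ltW.
  exists (Num.max (2 * t1) (X `^ (p - q)^-1)); first by rewrite le_max lexx.
  have pq0 : p - q != 0 by rewrite subr_eq0 gt_eqF.
  rewrite mulrC -ler_pdivrMr//.
  apply: (@le_trans _ _ ((X `^ (p - q)^-1) `^ (p - q))).
    by rewrite -powRrM mulVf// powRr1.
  rewrite ge0_ler_powR ?nnegrE ?powR_ge0 ?subr_ge0 ?(ltW qp)//.
    by rewrite le_max powR_ge0 orbT.
  by rewrite le_max lexx orbT.
have t1T : t1 < T by apply: lt_le_trans T2; rewrite mulr_natl mulr2n ltrDl.
have T0 : 0 < T := lt_trans t10 t1T.
have [e e0 he] := tau_large (n := n) om1 mb0 T0.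
have r20 : r' / 2 < r' by rewrite ltr_pdivrMr// mulr_natr mulr2n ltrDl.
have Sp : shell e (r' / 2) `<=` @pball R n r'.
  move=> x Sx; apply/pballE; split; last exact: (shell_punctured e0 Sx).
  by case/andP: Sx => _ h; exact: le_lt_trans r20.
have [B B0 hB] : exists2 B, 0 < B & forall x, shell e (r' / 2) x -> `|u x| <= B.
  by apply: (@continuous_compact_bound _ _ (pball r')) => //; exact: compact_shell.
(* the level [T1] of [tau] is where [blow] reaches [z0], which makes the barrier exceed
   the bound [B] of [u] while keeping [t1 <= T1] *)
pose z0 := Num.max 2 (B / (D * t1) + 1).
have z02 : 2 <= z0 by rewrite le_max lexx.
have z00 : 0 < z0 by exact: lt_le_trans z02.
pose T1 := T - T / z0.
have T1T : T1 < T by rewrite gtrBl divr_gt0.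
have t1T1 : t1 <= T1.
  have h : T / z0 <= T / 2 by rewrite ler_pM2l// lef_pV2 ?posrE.
  by rewrite /T1; lra.
have T10 : 0 < T1 := lt_le_trans t10 t1T1.
have blT1 : blow T T1 = z0.
  rewrite /blow /T1; have Tn0 := lt0r_neq0 T0; have zn0 := lt0r_neq0 z00.
  by rewrite mulrBl divff// opprB addrC subrK mulrAC divff// mul1r invrK.
have QT1 : B < barrier D T m T1.
  have hBz : B < D * t1 * z0.
    rewrite mulrC -ltr_pdivrMr; last exact: mulr_gt0 D0 t10.
    by apply: (@lt_le_trans _ _ (B / (D * t1) + 1)); rewrite ?ltrDl// le_max lexx orbT.
  apply: (lt_le_trans hBz); rewrite /barrier blT1 -!mulrA ler_pM2l//.
  apply: ler_pM => //; rewrite ?(ltW t10) ?(ltW z00)//.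
  by apply: ler_eXnr => //; apply: le_trans z02; rewrite ler1n.
pose G : set V := shell e (r' / 2) `&` [set x | tau x <= T1].
have Gx1 : G x1.
  split => //; apply/andP; split => //; rewrite leNgt; apply/negP => h.
  by have := he _ px1 (ltW h); rewrite ltNge (le_trans _ (ltW T1T)).
have GP x : G x -> punctured x by move=> [Sx _]; exact: (shell_punctured e0 Sx).
have GT x : G x -> sublevel om mb T x.
  by move=> Gx; split; [exact: GP|case: Gx => _ /= h; exact: le_lt_trans T1T].
have cG : compact G.
  apply: (subclosed_compact _ (@compact_shell _ _ e (r' / 2))); last by move=> x [].
  move=> x clx; have Sx : shell e (r' / 2) x.
    have clS : closed (shell e (r' / 2) : set V).
      by apply: compact_closed; [exact: norm_hausdorff|exact: compact_shell].
    by apply: clS => N /clx[y [[Sy _] Ny]]; exists y.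
  split => //=; rewrite leNgt; apply/negP => h.
  have ct := smooth_on_continuous (smooth_tau om mb) (shell_punctured e0 Sx).
  have [y [[_ /= ty] ty']] := clx _ (cvgr_gt _ ct _ h).
  by move: ty'; rewrite /= ltNge ty.
pose F x := u x - (A + barrier D T m (tau x)).
have cF x : G x -> {for x, continuous F}.
  move=> Gx; apply: (@continuousB _ _ _ u (fun x => A + barrier D T m (tau x))).
    by apply: cu; apply: Sp; case: Gx.
  exact: (smooth_on_continuous (smooth_barrier D A m T0) (GT _ Gx)).
have [x0 /set_mem Gx0 Fmax] : exists2 c, c \in G & forall t, t \in G -> F t <= F c.
  apply: compact_EVT_max => //; first by exists x1.
  by apply: continuous_in_subspaceT => x /set_mem; exact: cF.
have Fx1 : 0 < F x1.
  have z1 : blow T t1 <= 2.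
    have t1T2 : t1 / T <= 2^-1 by rewrite ler_pdivrMr// ler_pdivlMl.
    by rewrite /blow -[leRHS]invrK lef_pV2 ?posrE ?invr_gt0 ?blow_arg_gt0//; lra.
  have z10 : 0 <= blow T t1 by rewrite ltW// blow_gt0.
  have : barrier D T m t1 <= D * t1 * 2 ^+ m.
    by rewrite /barrier ler_pM2l ?mulr_gt0// lerXn2r ?nnegrE.
  by rewrite DE /F -/t1; move: ux1; lra.
have Fx0 : 0 < F x0 by apply: (lt_le_trans Fx1); apply: Fmax; exact: mem_set.
have [Sx0 /= tx0] := Gx0; have px0 := GP _ Gx0.
have tx0T : tau x0 < T := le_lt_trans tx0 T1T.
have Q0 : 0 < barrier D T m (tau x0) by apply: barrier_gt0 => //; exact: tau_gt0.
have x0r : enorm x0 < r' / 2.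
  rewrite lt_neqAle; case/andP: (Sx0) => _ ->; rewrite andbT; apply/eqP => h.
  by move: Fx0; rewrite /F; have := uA _ h; move: Q0; lra.
have x0e : e < enorm x0.
  rewrite lt_neqAle; case/andP: (Sx0) => -> _; rewrite andbT; apply/eqP => h.
  have := he _ px0; rewrite h lexx => /(_ isT).
  by rewrite ltNge (ltW tx0T).
have tx0T1 : tau x0 < T1.
  rewrite lt_neqAle tx0 andbT; apply/eqP => h.
  have := le_trans (ler_norm _) (hB _ Sx0).
  by move: Fx0; rewrite /F h; move: QT1; lra.
have nG : \forall x \near x0, G x.
  have ct := smooth_on_continuous (smooth_tau om mb) px0.
  have n1 : \forall x \near x0, tau x < T1 by exact: (cvgr_lt _ ct).
  have n2 : nbhs x0 (annulus e (r' / 2)).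
    by apply: open_nbhs_nbhs; split; [exact: open_annulus|apply/andP].
  apply: filterS2 n1 n2 => x /ltW tx Ax; split => //; exact: annulus_shell.
apply: (@barrier_touch r r' k0 p q D T A (F x0) m K u du x0) => //.
- exact: Sp.
- apply: filterS nG => x Gx; have := Fmax x (mem_set Gx).
  by rewrite {1}/F lerBlDr addrA.
- by rewrite /F -addrA subrK.
Qed.

(** The bound by the maximum on a sphere is incompatible with the singularity. *)
Lemma no_singular_solution (r k0 p q : R) K :
  q = 1 + 2 / mb -> q < p -> p <= q + 1 -> 0 < k0 ->
  {ae leb n, forall x, eball r x -> k0 <= K x} ->
  ~ exists u, singular_solution r lap_coef (drift om mb) K p u.
Proof.
move=> qE qp pq k00 aeK [u [[r' rr [du [u0 cu su aeu]]] lu]].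
have /andP[r'0 _] := rr.
have r20 : 0 < r' / 2 by rewrite divr_gt0.
have r2r : r' / 2 < r' by rewrite ltr_pdivrMr// mulr_natr mulr2n ltrDl.
have [A A0 hA] : exists2 B, 0 < B &
    forall x, shell (r' / 2) (r' / 2) x -> `|u x| <= B.
  apply: (@continuous_compact_bound _ _ (pball r')) => //; first exact: compact_shell.
  move=> x Sx; apply/pballE; split; last exact: (shell_punctured r20 Sx).
  by case/andP: Sx => _ h; exact: le_lt_trans r2r.
have uA := solution_le_sphere qE qp pq k00 (ltW A0) rr aeK cu su aeu.
have {}uA x : 0 < enorm x <= r' / 2 -> u x <= A.
  apply: uA => y yr; apply: (le_trans (ler_norm _)); apply: hA.
  by apply/andP; rewrite yr.
suff : (limf_esup (EFin \o u) (0%R : V)^' <= A%:E)%E by rewrite lu leye_eq.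
rewrite limf_esupE; apply: ge_ereal_inf.
exists (ereal_sup ((EFin \o u) @` (pball (r' / 2)))); last first.
  apply: ge_ereal_sup => _ [x /pballE[xr x0] <-]; rewrite lee_fin; apply: uA.
  by rewrite enorm_gt0 x0 ltW.
exists (pball (r' / 2)) => //.
have : nbhs (0 : V) (eball (r' / 2)).
  apply: open_nbhs_nbhs; split; first exact: open_eball.
  by rewrite /eball /= /enorm dotE /sqdist big1 ?sqrtr0// => i _; rewrite subrr expr2 mulr0.
by apply: filterS => x xr x0; apply/pballE.
Qed.

End comparison.

(** * Oscillation of Psi *)

Section essential_bounds.
Context {R : realType} {n : nat}.
Local Notation V := 'cV[R]_n.
Implicit Types (x : V) (D : set V) (f : V -> R).

(** Nonempty open sets have positive measure, so that essential bounds of a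
    function control its values at all points of continuity. *)
Lemma ess_sup_on_ge D f x : nbhs x D -> {for x, continuous f} ->
  ((f x)%:E <= ess_sup_on D (EFin \o f))%E.
Proof.
move=> Dx cf; apply: le_ereal_inf_tmp => y /= aey; rewrite leNgt; apply/negP => yf.
have [z zy yz] : exists2 z : R, (y <= z%:E)%E & z < f x.
  move: y yf {aey} => [y||]//=; first by rewrite lte_fin => ?; exists y.
  by move=> _; exists (f x - 1); rewrite ?leNye// ltrBlDr ltrDl.
have A : nbhs x (D `&` [set t | z < f t]).
  apply: filterI => //; apply: (cf [set t | z < t]).
  by apply: open_nbhs_nbhs; split => //; exact: open_gt.
have [t [Dt zt] /(_ Dt) /= ft] := ae_open_exists aey A.
by have := le_trans ft zy; rewrite lee_fin leNgt zt.
Qed.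

Lemma ess_inf_on_le D f x : nbhs x D -> {for x, continuous f} ->
  (ess_inf_on D (EFin \o f) <= (f x)%:E)%E.
Proof.
move=> Dx cf; apply: ge_ereal_sup => y /= aey; rewrite leNgt; apply/negP => yf.
have [z zy yz] : exists2 z : R, (z%:E <= y)%E & f x < z.
  move: y yf {aey} => [y||]//=; first by rewrite lte_fin => ?; exists y.
  by move=> _; exists (f x + 1); rewrite ?leey// ltrDl.
have A : nbhs x (D `&` [set t | f t < z]).
  apply: filterI => //; apply: (cf [set t | t < z]).
  by apply: open_nbhs_nbhs; split => //; exact: open_lt.
have [t [Dt zt] /(_ Dt) /= ft] := ae_open_exists aey A.
by have := le_trans zy ft; rewrite lee_fin leNgt zt.
Qed.

Lemma ess_sup_on_lim_ge f (c : R) :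
  (forall r, 0 < r -> exists x, [/\ eball r x, {for x, continuous f} & c <= f x]) ->
  (c%:E <= lim (ess_sup_on (eball r) (EFin \o f) @[r --> 0^'+]))%E.
Proof.
move=> H; apply: lime_ge.
  apply: nondecreasing_at_right_is_cvge.
  near=> z => r s _ _ rs; apply: le_ereal_inf => y /=.
  by apply: filterS => x h xr; apply: h; exact: lt_le_trans rs.
near=> r; have r0 : 0 < r by [].
have [x [xr cf cx]] := H r r0.
apply: le_trans (ess_sup_on_ge _ cf); first by rewrite lee_fin.
by apply: open_nbhs_nbhs; split => //; exact: open_eball.
Unshelve. all: by end_near. Qed.

Lemma ess_inf_on_lim_le f (c : R) :
  (forall r, 0 < r -> exists x, [/\ eball r x, {for x, continuous f} & f x <= c]) ->
  (lim (ess_inf_on (eball r) (EFin \o f) @[r --> 0^'+]) <= c%:E)%E.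
Proof.
move=> H; apply: lime_le.
  apply: nonincreasing_at_right_is_cvge.
  near=> z => r s _ _ rs; apply: le_ereal_sup => y /=.
  by apply: filterS => x h xr; apply: h; exact: lt_le_trans rs.
near=> r; have r0 : 0 < r by [].
have [x [xr cf cx]] := H r r0.
apply: le_trans (ess_inf_on_le _ cf) _; last by rewrite lee_fin.
by apply: open_nbhs_nbhs; split => //; exact: open_eball.
Unshelve. all: by end_near. Qed.

End essential_bounds.

Section gram.
Context {R : realType} {n : nat}.
Local Notation V := 'cV[R]_n.
Implicit Types (x : V) (g A : 'M[R]_n).

Lemma smooth_sqdist_mulmx A : smooth_on setT (fun x : V => sqdist 0 (A *m x)).
Proof.
apply: (smooth_on_eq (g := fun x => \sum_i
    ((\sum_j A i j * x j 0) * (\sum_j A i j * x j 0)))).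
- exact: openT.
- by move=> x _; apply: eq_bigr => i _; rewrite !mxE subr0 expr2.
- have sl i : smooth_on setT (fun x : V => \sum_j A i j * x j 0).
    apply: smooth_on_sum => [|j]; first exact: openT.
    by apply: smooth_onZ; [exact: openT|exact: smooth_on_coord].
  apply: smooth_on_sum => [|i]; first exact: openT.
  by apply: smooth_onM => //; exact: openT.
Qed.

Lemma continuous_sqdist_mulmx A : continuous (fun x : V => sqdist 0 (A *m x)).
Proof. by move=> x; apply: smooth_on_continuous (smooth_sqdist_mulmx A) _. Qed.

(** The Cauchy-Schwarz inequality in the form [2 |x . y| <= |x|^2 + |y|^2]. *)
Lemma dot_le x (y : V) (s : R) : sqdist 0 x <= s -> sqdist 0 y <= s -> `|dot x y| <= s.
Proof.
move=> xs ys.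
have E (e : R) : e ^+ 2 = 1 -> 0 <= sqdist 0 x + sqdist 0 y - 2 * e * dot x y.
  move=> e2; rewrite /sqdist /dot mulr_sumr -big_split -sumrB /=; apply: sumr_ge0 => i _.
  rewrite !mxE !subr0 (_ : _ - _ = (x i 0 - e * y i 0) ^+ 2) ?sqr_ge0//.
  by rewrite sqrrB exprMn e2; ring.
have := E 1 (expr1n _ 2); have := E (- 1) (etrans (sqrrN 1) (expr1n _ 2)).
by rewrite ler_norml; lra.
Qed.

(** The entries of [g^T *m col i g] are the inner products of the columns of [g] with the
    longest one; the [i]-th is its squared length, which bounds the others. *)
Lemma gram_bounds g i : (forall j, sqdist 0 (col j g) <= sqdist 0 (col i g)) ->
  sqdist 0 (col i g) ^+ 2 <= sqdist 0 (g^T *m col i g) <= n%:R * sqdist 0 (col i g) ^+ 2.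
Proof.
move=> hi; set s := sqdist 0 (col i g).
have E j : (g^T *m col i g) j 0 = dot (col j g) (col i g).
  by rewrite mxE; apply: eq_bigr => k _; rewrite !mxE.
apply/andP; split.
  have := sqdist_ge 0 (g^T *m col i g) i; rewrite E mxE subr0 dotE.
  by [].
have -> : n%:R * s ^+ 2 = \sum_(j < n) s ^+ 2 by rewrite sumr_const card_ord mulr_natl.
apply: ler_sum => j _; rewrite E mxE subr0 -[leLHS]real_normK ?num_real//.
by rewrite lerXn2r ?nnegrE ?normr_ge0 ?sqdist_ge0//; apply: dot_le => //; exact: hi.
Qed.

Lemma trace_gram g : \tr (g *m g^T) = \sum_j sqdist 0 (col j g).
Proof.
rewrite mxtrace_mulC; apply: eq_bigr => j _; rewrite mxE; apply: eq_bigr => k _.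
by rewrite !mxE subr0 expr2.
Qed.

End gram.

Section oscillation.
Context {R : realType} {n : nat}.
Local Notation V := 'cV[R]_n.
Implicit Types (x y : V) (g : 'M[R]_n).
Variables (om mb : R).
Hypotheses (om1 : 1 <= om).
Local Notation Psi_osc := (Psi lap_coef (drift om mb)).

Lemma Psi_laplace_drift g x : g \in unitmx ->
  Psi_osc g x = (\tr (g *m g^T) + weight_slope (n := n) om mb (lognorm (invmx g *m x)) /
      sqdist 0 (invmx g *m x) * sqdist 0 x) / (sqdist 0 (g^T *m x) / sqdist 0 x).
Proof.
move=> gu; rewrite /Psi /transport_mx /transport_cV /lap_coef mulmx1 enormE.
congr ((_ + _) / (_ / _)).
- have -> : drift om mb (invmx g *m x) = (weight_slope (n := n) om mb (lognorm (invmx g *m x)) /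
      sqdist 0 (invmx g *m x)) *: (invmx g *m x).
    by apply/matrixP => i j; rewrite [j]ord1 [LHS]mxE [RHS]mxE mulrAC mulrA.
  rewrite -scalemxAr mulKVmx// -[sqdist 0 x]dotE /dot mulr_sumr; apply: eq_bigr => i _.
  by rewrite mxE mulrA.
- rewrite -[RHS]dotE /dot -mulmxA.
  transitivity ((x^T *m (g *m (g^T *m x))) 0 0).
    by rewrite mxE; apply: eq_bigr => i _; rewrite [x^T _ _]mxE mulrC.
  rewrite mulmxA -{1}[g]trmxK -trmx_mul mxE.
  by apply: eq_bigr => i _; rewrite mxE.
Qed.

Lemma continuous_weight_slope : continuous (weight_slope (n := n) om mb).
Proof.
have c1 : continuous (stretch1 om).
  move=> t; apply: differentiable_continuous; apply/derivable1_diffP.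
  by have [] := is_derive_stretch1 om t.
have c2 : continuous (stretch2 om).
  move=> t; apply: cvgM; first exact: cvg_cst.
  apply: (@continuous_comp _ _ _ (fun s : R => om * s) sin); last exact: continuous_sin.
  by apply: cvgM; [exact: cvg_cst|exact: cvg_id].
move=> t; apply: cvgD; last by apply: cvgM; [exact: cvg_cst|exact: c1].
apply: cvgB; first exact: cvg_cst.
by apply: cvgM; [exact: c2|apply: cvgV; [exact: lt0r_neq0 (stretch1_gt0 om t)|exact: c1]].
Qed.

Lemma continuous_Psi g x : g \in unitmx -> x != 0 -> {for x, continuous (Psi_osc g)}.
Proof.
move=> gu x0.
rewrite (_ : Psi_osc g = fun x => (\tr (g *m g^T) +
      weight_slope (n := n) om mb (lognorm (invmx g *m x)) /
      sqdist 0 (invmx g *m x) * sqdist 0 x) / (sqdist 0 (g^T *m x) / sqdist 0 x)); last first.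
  by apply/funext => y; exact: Psi_laplace_drift.
have n0 (A : 'M[R]_n) : A \in unitmx -> 0 < sqdist 0 (A *m x).
  move=> Au; rewrite sqdist0_gt0; apply: contra_neq x0 => Ax.
  by rewrite -[x](mulKmx Au) Ax mulmx0.
have giu : invmx g \in unitmx by rewrite unitmx_inv.
have gtu : g^T \in unitmx by rewrite unitmx_tr.
have cd : {for x, continuous (sqdist 0)} := @continuous_sqdist _ _ 0 x.
have d0 : sqdist 0 x != 0 by rewrite lt0r_neq0// sqdist0_gt0.
have ci : {for x, continuous (fun x => sqdist 0 (invmx g *m x))} :=
  @continuous_sqdist_mulmx _ _ _ _.
have ct : {for x, continuous (fun x => sqdist 0 (g^T *m x))} := @continuous_sqdist_mulmx _ _ _ _.
have cv (f : V -> R) : f x != 0 -> {for x, continuous f} ->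
    {for x, continuous (fun y => (f y)^-1)}.
  by move=> f0 cf; exact: (@continuousV _ _ f x f0 cf).
have cl : {for x, continuous (fun x => ln (sqdist 0 (invmx g *m x)))}.
  apply: (@continuous_comp _ _ _ (fun x => sqdist 0 (invmx g *m x)) (@ln R)) => //.
  exact: continuous_ln (n0 _ giu).
have cw : {for x, continuous (fun x => weight_slope (n := n) om mb (lognorm (invmx g *m x)))}.
  apply: (@continuous_comp _ _ _ (fun x => lognorm (invmx g *m x)) (weight_slope om mb));
    last exact: continuous_weight_slope.
  exact: continuousM (@cst_continuous _ _ (2^-1 : R) x) cl.
have c1 := continuousM (continuousM cw (cv _ (lt0r_neq0 (n0 _ giu)) ci)) cd.
have c2 := continuousD (@cst_continuous _ _ (\tr (g *m g^T)) x) c1.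
have c3 : {for x, continuous (fun y => (sqdist 0 (g^T *m y) / sqdist 0 y)^-1)}.
  apply: (cv _); first by rewrite mulf_neq0 ?invr_eq0// lt0r_neq0// n0.
  exact: continuousM ct (cv _ d0 cd).
exact: continuousM c2 c3.
Qed.

(** The image under [g] of the [i]-th coordinate axis is the direction in which
    the value of [Psi] is tested. *)
Lemma Psi_axis g i (t : R) : g \in unitmx ->
  let x := g *m (expR t *: delta_mx i 0) : V in
  [/\ x != 0, enorm x ^+ 2 = expR t ^+ 2 * sqdist 0 (col i g) &
  Psi_osc g x = (\sum_j sqdist 0 (col j g) + weight_slope (n := n) om mb t * sqdist 0 (col i g)) *
    sqdist 0 (col i g) / sqdist 0 (g^T *m col i g)].
Proof.
move=> gu x.
have dZ (c : R) (y : V) : sqdist 0 (c *: y) = c ^+ 2 * sqdist 0 y.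
  rewrite /sqdist mulr_sumr; apply: eq_bigr => k _.
  by rewrite !mxE !subr0 exprMn.
have xE : x = expR t *: col i g.
  by rewrite /x -scalemxAr -colE.
have e0 : expR t != 0 :> R by rewrite lt0r_neq0// expR_gt0.
have d1 : sqdist 0 (delta_mx i 0 : V) = 1.
  rewrite /sqdist (bigD1 i)//= big1 => [|j ji].
    by rewrite addr0 !mxE !eqxx subr0 expr1n.
  by rewrite !mxE (negbTE ji) /= subr0 expr2 mulr0.
have x0 : x != 0.
  apply/eqP => /(congr1 (mulmx (invmx g))); rewrite /x mulKmx// mulmx0 => h.
  have := dZ (expR t) (delta_mx i 0); rewrite h d1 mulr1 -dotE /dot big1 => [|k _].
    by move/eqP; rewrite eq_sym expf_eq0 /= (negbTE e0).
  by rewrite mxE mulr0.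
split => //; first by rewrite enormE xE dZ.
have yE : invmx g *m x = expR t *: delta_mx i 0 by rewrite /x mulKmx.
have lgE : lognorm (expR t *: delta_mx i 0 : V) = t.
  by rewrite /lognorm dZ d1 mulr1 lnXn ?expR_gt0// expRK -mulr_natr; field.
have s0 : sqdist 0 (col i g) != 0.
  by rewrite lt0r_neq0// sqdist0_gt0; apply: contra_neq x0 => h; rewrite xE h scaler0.
have t0 : sqdist 0 (g^T *m col i g) != 0.
  rewrite lt0r_neq0// sqdist0_gt0; apply: contra_neq s0 => h.
  have : col i g = 0 by rewrite -[LHS](@mulKmx _ _ _ g^T) ?unitmx_tr// h mulmx0.
  by move=> ->; rewrite -dotE /dot big1// => k _; rewrite mxE mulr0.
rewrite Psi_laplace_drift// trace_gram yE lgE dZ d1 xE -scalemxAr !dZ mulr1.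
move: (\sum_j _) (weight_slope _ _ _) => S b.
move: (sqdist 0 _) (sqdist 0 _) (expR t) s0 t0 e0 => s T e s0 T0 e0.
by field; rewrite s0 T0 e0.
Qed.

Lemma sincos_pihalf (k : nat) :
  (sin (pi / 2 - (pi *+ 2) *+ k) = 1 :> R /\ cos (pi / 2 - (pi *+ 2) *+ k) = 0 :> R) /\
  (sin (- (pi / 2) - (pi *+ 2) *+ k) = - 1 :> R /\ cos (- (pi / 2) - (pi *+ 2) *+ k) = 0 :> R).
Proof.
have H (a : R) : sin (a - (pi *+ 2) *+ k) = sin a /\ cos (a - (pi *+ 2) *+ k) = cos a.
  elim: k a => [|k IH] a; first by rewrite mulr0n subr0.
  have [h1 h2] := IH (a - pi *+ 2); rewrite mulrS opprD addrA h1 h2.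
  by split; rewrite -[in RHS](subrK (pi *+ 2) a) ?sinD2pi ?cosD2pi.
by have [-> ->] := H (pi / 2); have [-> ->] := H (- (pi / 2));
  rewrite sinN cosN sin_pihalf cos_pihalf.
Qed.

(** At [om t = pi / 2] modulo [2 pi] the slope is [2 - n + om / 2 + mb], and at
    [om t = - pi / 2] it is [2 - n - om / 2 + mb]. *)
Lemma weight_slope_oscillates (L : R) : 2 * mb + 6 * n%:R + 4 <= om -> 0 <= mb ->
  (exists2 t, t < L & 2 * n%:R <= weight_slope (n := n) om mb t) /\
  (exists2 t, t < L & weight_slope (n := n) om mb t <= - n%:R).
Proof.
move=> omL mb0; have om0 : 0 < om := lt_le_trans ltr01 om1.
have pi0 := @pi_gt0 R.
have [k hk] : exists k : nat, pi / 2 - (pi *+ 2) *+ k < om * L.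
  pose c := (pi / 2 - om * L) / (pi *+ 2); exists (Num.trunc c).+1.
  have := truncnS_gt c; set m := _.+1 => h.
  have : pi / 2 - om * L < m%:R * (pi *+ 2).
    by rewrite -ltr_pdivrMr; [exact: h|rewrite pmulrn_lgt0].
  by rewrite mulr_natl; lra.
have [[s1 c1] [s2 c2]] := sincos_pihalf k.
have omn0 : om != 0 by rewrite lt0r_neq0.
have E t (s : R) : sin (om * t) = s -> cos (om * t) = 0 ->
    weight_slope (n := n) om mb t = 2 - n%:R + om / 2 * s + mb.
  by move=> st ct; rewrite /weight_slope /stretch1 /stretch2 st ct; field.
have n0 : 0 <= n%:R :> R := ler0n _ _.
split; [exists ((pi / 2 - (pi *+ 2) *+ k) / om) | exists ((- (pi / 2) - (pi *+ 2) *+ k) / om)].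
- by rewrite ltr_pdivrMr// [L * om]mulrC.
- by rewrite (E _ 1) ?(mulrCA om) ?divff ?mulr1//; lra.
- by rewrite ltr_pdivrMr// [L * om]mulrC; apply: lt_trans hk; rewrite ltrD2r; lra.
- by rewrite (E _ (- 1)) ?(mulrCA om) ?divff ?mulr1//; lra.
Qed.

(** Let [s] be the largest squared length of a column of [g], attained at [i]. On the
    image of the [i]-th axis the numerator of [Psi] is [(tr + w' s) s] with
    [0 <= tr <= n s], and its denominator lies in [[s^2, n s^2]]. *)
Lemma Psi_test_points g (r : R) : (0 < n)%N -> 0 <= mb ->
  2 * mb + 6 * n%:R + 4 <= om -> g \in unitmx -> 0 < r ->
  (exists x, [/\ eball r x, {for x, continuous (Psi_osc g)} & 2 <= Psi_osc g x]) /\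
  (exists x, [/\ eball r x, {for x, continuous (Psi_osc g)} & Psi_osc g x <= 0]).
Proof.
move=> n0 mb0 omL gu r0.
have [i hi] : exists i, forall j, sqdist 0 (col j g) <= sqdist 0 (col i g).
  case: (@arg_maxP _ _ _ (Ordinal n0) xpredT (fun j => sqdist 0 (col j g))) => // i _ h.
  by exists i => j; exact: h.
set s := sqdist 0 (col i g).
have s0 : 0 < s.
  have [x0 xE _] := Psi_axis i 0 gu.
  by move: x0; rewrite -sqdist0_gt0 -enormE xE expR0 expr1n mul1r.
have [T1 T2] := andP (gram_bounds hi).
set T := sqdist 0 (g^T *m col i g) in T1 T2.
have T0 : 0 < T by apply: lt_le_trans T1; rewrite exprn_gt0.
have S1 : s <= \sum_j sqdist 0 (col j g).
  by rewrite (bigD1 i)//= lerDl sumr_ge0// => j _; exact: sqdist_ge0.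
have S2 : \sum_j sqdist 0 (col j g) <= n%:R * s.
  rewrite (_ : n%:R * s = \sum_(j < n) s); last by rewrite sumr_const card_ord mulr_natl.
  by apply: ler_sum => j _; exact: hi.
have near0 t : t < ln r - 2^-1 * ln s -> eball r (g *m (expR t *: delta_mx i 0)).
  move=> tL; have [_ xE _] := Psi_axis i t gu.
  rewrite /eball /= -(@ltr_pXn2r _ 2)// ?nnegrE ?enorm_ge0 ?(ltW r0)// xE.
  rewrite -/s -[X in _ * X]lnK ?posrE// -[X in _ < X ^+ 2]lnK ?posrE//.
  by rewrite -!expRM_natl -expRD ltr_expR; lra.
have [[t tL ht] [t' tL' ht']] := weight_slope_oscillates (ln r - 2^-1 * ln s) omL mb0.
split.
- exists (g *m (expR t *: delta_mx i 0)); have [x0 _ ->] := Psi_axis i t gu.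
  split; [exact: near0|exact: continuous_Psi|].
  rewrite ler_pdivlMr// -/s -/T.
  apply: (@le_trans _ _ (2 * (n%:R * s ^+ 2))); first by rewrite ler_pM2l.
  rewrite expr2 !mulrA ler_wpM2r ?(ltW s0)//.
  have h : 2 * n%:R * s <= weight_slope (n := n) om mb t * s by rewrite ler_wpM2r ?(ltW s0).
  by apply: le_trans h _; rewrite lerDr (le_trans (ltW s0)).
- exists (g *m (expR t' *: delta_mx i 0)); have [x0 _ ->] := Psi_axis i t' gu.
  split; [exact: near0|exact: continuous_Psi|].
  rewrite -/s -/T pmulr_lle0 ?invr_gt0// pmulr_lle0//.
  have h : weight_slope (n := n) om mb t' * s <= - n%:R * s by rewrite ler_wpM2r ?(ltW s0).
  by move: h S2; rewrite mulNr; lra.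
Qed.

Lemma Psi_oscillates : (0 < n)%N -> 0 <= mb -> 2 * mb + 6 * n%:R + 4 <= om ->
  (Psi_inf lap_coef (drift om mb : V -> V) < 2%:E)%E /\
  (2%:E <= Psi_sup lap_coef (drift om mb : V -> V))%E.
Proof.
move=> n0 mb0 omL; split.
- apply: (@le_lt_trans _ _ 0%E); last by rewrite lte_fin.
  apply: ge_ereal_sup => _ [g gu <-].
  by apply: ess_inf_on_lim_le => r r0; have [] := Psi_test_points n0 mb0 omL gu r0.
- apply: le_ereal_inf_tmp => _ [g gu <-].
  by apply: ess_sup_on_lim_ge => r r0; have [] := Psi_test_points n0 mb0 omL gu r0.
Qed.

End oscillation.

(** * The coefficients and their critical exponent *)

Section coefficients.
Context {R : realType} {n : nat}.
Local Notation V := 'cV[R]_n.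
Implicit Types (x : V) (D : set V) (f K : V -> R) (r om mb : R).

Lemma Linfty_bounded D f B : measurable_fun D f ->
  (forall x, D x -> `|f x| <= B) -> Linfty D f.
Proof.
move=> mf fB; split => //; apply: (@le_lt_trans _ _ B%:E); last exact: ltry.
by apply: ereal_inf_lbound; apply: aeW => x Dx; rewrite lee_fin; exact: fB.
Qed.

Lemma Linfty_ae_le D f : Linfty D f ->
  exists2 M, 0 < M & {ae leb n, forall x, D x -> f x <= M}.
Proof.
move=> [_ /ereal_inf_lt[y /= aey yoo]].
exists (Num.max (fine y) 1); first by rewrite lt_max ltr01 orbT.
apply: filterS aey => x h Dx; rewrite le_max; apply/orP; left.
have {h} := h Dx; move: y yoo => [y||]//= _; rewrite lee_fin.
exact: le_trans (ler_norm _).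
Qed.

Lemma ess_inf_on_ae_ge D f : (0 < ess_inf_on D (EFin \o f))%E ->
  exists2 k, 0 < k & {ae leb n, forall x, D x -> k <= f x}.
Proof.
move=> /ereal_sup_gt[y /= aey y0].
have [k k0 ky] : exists2 k : R, 0 < k & (k%:E <= y)%E.
  move: y y0 {aey} => [y||]//= y0; first by exists y.
  by exists 1 => //; rewrite leey.
exists k => //; apply: filterS aey => x h Dx.
by have := le_trans ky (h Dx); rewrite lee_fin.
Qed.

Lemma elliptic_lap_coef r : elliptic r (lap_coef : V -> 'M[R]_n).
Proof.
split.
- move=> i j; apply: (@Linfty_bounded _ _ `|(1%:M : 'M[R]_n) i j|); first exact: measurable_cst.
  by [].
- by apply: aeW => x _; rewrite trmx1.
- exists 2; first by rewrite ltr1n.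
  apply: aeW => x _ xi.
  have -> : \sum_i \sum_j lap_coef x i j * xi i 0 * xi j 0 = enorm xi ^+ 2.
    rewrite enormE -dotE; apply: eq_bigr => i _.
    rewrite (bigD1 i)//= big1 => [|j ji]; first by rewrite addr0 mxE eqxx mul1r.
    by rewrite mxE eq_sym (negbTE ji) !mul0r.
  have := sqr_ge0 (enorm xi); lra.
Qed.

Lemma drift_growth_drift r om mb : 1 <= om ->
  drift_growth r (drift om mb : V -> V).
Proof.
move=> om1; pose c := 2 + n%:R + om + `|mb| * 2.
have c0 : 0 < c.
  by rewrite /c -!addrA ltr_pwDl// !addr_ge0 ?mulr_ge0 ?(le_trans ler01 om1).
have db x i : punctured x -> `|drift om mb x i 0| <= c / enorm x.
  move=> x0; have e0 : 0 < enorm x by rewrite enorm_gt0.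
  rewrite mxE normrM ler_pM ?weight_slope_le// -enormE normrM normfV normrX (ger0_norm (ltW e0)).
  rewrite ler_pdivrMr ?exprn_gt0// expr2 mulKf ?lt0r_neq0//.
  exact: coord_enorm_le.
have sd i x : punctured x -> {for x, continuous (fun y => drift om mb y i 0)}.
  have sw : smooth_on punctured ('D_(delta_mx i 0) (weight om mb)).
    by apply: smooth_on_pd; exact: smooth_weight.
  have sb : smooth_on punctured (fun y : V => drift om mb y i 0).
    apply: smooth_on_eq sw; first exact: open_punctured.
    by move=> y y0; rewrite pd_weight.
  exact: smooth_on_continuous sb.
split.
  move=> i C cC Cr.
  have Cp : C `<=` punctured by move=> x /Cr /pballE[].
  have [B _ hB] := continuous_compact_bound (sd i) cC Cp.
  apply: (@Linfty_bounded _ _ B) => //.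
  apply: (measurable_funS _ Cp); first exact: open_measurable_cV open_punctured.
  exact: measurable_fun_continuous_open open_punctured (sd i).
exists c => //; apply: aeW => x /pballE[_ x0] i; exact: db.
Qed.

(** If [mb * (p - 1) < 2], there is room for a rate [al] with [mb < al < 2 / (p - 1)].
    In the other direction, the exponents [p] slightly above [1 + 2 / mb] already
    bring the infimum down to this value. *)
Lemma critical_exponent_drift r K om mb (q : \bar R) : (0 < n)%N -> 0 < r ->
  1 <= om -> Linfty (eball r) K -> (0 < ess_inf_on (eball r) (EFin \o K))%E ->
  (q = +oo%E /\ mb = 0) \/ (0 < mb /\ q = (1 + 2 / mb)%:E) ->
  critical_exponent r lap_coef (drift om mb : V -> V) K = q.
Proof.
move=> n0 r0 om1 /Linfty_ae_le[Km Km0 aeKm] /ess_inf_on_ae_ge[k0 k00 aek0] qmb.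
have mb0 : 0 <= mb by case: qmb => [[_ ->]|[/ltW]].
have ex p : 1 < p -> mb * (p - 1) < 2 ->
    exists u, singular_solution r lap_coef (drift om mb) K p u.
  move=> p1 mbp; have p10 : 0 < p - 1 by rewrite subr_gt0.
  pose al := (mb + 2 / (p - 1)) / 2.
  have h : mb < 2 / (p - 1) by rewrite ltr_pdivlMr.
  exists (power_solution om al).
  apply: (@singular_solution_exists _ _ _ _ om1 n0 r K p al Km) => //.
  - by rewrite /al; lra.
  - by rewrite -ltr_pdivlMr// /al; lra.
case: qmb => [[-> mbE]|[mb1 ->]].
  rewrite /critical_exponent (_ : [set p%:E | p in _] = set0) ?ereal_inf0//.
  apply/seteqP; split => // t [p [p1 np] _]; apply: np; apply: ex => //.
  by rewrite mbE mul0r.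
apply/eqP; rewrite eq_le; apply/andP; split; last first.
  apply: le_ereal_inf_tmp => _ [p [p1 np] <-]; rewrite lee_fin leNgt.
  apply/negP => pq; apply: np; apply: ex => //.
  by rewrite mulrC -ltr_pdivlMr// ltrBlDl.
apply/lee_addgt0Pr => e e0.
have mb2 : 0 < 2 / mb by rewrite divr_gt0.
have m0 : 0 < Num.min e 1 by rewrite lt_min e0 ltr01.
have [me m1] : Num.min e 1 <= e /\ Num.min e 1 <= 1.
  by split; rewrite ge_min lexx ?orbT.
pose p := 1 + 2 / mb + Num.min e 1.
apply: (@le_trans _ _ p%:E); last by rewrite -EFinD lee_fin lerD2l.
apply: ereal_inf_lbound; exists p => //; split; first by rewrite /p; lra.
apply: (no_singular_solution om1 mb1 (erefl _) _ _ k00 aek0).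
- by rewrite /p ltrDl.
- by rewrite /p lerD2l.
Qed.

End coefficients.

Theorem theorem1p7 (R : realType) (N : nat) (hN : (1 <= N)%N)
  (r : R) (hr : 0 < r)
  (K : 'cV[R]_N -> R) (hK : Linfty (eball r) K)
  (hK0 : (0 < ess_inf_on (eball r) (EFin \o K))%E)
  (q : \bar R) (hq : (1 < q)%E) :
  exists (a : 'cV[R]_N -> 'M[R]_N) (b : 'cV[R]_N -> 'cV[R]_N),
    [/\ elliptic r a,
        drift_growth r b,
        critical_exponent r a b K = q &
        (Psi_inf a b < 2%:E)%E /\ (2%:E <= Psi_sup a b)%E].
Proof.
have [mb mb0 qmb] : exists2 mb : R, 0 <= mb &
    (q = +oo%E /\ mb = 0) \/ (0 < mb /\ q = (1 + 2 / mb)%:E).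
  move: q hq => [q||]//=; last by exists 0 => //; left.
  rewrite lte_fin -subr_gt0 => q1; have m0 : 0 < 2 / (q - 1) by rewrite divr_gt0.
  exists (2 / (q - 1)); first exact: ltW.
  right; split => //; congr EFin.
  by rewrite invf_div mulrC divfK ?pnatr_eq0// addrC subrK.
pose om := 2 * mb + 6 * N%:R + 4 : R.
have om1 : 1 <= om by rewrite /om; have : 0 <= N%:R :> R := ler0n _ _; lra.
exists lap_coef, (drift om mb); split.
- exact: elliptic_lap_coef.
- exact: drift_growth_drift.
- exact: critical_exponent_drift.
- exact: Psi_oscillates.
Qed.
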